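(* Let $\Omega\subset\mathbb{R}^3$ be an open, bounded, connected set with smooth boundary, and let $T>0$. Assume $F(t,x,v)$ is continuous on $[0,T]\times\big((\Omega\times\mathbb{R}^3)\setminus\mathfrak G\big)$ and $$\|\bar w^{-1}F\|_{L^\infty([0,T]\times\bar\Omega\times\mathbb{R}^3)}<+\infty,\qquad \bar w(v)=\frac{e^{-|v|^2/4}}{(1+\rho^2|v|^2)^\beta},$$ with $\rho\in\mathbb{R}$ and $\beta>0$. Then $Q_+(F,F)(t,x,v)$ is continuous in $[0,T]\times\Omega\times\mathbb{R}^3$ and $$\sup_{[0,T]\times\bar\Omega\times\mathbb{R}^3}\big|\nu^{-1}(v)\,\bar w^{-1}(v)\,Q_+(F,F)(t,x,v)\big|<\infty.$$
   Context: **Grazing set.** $n(x)$ is the outward unit normal at $x\in\partial\Omega$. For $(x,v)\in\bar\Omega\times\mathbb{R}^3$, $t_{\mathbf b}(x,v)=\sup(\{0\}\cup\{\tau>0:x-sv\in\Omega\text{ for all }0<s<\tau\})$, $x_{\mathbf b}(x,v)=x-t_{\mathbf b}(x,v)v$, and $\mathfrak G=\{(x,v)\in\bar\Omega\times\mathbb{R}^3:n(x_{\mathbf b}(x,v))\cdot v=0\}$. **Gain term.** $Q_+(F_1,F_2)(v)=\int_{\mathbb{R}^3}\int_{\mathbb{S}^2}B(v-u,\omega)F_1(u')F_2(v')\,d\omega\,du$ (acting in $v$ for fixed $t,x$), with $u'=u+[(v-u)\cdot\omega]\omega$, $v'=v-[(v-u)\cdot\omega]\omega$, $B(v-u,\omega)=|v-u|^\gamma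 q_0\big(\frac{v-u}{|v-u|}\cdot\omega\big)$, $0<\gamma\le1$, and $\int_{\mathbb{S}^2}q_0(\hat u\cdot\omega)d\omega<\infty$ for all $\hat u\in\mathbb{S}^2$ (angular cutoff). **Collision frequency.** $\nu(v)=\int_{\mathbb{R}^3}\int_{\mathbb{S}^2}|v-u|^\gamma\mu(u)q_0\big(\frac{v-u}{|v-u|}\cdot\omega\big)d\omega du$ with $\mu(v)=e^{-|v|^2/2}$. *)

(* Defs.v *)
From HB Require Import structures.
From mathcomp Require Import all_boot all_order all_algebra.
From mathcomp Require Import all_classical all_reals all_analysis.

Set Implicit Arguments.
Unset Strict Implicit.
Unset Printing Implicit Defensive.

Import Order.TTheory GRing.Theory Num.Theory.
Import numFieldNormedType.Exports.

Local Open Scope classical_set_scope.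
Local Open Scope ring_scope.

Section Vectors.
Variable R : realType.
Implicit Types u v x : 'rV[R]_3.

Definition dot u v : R := \sum_(i < 3) u 0 i * v 0 i.

(* The library norm on 'rV[R]_3 is the sup norm; it induces the same topology
   and the same bounded sets. *)
Definition enorm v : R := Num.sqrt (dot v v).

Definition vec3 (a b c : R) : 'rV[R]_3 := \row_(i < 3) [:: a; b; c]`_i.

End Vectors.

Section Domain.
Variable R : realType.
Local Notation V := 'rV[R]_3.
Implicit Types (U Omega : set V) (xi : V -> R) (x v : V).

Definition boundary Omega : set V := closure Omega `\` interior Omega.

Definition iter_derive (vs : seq V) xi : V -> R :=
  foldr (fun v (g : V -> R) => (fun x => 'D_v g x)) xi vs.

(* C^oo on the open set U: directional derivatives of every order are Frechet
   differentiable, hence continuous, on U. *)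
Definition smooth_on U xi : Prop :=
  forall (vs : seq V) x, U x -> differentiable (iter_derive vs xi) x.

Definition gradient xi x : V := \row_(i < 3) 'D_(delta_mx 0 i) xi x.

(* If x is a boundary point of the open set Omega, then xi x = 0, and near x
   the boundary is the zero set of xi. *)
Definition local_defining_function Omega x U xi : Prop :=
  [/\ open U, U x, smooth_on U xi,
      (forall y, U y -> gradient xi y != 0) &
      Omega `&` U = [set y | xi y < 0] `&` U].

Definition smooth_boundary Omega : Prop :=
  forall x, boundary Omega x -> exists U xi, local_defining_function Omega x U xi.

(* The value does not depend on the local defining function; it is 0 where
   there is none. *)
Definition outward_normal Omega x : V :=
  xget 0 [set n | boundary Omega x /\ exists U xi,
    local_defining_function Omega x U xi /\
    n = (enorm (gradient xi x))^-1 *: gradient xi x].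

(* sup is 0 on unbounded sets: for bounded Omega this occurs only when v = 0 and
   x \in Omega, where t_b is +oo. Then (x, 0) is a grazing pair in any case. *)
Definition t_b Omega x v : R :=
  sup ([set 0] `|`
       [set tau | 0 < tau /\ forall s, 0 < s < tau -> Omega (x - s *: v)]).

Definition x_b Omega x v : V := x - t_b Omega x v *: v.

Definition grazing Omega : set (V * V) :=
  [set p | closure Omega p.1 /\
           dot (outward_normal Omega (x_b Omega p.1 p.2)) p.2 = 0].

End Domain.

Section Integrals.
Variable R : realType.
Local Notation V := 'rV[R]_3.
Local Notation leb := (@lebesgue_measure R).
Local Open Scope ereal_scope.

Definition int_R3 (f : V -> \bar R) : \bar R :=
  \int[((leb \x leb) \x leb)]_(y in [set: R * R * R]) f (vec3 y.1.1 y.1.2 y.2).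

Definition sph (p : R * R) : V :=
  vec3 (sin p.1 * cos p.2) (sin p.1 * sin p.2) (cos p.1).

(* Integral for the surface measure sin(theta) dtheta dphi on the unit sphere. *)
Definition int_S2 (f : V -> \bar R) : \bar R :=
  \int[(leb \x leb)]_(p in `[0%R, pi]%classic `*` `[0%R, (2 * pi)%R]%classic)
    (f (sph p) * (sin p.1)%:E).

End Integrals.

Section Collision.
Variables (R : realType) (gamma : R) (q0 : R -> R).
Local Notation V := 'rV[R]_3.
Implicit Types (u v z w : V).

Definition angular_cutoff : Prop :=
  [/\ measurable_fun (`[-1, 1]%classic : set R) q0,
      (forall s, -1 <= s <= 1 -> 0 <= q0 s) &
      forall z, enorm z = 1 -> (int_S2 (fun w => (q0 (dot z w))%:E) < +oo)%E].

(* For z = 0 the direction z / |z| is 0 here, but then |z| `^ gamma = 0 since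
   gamma > 0. *)
Definition kernel z w : R :=
  enorm z `^ gamma * q0 (dot ((enorm z)^-1 *: z) w).

Definition post_u u v w : V := u + dot (v - u) w *: w.
Definition post_v u v w : V := v - dot (v - u) w *: w.

(* Integrals are extended-real valued, so that divergence is not hidden. *)
Definition gain (F1 F2 : V -> R) v : \bar R :=
  int_R3 (fun u => int_S2 (fun w =>
    (kernel (v - u) w * F1 (post_u u v w) * F2 (post_v u v w))%:E)).

Definition mu v : R := expR (- (enorm v ^+ 2) / 2).

Definition nu v : \bar R :=
  int_R3 (fun u => int_S2 (fun w => (kernel (v - u) w * mu u)%:E)).

End Collision.

Definition wbar (R : realType) (rho beta : R) (v : 'rV[R]_3) : R :=
  expR (- (enorm v ^+ 2) / 4) / (1 + rho ^+ 2 * enorm v ^+ 2) `^ beta.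

Definition sup_norm_on (R : realType) (P : Type) (A : set P) (f : P -> \bar R)
    : \bar R :=
  ereal_sup [set `|f p|%E | p in A].

(* Main.v *)
(* Let r(v) = t_b(x,v) for x in Omega. It is lower semicontinuous, and at a grazing
   direction some one-sided partial derivative of r is -oo: along the ray a local
   defining function of the boundary vanishes to second order, whereas a
   perturbation of v moves it to first order. On every line parallel to an axis, the
   points where a function has such an infinite slope form a Lebesgue null set, so
   the grazing velocities of x lie in a Borel null set N(x).

   In the relative velocity z = v - u, the post-collisional velocities are
   v - (z.w)w and v - z + (z.w)w, and for almost every (z,w) both avoid N(x): the
   first by polar coordinates, the second because for fixed w it runs over a plane
   and varying the polar angle of w sweeps vertical lines. Along a convergent
   sequence (t_n,x_n,v_n) the integrand of Q_+ therefore converges almost everywhere,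
   and energy conservation gives w(u')w(v') <= e^(-|u|^2/4) w(v), a bound which
   permits dominated convergence in w and then in z.

   The same inequality bounds |Q_+(F,F)(v)| / w(v) by a multiple of the angular mass
   times the integral of |v-u|^gamma e^(-|u|^2/4), which is at most a constant times
   nu(v) after scaling u by sqrt 2. *)

(* At grazing pairs the values of [F] are arbitrary within the weighted bound, so [F t x] need not
   be measurable, and the change of variables [z = v - u] cannot be applied to the integrand of the
   gain term as it stands. Integrals are nevertheless defined for every function, through suprema
   over simple functions, and do not see null sets. Replacing [F t x] by a Borel function that
   agrees with it off N(x) therefore preserves the gain term, once both post-collisional velocities
   are known to avoid N(x) almost everywhere. Since N(x) moves with x and the union over all x need
   not be null, continuity is proved along sequences, where only countably many null sets occur. The
   cutoff assumption asserts finiteness of the angular integral direction by direction, whereas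
   domination calls for one value for all directions. That value is constant by rotation invariance
   of the surface measure, which is invisible in angle coordinates and is derived from that of
   Lebesgue measure. *)
Require Import Defs.
From HB Require Import structures.
From mathcomp Require Import all_boot all_order all_algebra.
From mathcomp Require Import all_classical all_reals all_analysis.
From mathcomp Require Import measurable_realfun ring lra.

Import Order.TTheory GRing.Theory Num.Theory.
Import numFieldNormedType.Exports.

Local Open Scope classical_set_scope.
Local Open Scope ring_scope.

Set Implicit Arguments.
Unset Strict Implicit.
Unset Printing Implicit Defensive.

(** * Integrals of arbitrary functions *)

(* [F] need not be measurable at grazing pairs, hence no measurability
   hypotheses on the integrands below. *)
Section UnmeasurableIntegrals.
Context d (T : measurableType d) (R : realType).
Variable mu : {measure set T -> \bar R}.
Local Open Scope ereal_scope.
Implicit Types (D N : set T) (f g : T -> \bar R).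
Import HBNNSimple.

(** The integral of a nonnegative function is a supremum over the simple functions below it, and a
    larger function admits more of them. *)
Lemma ge0_integral_le D f g : (forall x, D x -> 0 <= f x <= g x) ->
  \int[mu]_(x in D) f x <= \int[mu]_(x in D) g x.
Proof.
move=> fg.
have f0 x : 0 <= (f \_ D) x.
  by apply: erestrict_ge0 => y /fg /andP[].
have g0 x : 0 <= (g \_ D) x.
  by apply: erestrict_ge0 => y /fg /andP[+ +]; exact: le_trans.
rewrite [leLHS]integral_mkcond [leRHS]integral_mkcond.
rewrite !ge0_integralTE//; apply: le_ereal_sup => _ [h /= hf <-].
exists h => //= x; apply: le_trans (hf x) _.
by apply: lee_restrict => y /fg /andP[].
Qed.

(** Additivity fails for arbitrary functions, so the integrals of the positive and negative parts
    are not added: each lies between 0 and the integral of [g], which bounds the absolute value of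
    their difference. *)
Lemma abse_integral_le D f g : (forall x, D x -> `|f x| <= g x) ->
  `|\int[mu]_(x in D) f x| <= \int[mu]_(x in D) g x.
Proof.
move=> fg; rewrite integralE.
set a := integral _ _ _; set b := integral _ _ _.
have a0 : 0 <= a by apply: integral_ge0 => x _; exact: funepos_ge0.
have b0 : 0 <= b by apply: integral_ge0 => x _; exact: funeneg_ge0.
have ag : a <= \int[mu]_(x in D) g x.
  apply: ge0_integral_le => x /fg fgx; rewrite funepos_ge0/= (le_trans _ fgx)//.
  by rewrite funeposE ge_max abse_ge0 lee_abs.
have bg : b <= \int[mu]_(x in D) g x.
  apply: ge0_integral_le => x /fg fgx; rewrite funeneg_ge0/= (le_trans _ fgx)//.
  by rewrite funenegE ge_max abse_ge0 -abseN lee_abs.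
move: ag bg; set c := integral _ _ g => ac bc.
have [->|cfin] := eqVneq c +oo; first by rewrite leey.
have {}cfin : c \is a fin_num by rewrite ge0_fin_numE ?(le_trans a0 ac)// ltey.
have afin : a \is a fin_num.
  by rewrite ge0_fin_numE// (le_lt_trans ac)// -ge0_fin_numE// (le_trans a0 ac).
have bfin : b \is a fin_num.
  by rewrite ge0_fin_numE// (le_lt_trans bc)// -ge0_fin_numE// (le_trans a0 ac).
move: a0 b0 ac bc; rewrite -(fineK afin) -(fineK bfin) -(fineK cfin).
rewrite !lee_fin => a0 b0 ac bc; rewrite ler_norml; apply/andP; split; lra.
Qed.

(** A simple function below [h] becomes one below [k] when multiplied by the indicator of the
    complement of [N], and its integral does not change. Positive and negative parts are treated
    separately. *)
Lemma integral_eq_off_null D N f g : measurable N -> mu N = 0 ->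
  (forall x, D x -> ~ N x -> f x = g x) ->
  \int[mu]_(x in D) f x = \int[mu]_(x in D) g x.
Proof.
move=> mN N0 fg.
have half (h k : T -> \bar R) : (forall x, 0 <= h x) -> (forall x, 0 <= k x) ->
    (forall x, ~ N x -> h x = k x) -> \int[mu]_x h x <= \int[mu]_x k x.
  move=> h0 k0 hk; rewrite !ge0_integralTE//; apply: ge_ereal_sup => _ [s /= sh <-].
  have mNC : measurable (~` N) by exact: measurableC.
  have -> : sintegral mu s = sintegral mu (proj_nnsfun s mNC).
    rewrite -!integralT_nnsfun; apply: ae_eq_integral => //.
    - by apply/measurable_EFinP; exact: measurable_funP.
    - by apply/measurable_EFinP; exact: measurable_funP.
    - exists N; split => // x /= Nx; apply: contrapT => xN; apply: Nx => _.
      by rewrite mindicE mem_set// mulr1.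
  apply: ereal_sup_ubound; exists (proj_nnsfun s mNC) => // x /=.
  rewrite mindicE; have [xN|xN] := boolP (x \in ~` N); last by rewrite mulr0.
  by rewrite mulr1 -hk//; move: xN; rewrite inE.
have eqint (h k : T -> \bar R) : (forall x, 0 <= h x) -> (forall x, 0 <= k x) ->
    (forall x, ~ N x -> h x = k x) -> \int[mu]_x h x = \int[mu]_x k x.
  by move=> h0 k0 hk; apply/eqP; rewrite eq_le !half// => x /hk.
rewrite integral_mkcond [RHS]integral_mkcond integralE [RHS]integralE.
have fgD x : ~ N x -> (f \_ D) x = (g \_ D) x.
  by move=> Nx; rewrite /patch; case: ifPn => // /set_mem Dx; exact: fg.
congr (_ - _); apply: eqint => // x /fgD fgx.
- by rewrite !funeposE fgx.
- by rewrite !funenegE fgx.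
Qed.

End UnmeasurableIntegrals.

(** * Changes of variables *)

Section DensityTransfer.
Context d1 d2 (X : measurableType d1) (Y : measurableType d2) (R : realType).
Variables (mu : {measure set X -> \bar R}) (nu : {measure set Y -> \bar R}).
Variables (phi : X -> Y) (rho : X -> R).
Hypotheses (mphi : measurable_fun setT phi) (mrho : measurable_fun setT rho).
Hypothesis rho0 : forall x, 0 <= rho x.
Local Open Scope ereal_scope.
Import HBNNSimple.

(** Indicators give simple functions by linearity, and monotone convergence gives the rest. [rho]
    acts as the Jacobian of the substitution [y = phi x]. *)
Lemma ge0_integral_transfer :
  (forall A, measurable A -> \int[mu]_x (rho x * \1_A (phi x))%:E = nu A) ->
  forall g, measurable_fun setT g -> (forall y, 0 <= g y) ->
  \int[mu]_x ((rho x)%:E * g (phi x)) = \int[nu]_y g y.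
Proof.
move=> transfer g mg g0; pose h := nnsfun_approx measurableT mg.
have gE y : g y = lim ((h n y)%:E @[n --> \oo]).
  by apply/esym/cvg_lim => //; exact: cvg_nnsfun_approx.
have ndh y : {homo (fun n => (h n y)%:E) : a b / (a <= b)%N >-> a <= b}.
  by move=> a b ab; rewrite lee_fin; exact/lefP/nd_nnsfun_approx.
under [RHS]eq_integral do rewrite gE.
rewrite monotone_convergence//; last 2 first.
- by move=> n; apply/measurable_EFinP; exact: measurable_funP.
- by move=> n y _; rewrite lee_fin.
under [LHS]eq_integral => x _.
  have -> : (rho x)%:E * g (phi x) = lim ((rho x * h n (phi x))%:E @[n --> \oo]).
    apply/esym/cvg_lim => //.
    under eq_fun do rewrite EFinM.
    by apply: cvgeZl => //; exact: cvg_nnsfun_approx.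
  over.
have mh n y : measurable_fun setT (fun x => rho x * (y * \1_(h n @^-1` [set y]) (phi x)))%R.
  apply: measurable_funM => //; apply: measurable_funM => //.
  by apply: measurableT_comp mphi; exact: measurable_indic.
rewrite monotone_convergence//; last 3 first.
- move=> n; apply/measurable_EFinP/measurable_funM => //.
  by apply: measurableT_comp mphi; exact: measurable_funP.
- by move=> n x _; rewrite lee_fin mulr_ge0.
- by move=> x _ a b ab; rewrite lee_fin ler_wpM2l// -lee_fin; exact: ndh.
congr (limn _); apply/funext => n.
transitivity (\int[mu]_x \sum_(y \in range (h n))
    (rho x * (y * \1_(h n @^-1` [set y]) (phi x)))%:E).
  apply: eq_integral => x _.
  by rewrite (fimfunE (h n)) mulr_fsumr// -fsumEFin.
transitivity (\int[nu]_z \sum_(y \in range (h n))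
    (y * \1_(h n @^-1` [set y]) z)%:E); last first.
  by apply: eq_integral => z _; rewrite (fimfunE (h n)) fsumEFin.
have h0 y z : (0 <= y * \1_(h n @^-1` [set y]) z)%R.
  by have := nnfun_muleindic_ge0 (h n) y z; rewrite -EFinM lee_fin.
rewrite !ge0_integral_fsum//; last 4 first.
- by move=> y; apply/measurable_EFinP/measurable_funM => //; exact: measurable_indic.
- by move=> y z _; rewrite lee_fin.
- by move=> y; apply/measurable_EFinP.
- by move=> y x _; rewrite lee_fin mulr_ge0.
apply: eq_fsbigr => y /set_mem[t _ hty].
have y0 : (0 <= y)%R by rewrite -hty.
transitivity (y%:E * nu (h n @^-1` [set y])); last first.
  under eq_integral do rewrite EFinM.
  rewrite ge0_integralZl//.
  - by rewrite integral_indic// setIT.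
  - by apply/measurable_EFinP; exact: measurable_indic.
rewrite -transfer//.
under eq_integral do rewrite mulrCA EFinM.
rewrite ge0_integralZl//.
- apply/measurable_EFinP; apply: measurable_funM => //.
  by apply: measurableT_comp mphi; exact: measurable_indic.
- by move=> x _; rewrite lee_fin mulr_ge0.
Qed.

End DensityTransfer.

Section DensityMeasure.
Context d1 d2 (X : measurableType d1) (Y : measurableType d2) (R : realType).
Variables (mu : {measure set X -> \bar R}) (phi : X -> Y) (rho : X -> R).
Hypotheses (mphi : measurable_fun setT phi) (mrho : measurable_fun setT rho).
Hypothesis rho0 : forall x, 0 <= rho x.
Local Open Scope ereal_scope.

(** The image under [phi] of the measure with density [rho]. The measurability and sign proofs are
    arguments so that the measure structure can be attached to the term itself. *)
Definition density_image of measurable_fun setT phi & measurable_fun setT rho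
    & (forall x, (0 <= rho x)%R) :=
  fun A => \int[mu]_(x in phi @^-1` A) (rho x)%:E.

Local Notation m := (density_image mphi mrho rho0).

Let m0 : m set0 = 0.
Proof. by rewrite /density_image preimage_set0 integral_set0. Qed.

Let m_ge0 A : 0 <= m A.
Proof. by apply: integral_ge0 => x _; rewrite lee_fin. Qed.

Let m_sigma_additive : semi_sigma_additive m.
Proof.
move=> F mF tF mUF; rewrite /density_image preimage_bigcup.
rewrite ge0_integral_bigcup//.
- by apply: is_cvg_ereal_nneg_natsum_cond => n _ _; exact: m_ge0.
- by move=> n; rewrite -[X in measurable X]setTI; exact: mphi.
- by apply/measurable_EFinP; exact: measurable_funTS.
- by move=> x _; rewrite lee_fin.
- apply/trivIsetP => i j _ _ ij; rewrite -preimage_setI.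
  by move/trivIsetP : tF => ->//; rewrite preimage_set0.
Qed.

HB.instance Definition _ :=
  isMeasure.Build _ _ _ m m0 m_ge0 m_sigma_additive.

End DensityMeasure.

Section TransferToLebesgue.
Context d (X : measurableType d) (R : realType).
Variables (mu : {measure set X -> \bar R}) (phi : X -> R) (rho : X -> R).
Hypotheses (mphi : measurable_fun setT phi) (mrho : measurable_fun setT rho).
Hypothesis rho0 : forall x, 0 <= rho x.
Local Notation leb := (@lebesgue_measure R).
Local Open Scope ereal_scope.

(** Half-open intervals identify the image measure, since Lebesgue measure is determined by its
    values on them. *)
Lemma ge0_integral_transfer_lebesgue :
  (forall a b, (a < b)%R ->
    \int[mu]_(x in phi @^-1` `]a, b]%classic) (rho x)%:E = (b - a)%:E) ->
  forall g : R -> \bar R, measurable_fun setT g -> (forall y, 0 <= g y) ->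
  \int[mu]_x ((rho x)%:E * g (phi x)) = \int[leb]_y g y.
Proof.
move=> transfer; apply: (@ge0_integral_transfer _ _ X (measurableTypeR R) R mu leb) => // A mA.
transitivity (density_image mu mphi mrho rho0 A).
  rewrite /density_image [RHS]integral_mkcond; apply: eq_integral => x _.
  rewrite patchE indicE.
  have -> : (x \in phi @^-1` A) = (phi x \in A) by apply/idP/idP; rewrite !inE.
  by case: (phi x \in A); rewrite ?mulr1 ?mulr0.
apply/esym; apply: (@lebesgue_measure_unique R (density_image (Y:=measurableTypeR R) mu mphi mrho rho0)) mA => Z /ocitvP[->|[[a b]/= ab ->]].
  by rewrite !measure0.
by rewrite lebesgue_measure_itv/= lte_fin ab /density_image transfer// EFinB.
Qed.

End TransferToLebesgue.

Section Affine.
Context (R : realType).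
Local Notation leb := (@lebesgue_measure R).
Local Open Scope ereal_scope.

Lemma ge0_integral_affine (a b : R) (g : R -> \bar R) : a != 0%R ->
  measurable_fun setT g -> (forall y, 0 <= g y) ->
  \int[leb]_x (`|a|%:E * g (a * x + b)%R) = \int[leb]_y g y.
Proof.
move=> a0 mg g0.
have maff : measurable_fun [set: R] (fun x => a * x + b)%R.
  by apply: measurable_funD => //; exact: measurable_funM.
apply: (@ge0_integral_transfer_lebesgue _ _ _ leb (fun x => a * x + b)%R (cst `|a|%R)) => //.
move=> u v uv.
rewrite [LHS](_ : _ = \int[leb]_(x in (fun x : R => a * x + b)%R @^-1` `]u, v]%classic) (cst `|a|%:E x))//.
rewrite integral_cst; last first.
  by rewrite -[X in measurable X]setTI; exact: maff.
(* A negative slope reverses the half-open interval; its endpoints do not affect the length. *)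
have [a_lt0|a_gt0] : (a < 0 \/ 0 < a)%R by apply/orP; rewrite -neq_lt.
- have -> : (fun x : R => a * x + b)%R @^-1` `]u, v]%classic = `[((v - b) / a)%R, ((u - b) / a)%R[%classic.
    apply/seteqP; split => x /=; rewrite !in_itv/= ltr_ndivlMr// ler_ndivrMr//;
      rewrite (mulrC a) ltrBlDr lerBrDr andbC => //.
  rewrite /= lebesgue_measure_itv/= lte_fin ltr_nM2r ?invr_lt0// ltrD2r uv.
  by rewrite -EFinB -EFinM ltr0_norm//; congr EFin; field.
- have -> : (fun x : R => a * x + b)%R @^-1` `]u, v]%classic = `]((u - b) / a)%R, ((v - b) / a)%R]%classic.
    apply/seteqP; split => x /=; rewrite !in_itv/= ltr_pdivrMr// ler_pdivlMr//;
      rewrite (mulrC a) ltrBlDr lerBrDr => //.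
  rewrite /= lebesgue_measure_itv/= lte_fin ltr_pM2r ?invr_gt0// ltrD2r uv.
  by rewrite -EFinB -EFinM gtr0_norm//; congr EFin; field.
Qed.

End Affine.

Section TangentSubstitution.
Context (R : realType).
Local Notation leb := (@lebesgue_measure R).

Lemma measurable_invr : measurable_fun [set: R] (@GRing.inv R).
Proof.
have -> : [set: R] = [set~ 0] `|` [set 0] by rewrite setUC setUv.
apply/measurable_funU => //; first exact: measurableC.
split; last exact: measurable_fun_set1.
apply: open_continuous_measurable_fun; first exact: closed_openC.
move=> x /set_mem/= /eqP x0; exact: inv_continuous.
Qed.

Lemma measurable_tan : measurable_fun [set: R] (@tan R).
Proof.
apply: measurable_funM.
  by apply: continuous_measurable_fun; exact: continuous_sin.
apply: measurableT_comp measurable_invr _.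
by apply: continuous_measurable_fun; exact: continuous_cos.
Qed.

Local Notation quad := (`]- (pi / 2), (pi / 2)[%classic : set R).

Lemma quadE (t : R) : quad t = (- (pi / 2) < t < pi / 2) :> Prop.
Proof. by rewrite /= in_itv. Qed.

Lemma cos_neq0_quad (t : R) : quad t -> cos t != 0.
Proof. by rewrite quadE => /cos_gt0_pihalf; rewrite lt0r => /andP[]. Qed.

Local Open Scope ereal_scope.

(** The derivative of [tan] is [1 + tan^2]; the density is cut off outside [quad], where further
    branches of [tan] begin. Spherical coordinates are composed below from this substitution and
    scalings of one variable. *)
Lemma ge0_integral_tan (g : R -> \bar R) :
  measurable_fun setT g -> (forall y, 0 <= g y) ->
  \int[leb]_(t in quad) ((1 + tan t ^+ 2)%:E * g (tan t)) = \int[leb]_y g y.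
Proof.
move=> mg g0; pose rho (t : R) := ((1 + tan t ^+ 2) * \1_quad t)%R.
have mtan2 : measurable_fun [set: R] (fun t : R => 1 + tan t ^+ 2)%R.
  apply: measurable_funD => //; apply: measurable_funX; exact: measurable_tan.
rewrite -(@ge0_integral_transfer_lebesgue _ _ _ leb (@tan R) rho)//; last 4 first.
- exact: measurable_tan.
- apply: measurable_funM => //; exact: measurable_indic.
- by move=> x; rewrite mulr_ge0// addr_ge0// sqr_ge0.
- move=> a b ab.
  have ac c : quad (atan c) by rewrite quadE atan_gtNpi2 atan_ltpi2.
  have tK (t : R) : quad t -> atan (tan t) = t by move=> qt; exact: tanK.
  rewrite integral_mkcond.
  transitivity (\int[leb]_(t in `]atan a, atan b]) (1 + tan t ^+ 2)%:E).
    rewrite [RHS]integral_mkcond; apply: eq_integral => t _.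
    rewrite !patchE /rho indicE; case: (boolP (t \in quad)) => tq.
      move/set_mem in tq; rewrite mulr1; congr (if _ then _ else _).
      apply/idP/idP; rewrite !inE/= !in_itv/= => /andP[h1 h2].
        rewrite -[t]tK// lt_atan//=; exact: le_atan.
      apply/andP; split; first by rewrite -[a]atanK ltr_tan ?h1//; exact: ac.
      by rewrite -[b]atanK leNgt ltr_tan -?leNgt//; exact: ac.
    rewrite mulr0 if_same; case: ifPn => // /set_mem/=; rewrite in_itv/= => /andP[h1 h2].
    exfalso; move: tq; rewrite notin_setE; apply.
    rewrite quadE (lt_trans _ h1) ?atan_gtNpi2//=.
    by rewrite (le_lt_trans h2)// atan_ltpi2.
  rewrite integral_itv_obnd_cbnd; last first.
    by apply/measurable_EFinP; exact: measurable_funTS.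
  have qab (t : R) : (atan a <= t <= atan b)%R -> quad t.
    move=> /andP[h1 h2]; rewrite quadE (lt_le_trans _ h1) ?atan_gtNpi2//=.
    by rewrite (le_lt_trans h2)// atan_ltpi2.
  have tanc (t : R) : quad t -> {for t, continuous (@tan R)}.
    by move=> /cos_neq0_quad; exact: continuous_tan.
  rewrite (@continuous_FTC2 _ _ (@tan R)) ?atanK ?EFinB//.
  + exact: lt_atan.
  + apply: continuous_in_subspaceT => t /set_mem/=; rewrite in_itv/= => /qab/tanc ct.
    apply: cvgD; first exact: cvg_cst.
    by apply: (@continuous_comp _ _ _ (@tan R) (fun y => y ^+ 2)%R) => //; exact: exprn_continuous.
  + split.
    * move=> t; rewrite in_itv/= => /andP[h1 h2].
      by apply/derivable_tan/cos_neq0_quad/qab; rewrite !ltW.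
    * by apply: cvg_at_right_filter; apply: tanc; exact: ac.
    * by apply: cvg_at_left_filter; apply: tanc; exact: ac.
  + move=> t; rewrite in_itv/= => /andP[h1 h2].
    have tq : cos t != 0%R by apply/cos_neq0_quad/qab; rewrite !ltW.
    by have dt := is_derive_tan tq; rewrite derive1E derive_val cos2_tan2.
rewrite [LHS]integral_mkcond; apply: eq_integral => t _.
by rewrite patchE /rho indicE; case: ifPn; rewrite ?mulr1// mulr0 mul0e.
Qed.

End TangentSubstitution.

(** * Iterated integrals in space *)

Section Tonelli.
Context d1 d2 (X : measurableType d1) (Y : measurableType d2) (R : realType).
Variables (m1 : {sigma_finite_measure set X -> \bar R}).
Variables (m2 : {sigma_finite_measure set Y -> \bar R}).
Local Open Scope ereal_scope.
Variable f : X -> Y -> \bar R.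
Hypothesis mf : measurable_fun setT (fun p => f p.1 p.2).
Hypothesis f0 : forall x y, 0 <= f x y.

Lemma tonelli : \int[m1]_x \int[m2]_y f x y = \int[m2]_y \int[m1]_x f x y.
Proof. exact: (@fubini_tonelli _ _ _ _ _ m1 m2 (fun p => f p.1 p.2)). Qed.

Lemma tonelli_product g : measurable_fun setT g -> (forall p, 0 <= g p) ->
  \int[m1 \x m2]_p g p = \int[m1]_x \int[m2]_y g (x, y).
Proof. exact: (@fubini_tonelli1 _ _ _ _ _ m1 m2 g). Qed.

Lemma measurable_integral2 : measurable_fun setT (fun x => \int[m2]_y f x y).
Proof. exact: (@measurable_fun_fubini_tonelli_F _ _ _ _ _ m2 (fun p => f p.1 p.2)). Qed.

End Tonelli.

Section ProductSigmaFinite.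
Context d1 d2 (X : measurableType d1) (Y : measurableType d2) (R : realType).
Variables (m1 : {sigma_finite_measure set X -> \bar R}).
Variables (m2 : {sigma_finite_measure set Y -> \bar R}).
Local Open Scope ereal_scope.

(* The library instance on [m1 \x m2] is shadowed by the one for
   subprobabilities, hence this alias. *)
Definition prod_measure := m1 \x m2.

HB.instance Definition _ := Measure.on prod_measure.

Let prod_measure_sigma_finite : sigma_finite setT prod_measure.
Proof.
have /sigma_finiteP[F [TF ndF Foo]] := sigma_finiteT m1.
have /sigma_finiteP[G [TG ndG Goo]] := sigma_finiteT m2.
exists (fun n => F n `*` G n).
  apply/esym/seteqP; split => // -[x y] _.
  have [n _ Fnx] : (\bigcup_n F n) x by rewrite -TF.
  have [k _ Gky] : (\bigcup_n G n) y by rewrite -TG.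
  exists (maxn n k) => //; split => /=.
  - by move: x Fnx; apply/subsetPset/ndF/leq_maxl.
  - by move: y Gky; apply/subsetPset/ndG/leq_maxr.
move=> k; have [mF Fk] := Foo k; have [mG Gk] := Goo k.
split; first exact: measurableX.
by rewrite /prod_measure product_measure1E// lte_mul_pinfty// ge0_fin_numE.
Qed.

HB.instance Definition _ :=
  Measure_isSigmaFinite.Build _ _ _ prod_measure prod_measure_sigma_finite.

End ProductSigmaFinite.

Section Borel.
Context (R : realType).
Local Notation V := 'rV[R]_3.

Definition v3 (p : R * R * R) : V := vec3 p.1.1 p.1.2 p.2.

(** Measurability is tested in the coordinates [R * R * R], the space over which [int_R3]
    integrates. *)
Definition borel d (Y : measurableType d) (f : V -> Y) :=
  measurable_fun setT (fun p : R * R * R => f (vec3 p.1.1 p.1.2 p.2)).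

Lemma borel_vec3 d d' (X : measurableType d) (Y : measurableType d') (f : V -> Y)
    (a b c : X -> R) : borel f ->
  measurable_fun setT a -> measurable_fun setT b -> measurable_fun setT c ->
  measurable_fun setT (fun x => f (vec3 (a x) (b x) (c x))).
Proof.
move=> bf ma mb mc.
apply: (measurableT_comp (f := fun p : R * R * R => f (vec3 p.1.1 p.1.2 p.2))
  (g := fun x => (a x, b x, c x))) => //.
by apply: measurable_fun_pair => //; exact: measurable_fun_pair.
Qed.

Lemma eq_borel d (Y : measurableType d) (f : V -> Y) (g : R -> R -> R -> Y) :
  (forall a b c, f (vec3 a b c) = g a b c) ->
  measurable_fun setT (fun p : R * R * R => g p.1.1 p.1.2 p.2) -> borel f.
Proof.
move=> fg; rewrite /borel; congr measurable_fun.
by apply/funext => p; rewrite fg.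
Qed.

Lemma measurable_sin : measurable_fun [set: R] (@sin R).
Proof. by apply: continuous_measurable_fun; exact: continuous_sin. Qed.

Lemma measurable_cos : measurable_fun [set: R] (@cos R).
Proof. by apply: continuous_measurable_fun; exact: continuous_cos. Qed.

Lemma measurable_abs : measurable_fun [set: R] (fun x : R => `|x|).
Proof. exact: normr_measurable. Qed.

Lemma measurable_sqrt : measurable_fun [set: R] (@Num.sqrt R).
Proof. by apply: continuous_measurable_fun; exact: sqrt_continuous. Qed.

Lemma vec3E (v : V) : v = vec3 (v 0 0) (v 0 1) (v 0 2%:R).
Proof.
apply/rowP => i; rewrite !mxE.
case: i => [[|[|[|//]]] i3] /=; congr (v _ _); exact: val_inj.
Qed.

Lemma dot_vec3 (a b c a' b' c' : R) :
  dot (vec3 a b c) (vec3 a' b' c') = a * a' + b * b' + c * c'.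
Proof. by rewrite /dot !big_ord_recr/= big_ord0 !mxE/= add0r. Qed.

Lemma dotE (u v : V) :
  dot u v = u 0 0 * v 0 0 + u 0 1 * v 0 1 + u 0 2%:R * v 0 2%:R.
Proof. by rewrite {1}(vec3E u) {1}(vec3E v) dot_vec3. Qed.

Section VectorValued.
Context d (X : measurableType d).
Implicit Types (a b : X -> V) (c : X -> R).

Definition mvec a := forall i, measurable_fun setT (fun x => a x 0 i).

Lemma mvec_cst v : mvec (fun=> v).
Proof. by move=> i; exact: measurable_cst. Qed.

Lemma mvec_vec3 (f g h : X -> R) : measurable_fun setT f ->
  measurable_fun setT g -> measurable_fun setT h ->
  mvec (fun x => vec3 (f x) (g x) (h x)).
Proof.
move=> mf mg mh i.
have -> : (fun x => vec3 (f x) (g x) (h x) 0 i) = fun x => [:: f x; g x; h x]`_i.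
  by apply/funext => x; rewrite mxE.
by case: i => -[|[|[|//]]].
Qed.

Lemma mvecD a b : mvec a -> mvec b -> mvec (fun x => a x + b x).
Proof.
move=> ma mb i; have -> : (fun x => (a x + b x) 0 i) = fun x => a x 0 i + b x 0 i.
  by apply/funext => x; rewrite mxE.
exact: measurable_funD.
Qed.

Lemma mvecZ c a : measurable_fun setT c -> mvec a -> mvec (fun x => c x *: a x).
Proof.
move=> mc ma i; have -> : (fun x => (c x *: a x) 0 i) = fun x => c x * a x 0 i.
  by apply/funext => x; rewrite mxE.
exact: measurable_funM.
Qed.

Lemma mvecN a : mvec a -> mvec (fun x => - a x).
Proof.
move=> ma i; have -> : (fun x => (- a x) 0 i) = fun x => - a x 0 i.
  by apply/funext => x; rewrite mxE.
exact: measurable_funN.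
Qed.

Lemma measurable_dot a b : mvec a -> mvec b ->
  measurable_fun setT (fun x => dot (a x) (b x)).
Proof.
move=> ma mb.
have -> : (fun x => dot (a x) (b x)) = fun x =>
    a x 0 0 * b x 0 0 + a x 0 1 * b x 0 1 + a x 0 2%:R * b x 0 2%:R.
  by apply/funext => x; rewrite dotE.
by do 2?[apply: measurable_funD]; apply: measurable_funM.
Qed.

Lemma measurable_enorm a : mvec a -> measurable_fun setT (fun x => enorm (a x)).
Proof.
move=> ma.
by apply: (measurableT_comp measurable_sqrt (g := fun x => dot (a x) (a x)));
  exact: measurable_dot.
Qed.

Lemma borel_mvec d' (Y : measurableType d') (f : V -> Y) a : borel f -> mvec a ->
  measurable_fun setT (fun x => f (a x)).
Proof.
move=> bf ma.
have -> : (fun x => f (a x)) = fun x => f (vec3 (a x 0 0) (a x 0 1) (a x 0 2%:R)).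
  by apply/funext => x; rewrite -vec3E.
exact: borel_vec3.
Qed.

Lemma v3_mvec (p : X -> R * R * R) :
  measurable_fun setT p -> mvec (fun x => v3 (p x)).
Proof.
move=> mp; apply: mvec_vec3.
- by apply: (measurableT_comp measurable_fst (g := fst \o p)); exact: measurableT_comp.
- by apply: (measurableT_comp measurable_snd (g := fst \o p)); exact: measurableT_comp.
- exact: measurableT_comp.
Qed.

End VectorValued.

End Borel.

(** * Automation for measurability and nonnegativity *)

Ltac measurability := cbv beta; lazymatch goal with
  | |- measurable_fun _ (fun x => x) => exact: measurable_id
  | |- measurable_fun _ (fun _ => ?c) => exact: measurable_cst
  | |- measurable_fun _ (fun x => fst (@?a x)) =>
      apply: (measurableT_comp measurable_fst (g := a)); measurability
  | |- measurable_fun _ (fun x => snd (@?a x)) =>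
      apply: (measurableT_comp measurable_snd (g := a)); measurability
  | |- measurable_fun _ (fun x => EFin (@?a x)) =>
      apply/(measurable_EFinP _ a); measurability
  | |- measurable_fun _ (fun x => GRing.mul (@?a x) (@?b x)) =>
      apply: (@measurable_funM _ _ _ _ a b); measurability
  | |- measurable_fun _ (fun x => mule (@?a x) (@?b x)) =>
      apply: (@emeasurable_funM _ _ _ _ a b); measurability
  | |- measurable_fun _ (fun x => GRing.opp (@?a x)) =>
      apply: (@measurable_funN _ _ _ _ a); measurability
  | |- measurable_fun _ (fun x => GRing.add (@?a x) (@?b x)) =>
      apply: (@measurable_funD _ _ _ _ a b); measurability
  | |- measurable_fun _ (fun x => GRing.exp (@?a x) ?n) =>
      apply: (@measurable_funX _ _ _ _ a); measurability
  | |- measurable_fun _ (fun x => Num.Def.normr (@?a x)) =>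
      apply: (measurableT_comp (@measurable_abs _) (g := a)); measurability
  | |- measurable_fun _ (fun x => GRing.inv (@?a x)) =>
      apply: (measurableT_comp (@measurable_invr _) (g := a)); measurability
  | |- measurable_fun _ (fun x => sin (@?a x)) =>
      apply: (measurableT_comp (@measurable_sin _) (g := a)); measurability
  | |- measurable_fun _ (fun x => cos (@?a x)) =>
      apply: (measurableT_comp (@measurable_cos _) (g := a)); measurability
  | |- measurable_fun _ (fun x => tan (@?a x)) =>
      apply: (measurableT_comp (@measurable_tan _) (g := a)); measurability
  | |- measurable_fun _ (fun x => expR (@?a x)) =>
      apply: (measurableT_comp (@measurable_expR _) (g := a)); measurability
  | |- measurable_fun _ (fun x => Num.sqrt (@?a x)) =>
      apply: (measurableT_comp (@measurable_sqrt _) (g := a)); measurability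
  | |- measurable_fun _ (fun x => powR (@?a x) ?p) =>
      apply: (measurableT_comp (@measurable_powR _ p) (g := a)); measurability
  | |- measurable_fun _ (fun x => integral _ setT (fun y => @?f x y)) =>
      apply: (@measurable_integral2 _ _ _ _ _ _ f); [measurability|]
  | |- measurable_fun _ (fun x => dot (@?a x) (@?b x)) =>
      apply: (@measurable_dot _ _ _ a b); measurability
  | |- measurable_fun _ (fun x => enorm (@?a x)) =>
      apply: (@measurable_enorm _ _ _ a); measurability
  | |- mvec (fun _ => ?v) => exact: mvec_cst
  | |- mvec (fun x => vec3 (@?a x) (@?b x) (@?c x)) =>
      apply: (@mvec_vec3 _ _ _ a b c); measurability
  | |- mvec (fun x => GRing.add (@?a x) (@?b x)) =>
      apply: (@mvecD _ _ _ a b); measurability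
  | |- mvec (fun x => GRing.scale (@?a x) (@?b x)) =>
      apply: (@mvecZ _ _ _ a b); measurability
  | |- mvec (fun x => GRing.opp (@?a x)) =>
      apply: (@mvecN _ _ _ a); measurability
  | |- borel _ => rewrite /borel; measurability
  | |- measurable_fun _ (fun x => ?k (vec3 (@?a x) (@?b x) (@?c x))) =>
      first [ apply: (@borel_vec3 _ _ _ _ _ k a b c); [assumption|measurability..]
            | apply: (@borel_vec3 _ _ _ _ _ k a b c); measurability ]
  | |- measurable_fun _ (fun x => ?k (@?a x)) =>
      first [ assumption
            | apply: (measurableT_comp (f := k) (g := a)); measurability
            | apply: (@borel_mvec _ _ _ _ _ k a); [assumption|measurability] ]
  | |- _ => try assumption
  end.


Ltac nonneg := intros; repeat (cbv beta;
  lazymatch goal with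
  | |- is_true (@Order.le _ _ _ (integral _ _ _)) => apply: integral_ge0 => *
  | |- is_true (@Order.le _ _ _ (mule _ _)) => apply: mule_ge0
  | |- is_true (@Order.le _ _ _ (EFin _)) => rewrite lee_fin
  | |- is_true (@Order.le _ _ _ (_ ^+ 2)) => exact: sqr_ge0
  | |- is_true (@Order.le _ _ _ (GRing.exp _ _)) => apply: exprn_ge0
  | |- is_true (@Order.le _ _ _ (GRing.mul _ _)) => apply: mulr_ge0
  | |- is_true (@Order.le _ _ _ (GRing.add _ _)) => apply: addr_ge0
  | |- is_true (@Order.le _ _ _ (GRing.inv _)) => rewrite invr_ge0
  | |- is_true (@Order.le _ _ _ (Num.Def.normr _)) => exact: normr_ge0
  | |- is_true (@Order.le _ _ _ (expR _)) => exact: expR_ge0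
  | |- is_true (@Order.le _ _ _ (powR _ _)) => exact: powR_ge0
  | |- _ => done
  end).

Ltac side := lazymatch goal with
  | |- measurable_fun _ _ => solve [measurability; nonneg]
  | |- borel _ => solve [assumption | measurability; nonneg]
  | |- is_true (@Order.le _ _ _ _) => solve [nonneg]
  | |- forall _, _ => solve [nonneg]
  end.

(** * Spherical coordinates *)

Section Space.
Context (R : realType).
Local Notation V := 'rV[R]_3.
Local Notation leb := (@lebesgue_measure R).
Local Notation quad := (`]- (pi / 2), (pi / 2)[%classic : set R).
Local Open Scope ereal_scope.
Implicit Types k : V -> \bar R.

Lemma int_R3E k : borel k -> (forall x, 0 <= k x) ->
  int_R3 k = \int[leb]_x \int[leb]_y \int[leb]_z k (vec3 x y z).
Proof.
move=> bk k0; rewrite /int_R3.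

have := (@tonelli_product _ _ _ _ R (prod_measure leb leb) leb (fun p => k (vec3 p.1.1 p.1.2 p.2))) bk (fun p => k0 _).
move=> ->.
apply: (@tonelli_product _ _ _ _ R leb leb (fun p => \int[leb]_z k (vec3 p.1 p.2 z))).
  by measurability.
by move=> p; apply: integral_ge0.
Qed.

Lemma swap12 k : borel k -> (forall x, 0 <= k x) ->
  \int[leb]_x \int[leb]_y \int[leb]_z k (vec3 x y z) =
  \int[leb]_y \int[leb]_x \int[leb]_z k (vec3 x y z).
Proof.
move=> bk k0; rewrite tonelli//; last by move=> *; exact: integral_ge0.
by measurability.
Qed.

Lemma swap23 k : borel k -> (forall x, 0 <= k x) ->
  \int[leb]_x \int[leb]_y \int[leb]_z k (vec3 x y z) =
  \int[leb]_x \int[leb]_z \int[leb]_y k (vec3 x y z).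
Proof.
move=> bk k0; apply: eq_integral => x _; rewrite tonelli//.
by measurability.
Qed.

Lemma ge0_integral_scale (a : R) (g : R -> \bar R) : a != 0%R ->
  measurable_fun setT g -> (forall y, 0 <= g y) ->
  \int[leb]_x (`|a|%:E * g (a * x)%R) = \int[leb]_y g y.
Proof.
move=> a0 mg g0; rewrite -(ge0_integral_affine 0 a0 mg g0).
by under [RHS]eq_integral do rewrite addr0.
Qed.

(** Every line through the origin outside the planes [p1 = 0] and [p3 = 0] has exactly one direction
    [sph (theta, phi)] with both angles in [quad]; accordingly the radius is signed. The
    substitutions are [y = r cos theta], [x = tan theta], [a = x cos phi], [tau = tan phi],
    [b = y a tau], and finally [y a] is renamed [a]. Their Jacobians consume the weight
    [r^2 |sin theta|]. *)
Lemma polar_integral k : borel k -> (forall x, 0 <= k x) ->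
  \int[leb]_(phi in quad) \int[leb]_(theta in quad)
     \int[leb]_r ((r ^+ 2 * `|sin theta|)%:E * k (r *: sph (theta, phi))) =
  int_R3 k.
Proof.
move=> bk k0.
have sphE (r theta phi : R) : r *: sph (theta, phi) = vec3
    (r * (sin theta * cos phi)) (r * (sin theta * sin phi)) (r * cos theta) :> V.
  by apply/rowP => -[[|[|[|//]]] i3]; rewrite !mxE.
transitivity (\int[leb]_(phi in quad) \int[leb]_(theta in quad)
    ((1 + tan theta ^+ 2)%:E * \int[leb]_y ((y ^+ 2 * `|tan theta|)%:E *
      k (vec3 (y * (tan theta * cos phi)) (y * (tan theta * sin phi)) y)))).
  apply: eq_integral => phi _; apply: eq_integral => theta /set_mem qt.
  have c0 : cos theta != 0%R by exact: cos_neq0_quad.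
  rewrite -ge0_integralZl//; last 3 first.
  - by measurability.
  - by nonneg.
  - by rewrite lee_fin addr_ge0// sqr_ge0.
  rewrite -[RHS](@ge0_integral_scale (cos theta))//; last 2 first.
  - by measurability.
  - by nonneg.
  apply: eq_integral => r _; rewrite sphE !muleA -!EFinM; congr (_%:E * k (vec3 _ _ _)).
  - rewrite -cos2_tan2// /tan normrM normfV.
    rewrite exprMn -(@real_normK _ (cos theta) (num_real _)).
    have n0 : `|cos theta|%R != 0%R by rewrite normr_eq0.
    by field.
  - by rewrite /tan; field.
  - by rewrite /tan; field.
  - by rewrite mulrC.
transitivity (\int[leb]_(phi in quad) \int[leb]_x \int[leb]_y ((y ^+ 2 * `|x|)%:E *
      k (vec3 (y * (x * cos phi)) (y * (x * sin phi)) y))).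
  apply: eq_integral => phi _.
  rewrite -(@ge0_integral_tan _ (fun x => \int[leb]_y ((y ^+ 2 * `|x|)%:E *
      k (vec3 (y * (x * cos phi)) (y * (x * sin phi)) y))))//.
  - by measurability; nonneg.
  - by nonneg.
transitivity (\int[leb]_(phi in quad) ((1 + tan phi ^+ 2)%:E *
    \int[leb]_a \int[leb]_y ((y ^+ 2 * `|a|)%:E *
      k (vec3 (y * a) (y * (a * tan phi)) y)))).
  apply: eq_integral => phi /set_mem qt.
  have c0 : cos phi != 0%R by exact: cos_neq0_quad.
  rewrite -ge0_integralZl//; last 3 first.
  - by measurability; nonneg.
  - by nonneg.
  - by nonneg.
  rewrite -[RHS](@ge0_integral_scale (cos phi))//; last 2 first.
  - by measurability; nonneg.
  - by nonneg.
  apply: eq_integral => x _; rewrite -!ge0_integralZl//; try side.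
  apply: eq_integral => y _; rewrite !muleA -!EFinM; congr (_%:E * k (vec3 _ _ _)).
  - rewrite -cos2_tan2// normrM -(@real_normK _ (cos phi) (num_real _)).
    have n0 : `|cos phi|%R != 0%R by rewrite normr_eq0.
    by field.
  - by ring.
  - by rewrite /tan; field.
transitivity (\int[leb]_tau \int[leb]_a \int[leb]_y ((y ^+ 2 * `|a|)%:E *
      k (vec3 (y * a) (y * (a * tau)) y))).
  rewrite -(@ge0_integral_tan _ (fun tau => \int[leb]_a \int[leb]_y
      ((y ^+ 2 * `|a|)%:E * k (vec3 (y * a) (y * (a * tau)) y))))//.
  - by measurability; nonneg.
  - by nonneg.
rewrite tonelli; last 2 first.
- by measurability; nonneg.
- by nonneg.
(* The last two scalings degenerate at [a = 0] and at [y = 0]. *)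
have null0 : leb [set 0%R] = 0 by rewrite lebesgue_measure_set1.
transitivity (\int[leb]_a \int[leb]_y (`|y|%:E * \int[leb]_b k (vec3 (y * a) b y))).
  apply: (integral_eq_off_null _ null0) => // a _ /eqP a0.
  rewrite tonelli; last 2 first.
  - by measurability.
  - by nonneg.
  apply: eq_integral => y _.
  have [->|y0] := eqVneq y 0%R.
    by rewrite normr0 mul0e integral0_eq// => tau _; rewrite expr0n/= mul0r mul0e.
  rewrite -ge0_integralZl//; last by measurability.
  have ya0 : (y * a != 0)%R by exact: mulf_neq0.
  rewrite -[RHS](@ge0_integral_scale (y * a))//; try side.
  apply: eq_integral => tau _; rewrite muleA -EFinM; congr (_%:E * k (vec3 _ _ _)).
  - by rewrite normrM -(@real_normK _ y (num_real _)); ring.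
  - by ring.
rewrite tonelli; last 2 first.
- by measurability; nonneg.
- by nonneg.
transitivity (\int[leb]_y \int[leb]_a \int[leb]_b k (vec3 a b y)).
  apply: (integral_eq_off_null _ null0) => // y _ /eqP y0.
  rewrite -[RHS](@ge0_integral_scale y)//.
  - by measurability.
  - by nonneg.
rewrite (int_R3E bk k0) (swap23 bk k0).
by apply: tonelli; side.
Qed.

End Space.

Section TonelliOn.
Context d1 d2 (X : measurableType d1) (Y : measurableType d2) (R : realType).
Variables (m1 : {sigma_finite_measure set X -> \bar R}).
Variables (m2 : {sigma_finite_measure set Y -> \bar R}).
Variables (A : set X) (B : set Y) (f : X -> Y -> \bar R).
Local Open Scope ereal_scope.
Hypotheses (mA : measurable A) (mB : measurable B).
Hypothesis mf : measurable_fun (A `*` B) (fun p => f p.1 p.2).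
Hypothesis f0 : forall x y, A x -> B y -> 0 <= f x y.

(** Extension by zero turns integrals over [A] and [B] into integrals over the whole spaces. *)
Let fAB (x : X) (y : Y) := ((fun p => f p.1 p.2) \_ (A `*` B)) (x, y).

Let mfAB : measurable_fun setT (fun p => fAB p.1 p.2).
Proof.
have -> : (fun p => fAB p.1 p.2) = (fun p => f p.1 p.2) \_ (A `*` B).
  by apply/funext => -[].
by apply/(measurable_restrictT _ (measurableX mA mB)).
Qed.

Let fAB0 x y : 0 <= fAB x y.
Proof. by apply: erestrict_ge0 => -[a b] [] /=; exact: f0. Qed.

Let fABl x : \int[m2]_y fAB x y = ((fun x => \int[m2]_(y in B) f x y) \_ A) x.
Proof.
rewrite patchE; case: ifPn => [/set_mem Ax|/negP Ax]; last first.
  by apply: integral0_eq => y _; rewrite /fAB patchE memNset// => -[/mem_set].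
rewrite [RHS]integral_mkcond; apply: eq_integral => y _.
rewrite /fAB !patchE/=; congr (if _ then _ else _).
by apply/idP/idP; rewrite !inE//= => -[].
Qed.

Let fABr y : \int[m1]_x fAB x y = ((fun y => \int[m1]_(x in A) f x y) \_ B) y.
Proof.
rewrite patchE; case: ifPn => [/set_mem By|/negP By]; last first.
  by apply: integral0_eq => x _; rewrite /fAB patchE memNset// => -[_ /mem_set].
rewrite [RHS]integral_mkcond; apply: eq_integral => x _.
rewrite /fAB !patchE/=; congr (if _ then _ else _).
by apply/idP/idP; rewrite !inE//= => -[].
Qed.

Lemma tonelli_product_on : \int[m1 \x m2]_(p in A `*` B) f p.1 p.2 =
  \int[m1]_(x in A) \int[m2]_(y in B) f x y.
Proof.
rewrite integral_mkcond [RHS]integral_mkcond.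
rewrite -(eq_integral _ _ (fun x _ => fABl x)).
apply: (@tonelli_product _ _ _ _ _ _ _ ((fun p => f p.1 p.2) \_ (A `*` B))).
  by apply/(measurable_restrictT _ (measurableX mA mB)).
by move=> [x y]; exact: fAB0.
Qed.

Lemma tonelli_on : \int[m1]_(x in A) \int[m2]_(y in B) f x y =
  \int[m2]_(y in B) \int[m1]_(x in A) f x y.
Proof.
rewrite integral_mkcond [RHS]integral_mkcond.
rewrite -(eq_integral _ _ (fun x _ => fABl x)) -(eq_integral _ _ (fun x _ => fABr x)).
exact: tonelli.
Qed.

Lemma measurable_integral_on2 :
  measurable_fun A (fun x => \int[m2]_(y in B) f x y).
Proof.
apply/(measurable_restrictT _ mA).
have -> : (fun x => \int[m2]_(y in B) f x y) \_ A = fun x => \int[m2]_y fAB x y.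
  by apply/funext => x; rewrite fABl.
exact: measurable_integral2.
Qed.

End TonelliOn.

Section LineChanges.
Context (R : realType).
Local Notation leb := (@lebesgue_measure R).
Local Open Scope ereal_scope.
Variable g : R -> \bar R.
Hypotheses (mg : measurable_fun setT g) (g0 : forall x, 0 <= g x).

Lemma ge0_integral_shift (c a b : R) :
  \int[leb]_(x in `]a, b]) g (x + c)%R = \int[leb]_(x in `](a + c)%R, (b + c)%R]) g x.
Proof.
rewrite integral_mkcond [RHS]integral_mkcond.
rewrite -[RHS](@ge0_integral_affine _ 1 c)//; last 2 first.
- by apply/(measurable_restrictT _ (measurable_itv _)); exact: measurable_funTS.
- by move=> y; apply: erestrict_ge0.
apply: eq_integral => x _; rewrite normr1 mul1e mul1r !patchE.
by congr (if _ then _ else _); apply/idP/idP; rewrite !inE/= !in_itv/= ltrD2r lerD2r.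
Qed.

Lemma ge0_integral_reflect (c a b : R) :
  \int[leb]_(x in `]a, b[) g (c - x)%R = \int[leb]_(x in `](c - b)%R, (c - a)%R[) g x.
Proof.
rewrite integral_mkcond [RHS]integral_mkcond.
rewrite -[RHS](@ge0_integral_affine _ (-1) c)//; last 2 first.
- by apply/(measurable_restrictT _ (measurable_itv _)); exact: measurable_funTS.
- by move=> y; apply: erestrict_ge0.
apply: eq_integral => x _; rewrite normrN normr1 mul1e mulN1r [(- x + c)%R]addrC !patchE.
congr (if _ then _ else _); apply/idP/idP; rewrite !inE/= !in_itv/= !ltrD2l !ltrN2 andbC//.
Qed.

Lemma ge0_integral_split (a b c : R) : (a <= b)%R -> (b <= c)%R ->
  \int[leb]_(x in `]a, c]) g x =
  \int[leb]_(x in `]a, b]) g x + \int[leb]_(x in `]b, c]) g x.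
Proof.
move=> ab bc; rewrite -ge0_integral_setU//.
- congr integral; apply/seteqP; split => x /=; rewrite !in_itv/=.
    move=> /andP[ax xc]; have [xb|bx] := leP x b; [left|right].
      by rewrite ax.
    by rewrite xc.
  move=> [/andP[-> xb]/=|/andP[bx ->]]; first exact: le_trans bc.
  by rewrite (le_lt_trans ab).
- exact: measurable_funTS.
- apply/disj_set2P/seteqP; split => // x /=; rewrite !in_itv/=.
  by move=> [/andP[_ xb] /andP[bx _]]; move: xb; rewrite leNgt bx.
Qed.

(** Both sides are cut so that []b, a + p]] is common; translation by [p] moves the remaining piece
    []a, b]] onto []a + p, b + p]]. *)
Lemma periodic_integral (p a b : R) : (forall x, g (x + p)%R = g x) ->
  (a <= b)%R -> (b <= a + p)%R ->
  \int[leb]_(x in `]a, (a + p)%R]) g x = \int[leb]_(x in `]b, (b + p)%R]) g x.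
Proof.
move=> gp ab bap; rewrite (ge0_integral_split ab bap).
rewrite [RHS](ge0_integral_split bap) ?lerD2r// addeC; congr (_ + _).
by rewrite -ge0_integral_shift; under [RHS]eq_integral do rewrite gp.
Qed.

Lemma integral_oc_oo (a b : R) :
  \int[leb]_(x in `]a, b]) g x = \int[leb]_(x in `]a, b[) g x.
Proof.
by apply/esym/integral_itv_bndo_bndc; exact: measurable_funTS.
Qed.

Lemma integral_cc_oc (a b : R) :
  \int[leb]_(x in `[a, b]) g x = \int[leb]_(x in `]a, b]) g x.
Proof.
by apply/esym/integral_itv_obnd_cbnd; exact: measurable_funTS.
Qed.

End LineChanges.

(** * The unit sphere *)

Section Sphere.
Context (R : realType).
Local Notation V := 'rV[R]_3.
Local Notation leb := (@lebesgue_measure R).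
Local Notation quad := (`]- (pi / 2), (pi / 2)[%classic : set R).
Local Open Scope ereal_scope.
Implicit Types (f h : V -> \bar R) (w : V).

(** With [|sin theta|] the density extends to all angles compatibly with the reflections and
    half-turns used below; on [[0, pi]] it is the surface density. *)
Definition sphere_density f (theta phi : R) : \bar R :=
  f (vec3 (sin theta * cos phi) (sin theta * sin phi) (cos theta)) *
  `|sin theta|%:E.

Lemma sphere_density_ge0 f theta phi : (forall w, 0 <= f w) ->
  0 <= sphere_density f theta phi.
Proof. by rewrite /sphere_density; nonneg. Qed.

Lemma measurable_sphere_density f : borel f ->
  measurable_fun setT (fun p : R * R => sphere_density f p.1 p.2).
Proof. by rewrite /sphere_density => bf; measurability. Qed.

(** Integral along the meridian of longitude [phi]. Half-open intervals can be translated and joined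
    without overlap. *)
Definition latitude f phi : \bar R :=
  \int[leb]_(theta in `]0%R, pi]) sphere_density f theta phi.

Section nonneg_function.
Variable f : V -> \bar R.
Hypotheses (bf : borel f) (f0 : forall w, 0 <= f w).

Lemma measurable_latitude : measurable_fun [set: R] (latitude f).
Proof.
have mI : measurable `]0%R, (@pi R)]%classic by exact: measurable_itv.
have /= H := @measurable_integral_on2 _ _ _ _ R leb setT `]0%R, (@pi R)]%classic
  (fun phi theta => sphere_density f theta phi) measurableT mI. apply: H.
- by apply: measurable_funTS; rewrite /sphere_density; measurability.
- by move=> *; exact: sphere_density_ge0.
Qed.

Lemma latitude_ge0 phi : 0 <= latitude f phi.
Proof. by apply: integral_ge0 => *; exact: sphere_density_ge0. Qed.

Lemma measurable_density1 phi :
  measurable_fun setT (fun theta : R => sphere_density f theta phi).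
Proof. by rewrite /sphere_density; measurability. Qed.

Lemma int_S2E : int_S2 f = \int[leb]_(phi in `]0%R, (2 * pi)%R]) latitude f phi.
Proof.
transitivity (\int[leb \x leb]_(p in `[0%R, pi]%classic `*` `[0%R, (2 * pi)%R]%classic)
    sphere_density f p.1 p.2).
  apply: eq_integral => -[theta phi] /set_mem[/=].
  rewrite in_itv/= => /andP[t0 tpi] _; rewrite /sphere_density/=.
  by rewrite ger0_norm// sin_ge0_pi// t0.
have mcc (a b : R) : measurable `[a, b]%classic by exact: measurable_itv.
have mF : measurable_fun (`[0%R, pi]%classic `*` `[0%R, (2 * pi)%R]%classic)
    (fun p : R * R => sphere_density f p.1 p.2).
  by apply: measurable_funTS; exact: measurable_sphere_density.
have F0 x y : `[0%R, pi]%classic x -> `[0%R, (2 * pi)%R]%classic y ->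
  0 <= sphere_density f x y by move=> *; exact: sphere_density_ge0.
rewrite (@tonelli_product_on _ _ _ _ R leb leb _ _ (sphere_density f) (mcc _ _) (mcc _ _) mF F0).
rewrite (@tonelli_on _ _ _ _ R leb leb _ _ (sphere_density f) (mcc _ _) (mcc _ _) mF F0).
rewrite -(integral_cc_oc measurable_latitude).
apply: eq_integral => phi _; apply: integral_cc_oc; exact: measurable_density1.
Qed.

Lemma latitude_periodic phi : latitude f (phi + 2 * pi)%R = latitude f phi.
Proof.
apply: eq_integral => theta _; rewrite /sphere_density.
by rewrite [(2 * _)%R]mulr_natl mulr2n addrA !sinDpi !cosDpi !opprK.
Qed.

End nonneg_function.

Let oppr_vec3 (a b c : R) : (- vec3 a b c = vec3 (- a) (- b) (- c))%R.
Proof. by apply/rowP => -[[|[|[|//]]] i3]; rewrite !mxE. Qed.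

(** In angles the antipode is [theta] to [pi - theta] and [phi] to [phi + pi]: a reflection of []0,
    pi[] and a translation by half a period. *)
Lemma int_S2_antipode f : borel f -> (forall w, 0 <= f w) ->
  int_S2 (fun w => f (- w)%R) = int_S2 f.
Proof.
move=> bf f0.
have bfN : borel (fun w => f (- w)%R).
  have -> : borel (fun w => f (- w)%R) = measurable_fun setT
      (fun p : R * R * R => f (vec3 (- p.1.1) (- p.1.2) (- p.2))).
    by rewrite /borel; congr measurable_fun; apply/funext => p; rewrite oppr_vec3.
  by measurability.
rewrite (int_S2E bfN (fun w => f0 _)) (int_S2E bf f0).
have latN phi : latitude (fun w => f (- w)%R) phi = latitude f (phi + pi)%R.
  rewrite /latitude (integral_oc_oo (measurable_density1 bfN phi)).
  rewrite (integral_oc_oo (measurable_density1 bf (phi + pi)%R)).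
  have := @ge0_integral_reflect R _ (measurable_density1 bf (phi + pi)%R)
    (fun x => sphere_density_ge0 _ _ f0) pi 0%R pi.
  rewrite subrr subr0 => <-.
  apply: eq_integral => theta _; rewrite /sphere_density oppr_vec3.
  have -> : (sin (pi - theta) = sin theta)%R by rewrite addrC sinDpi sinN opprK.
  have -> : (cos (pi - theta) = - cos theta)%R by rewrite addrC cosDpi cosN.
  by rewrite sinDpi cosDpi !mulrN.
transitivity (\int[leb]_(phi in `]0%R, (2 * pi)%R]) latitude f (phi + pi)%R).
  by apply: eq_integral => phi _; exact: latN.
rewrite (ge0_integral_shift (measurable_latitude bf f0) (latitude_ge0 f0)).
have p0 := @pi_ge0 R.
have := @periodic_integral R (latitude f) (measurable_latitude bf f0)
  (latitude_ge0 f0) (2 * pi)%R 0%R pi (latitude_periodic f).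
rewrite !add0r => ->//; last lra.
by rewrite [(pi + _)%R]addrC.
Qed.

(** Adding [pi] to [theta] gives the opposite direction, and adding [pi] to [phi] has the effect of
    [theta] to [- theta]. For even [f] both integrations thus have period [pi], and the longitudes
    []0, 2 pi]] count [quad] twice. *)
Lemma int_S2_even f : borel f -> (forall w, 0 <= f w) -> (forall w, f (- w)%R = f w) ->
  int_S2 f = 2%:E * \int[leb]_(phi in quad) \int[leb]_(theta in quad)
    sphere_density f theta phi.
Proof.
move=> bf f0 fN; have p0 := @pi_ge0 R.
have latE phi : latitude f phi = \int[leb]_(theta in quad) sphere_density f theta phi.
  have := @periodic_integral R _ (measurable_density1 bf phi)
    (fun x => sphere_density_ge0 _ _ f0) pi (- (pi / 2))%R 0%R.
  rewrite add0r -/(latitude f phi) => <-; last 3 first.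
  - move=> theta; rewrite /sphere_density sinDpi cosDpi normrN !mulNr -oppr_vec3.
    by rewrite fN.
  - lra.
  - lra.
  rewrite (_ : (- (pi / 2) + pi = pi / 2)%R); last lra.
  by apply: integral_oc_oo; exact: measurable_density1.
have latp phi : latitude f (phi + pi)%R = latitude f phi.
  rewrite !latE.
  have := @ge0_integral_reflect R _ (measurable_density1 bf phi)
    (fun x => sphere_density_ge0 _ _ f0) 0%R (- (pi / 2))%R (pi / 2)%R.
  rewrite !sub0r opprK => <-.
  apply: eq_integral => theta _; rewrite /sphere_density sub0r.
  by rewrite sinDpi cosDpi sinN cosN normrN !mulrN !mulNr.
rewrite (int_S2E bf f0).
have mlat := measurable_latitude bf f0; have lat0 := latitude_ge0 f0.
rewrite (ge0_integral_split mlat lat0 (b := pi))//; last lra.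
have shiftE : \int[leb]_(x in `]pi, (2 * pi)%R]) latitude f x =
          \int[leb]_(x in `]0%R, pi]) latitude f x.
  have := ge0_integral_shift mlat lat0 pi 0%R pi.
  rewrite add0r (_ : (2 * pi = pi + pi)%R); last lra.
  by move=> <-; apply: eq_integral => phi _; rewrite latp.
have halfE : \int[leb]_(x in `]0%R, pi]) latitude f x =
    \int[leb]_(phi in quad) \int[leb]_(theta in quad) sphere_density f theta phi.
  have := @periodic_integral R _ mlat lat0 pi (- (pi / 2))%R 0%R latp.
  rewrite add0r => <-; [|lra|lra].
  rewrite (_ : (- (pi / 2) + pi = pi / 2)%R); last lra.
  by rewrite (integral_oc_oo mlat); apply: eq_integral => phi _.
rewrite shiftE halfE; move: (integral _ _ _) => X.
by rewrite -mule2n mule_natl.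
Qed.

End Sphere.

Section PlaneMaps.
Context (R : realType).
Local Notation leb := (@lebesgue_measure R).
Local Open Scope ereal_scope.
Variable g : R -> R -> \bar R.
Hypotheses (mg : measurable_fun setT (fun p => g p.1 p.2)).
Hypotheses (g0 : forall x y, 0 <= g x y).

Lemma measurable_curried d (X : measurableType d) (a b : X -> R) :
  measurable_fun setT a -> measurable_fun setT b ->
  measurable_fun setT (fun x => g (a x) (b x)).
Proof.
move=> ma mb.
apply: (measurableT_comp (f := fun p : R * R => g p.1 p.2) (g := fun x => (a x, b x))) => //.
exact: measurable_fun_pair.
Qed.

(** A pivot [a] factors the map into two substitutions in one variable: [x] becomes [a x + b y] with
    [y] fixed, then [y] becomes [(c / a) x + (D / a) y] with [x] fixed. *)
Lemma plane_map_pivot (a b c d : R) : (a != 0)%R -> (a * d - b * c != 0)%R ->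
  \int[leb]_x \int[leb]_y (`|a * d - b * c|%:E * g (a * x + b * y)%R (c * x + d * y)%R) =
  \int[leb]_x \int[leb]_y g x y.
Proof.
move=> a0 D0; pose D := (a * d - b * c)%R.
have mE (s t : R -> R -> R) : measurable_fun setT (fun p : R * R => s p.1 p.2) ->
    measurable_fun setT (fun p : R * R => t p.1 p.2) ->
    measurable_fun setT (fun p : R * R => `|D|%:E * g (s p.1 p.2) (t p.1 p.2)).
  move=> ms mt; apply: emeasurable_funM => //; exact: measurable_curried.
rewrite tonelli; last 2 first.
- by apply: (mE (fun x y => a * x + b * y)%R (fun x y => c * x + d * y)%R); measurability.
- by move=> *; rewrite mule_ge0.
transitivity (\int[leb]_y \int[leb]_x
    (`|D / a|%:E * g x (c / a * x + D / a * y)%R)).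
  apply: eq_integral => y _.
  rewrite -[RHS](@ge0_integral_affine _ a (b * y)%R)//; last 2 first.
  - apply: emeasurable_funM => //; apply: measurable_curried; measurability.
  - by move=> x; rewrite mule_ge0.
  apply: eq_integral => x _; rewrite muleA -EFinM; congr (_%:E * g _ _).
  - by rewrite -normrM; congr (`|_|)%R; rewrite /D; field.
  - by rewrite /D; field.
rewrite tonelli; last 2 first.
- by apply: emeasurable_funM => //; apply: measurable_curried; measurability.
- by move=> *; rewrite mule_ge0.
apply: eq_integral => x _.
rewrite -[RHS](@ge0_integral_affine _ (D / a)%R (c / a * x)%R)//; last 2 first.
- by rewrite mulf_neq0// invr_eq0.
- by apply: measurable_curried; measurability.
by apply: eq_integral => y _; rewrite [(c / a * x + _)%R]addrC.
Qed.

End PlaneMaps.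

Section PlaneMap.
Context (R : realType).
Local Notation leb := (@lebesgue_measure R).
Local Open Scope ereal_scope.
Variable g : R -> R -> \bar R.
Hypotheses (mg : measurable_fun setT (fun p => g p.1 p.2)).
Hypotheses (g0 : forall x y, 0 <= g x y).

Lemma ge0_integral_plane_map (a b c d : R) : (a * d - b * c != 0)%R ->
  \int[leb]_x \int[leb]_y (`|a * d - b * c|%:E * g (a * x + b * y)%R (c * x + d * y)%R) =
  \int[leb]_x \int[leb]_y g x y.
Proof.
move=> D0; have [a0|a0] := eqVneq a 0%R; last exact: plane_map_pivot.
(* If [a = 0], exchanging the two variables makes [b] the pivot. *)
have b0 : (b != 0)%R by apply: contraNneq D0 => ->; rewrite a0 !mul0r subrr.
rewrite tonelli; last 2 first.
- apply: emeasurable_funM => //; apply: measurable_curried => //; measurability.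
- by move=> *; rewrite mule_ge0.
have D'0 : (b * c - a * d != 0)%R by rewrite -oppr_eq0 opprB.
have <- := plane_map_pivot mg g0 b0 D'0.
apply: eq_integral => y _; apply: eq_integral => x _.
rewrite distrC; congr (_ * g _ _); exact: addrC.
Qed.

End PlaneMap.

Section Gaussian.
Context (R : realType).
Local Notation V := 'rV[R]_3.
Local Notation leb := (@lebesgue_measure R).
Local Notation quad := (`]- (pi / 2), (pi / 2)[%classic : set R).
Local Open Scope ereal_scope.

Lemma gauss_integral_lty (a : R) : (0 < a)%R ->
  \int[leb]_x (expR (- (a * x ^+ 2)))%:E < +oo.
Proof.
move=> a0; pose s := Num.sqrt a.
have s0 : (0 < s)%R by rewrite sqrtr_gt0.
have mgauss : measurable_fun [set: R] (fun x : R => (gauss_fun x)%:E).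
  by apply/measurable_EFinP; exact: measurable_gauss_fun.
have gauss0 (x : R) : 0 <= (gauss_fun x)%:E by rewrite lee_fin gauss_fun_ge0.
have mf : measurable_fun [set: R] (fun x : R => (s^-1)%:E * (gauss_fun x)%:E).
  by apply: emeasurable_funM.
have -> : \int[leb]_x (expR (- (a * x ^+ 2)))%:E =
    \int[leb]_x (`|s|%:E * ((s^-1)%:E * (gauss_fun (s * x)%R)%:E)).
  apply: eq_integral => x _; rewrite muleA -!EFinM gtr0_norm// divff ?gt_eqF// mul1r.
  by rewrite /gauss_fun exprMn sqr_sqrtr// ltW.
rewrite (ge0_integral_scale _ mf) ?gt_eqF//; last first.
  by move=> y; rewrite mule_ge0// lee_fin invr_ge0 ltW.
by rewrite ge0_integralZl ?lee_fin ?invr_ge0 ?ltW// integralT_gauss -EFinM ltry.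
Qed.

(** Radial factor of the Gaussian weight in the signed polar coordinates of [polar_integral]; being
    positive and finite, it can be cancelled. *)
Definition radial_weight : \bar R := \int[leb]_r (r ^+ 2 * expR (- (r ^+ 2)))%:E.

(** Half of the exponent absorbs [r^2]: from [exp(r^2 / 2) >= 1 + r^2 / 2] follows
    [r^2 exp(- r^2 / 2) <= 2]. *)
Lemma radial_weight_lty : radial_weight < +oo.
Proof.
have h0 : (0 < 2^-1 :> R)%R by lra.
apply: (@le_lt_trans _ _ (\int[leb]_r (2%:E * (expR (- (2^-1 * r ^+ 2)))%:E))).
  apply: ge0_integral_le => r _; apply/andP; split; first by nonneg.
  rewrite -EFinM lee_fin.
  have -> : (- (r ^+ 2) = (- (2^-1 * r ^+ 2)) + (- (2^-1 * r ^+ 2)))%R by field.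
  rewrite expRD mulrA ler_wpM2r ?expR_ge0// expRN ler_pdivrMr ?expR_gt0//.
  have := expR_ge1Dx (2^-1 * r ^+ 2); have := sqr_ge0 r; lra.
rewrite ge0_integralZl//; try side.
by rewrite lte_mul_pinfty// gauss_integral_lty.
Qed.

Lemma radial_weight_gt0 : 0 < radial_weight.
Proof.
apply: (@lt_le_trans _ _ (\int[leb]_(r in `[1%R, 2%R]) (cst (expR (-4))%:E r))).
  rewrite integral_cst//= lebesgue_measure_itv/= lte_fin ltr1n -EFinB -EFinM lte_fin.
  by apply: mulr_gt0; [exact: expR_gt0 | rewrite subr_gt0 ltr1n].
apply: (@le_trans _ _ (\int[leb]_(r in `[1%R, 2%R]) (r ^+ 2 * expR (- (r ^+ 2)))%:E)).
  apply: ge0_integral_le => r /=; rewrite in_itv/= lee_fin expR_ge0 lee_fin/= => /andP[r1 r2].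
  rewrite -[X in (X <= _)%R]mul1r ler_pM ?expR_ge0 ?ler_expR//; nra.
apply: ge0_subset_integral => //.
- by measurability.
- by nonneg.
Qed.

Lemma vec3Z (r a b c : R) : (r *: vec3 a b c = vec3 (r * a) (r * b) (r * c))%R.
Proof. by apply/rowP => -[[|[|[|//]]] i3]; rewrite !mxE. Qed.

Lemma dot_sph theta phi : dot (@sph R (theta, phi)) (sph (theta, phi)) = 1%R.
Proof.
rewrite /sph/= dot_vec3.
have <- := cos2Dsin2 theta; rewrite -[(sin theta ^+ 2)%R]mulr1 -(cos2Dsin2 phi); ring.
Qed.

(* Homogeneity of degree 0 lets a Gaussian weight trade the sphere for the whole
   space, where rotations are compositions of linear maps of coordinate planes. *)
Lemma sphere_to_space (h : V -> \bar R) : borel h -> (forall w, 0 <= h w) ->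
  (forall (r : R) w, r != 0%R -> h (r *: w)%R = h w) ->
  radial_weight * int_S2 h =
  2%:E * int_R3 (fun y => h y * (expR (- dot y y))%:E).
Proof.
move=> bh h0 hZ.
have hN w : h (- w)%R = h w by rewrite -scaleN1r hZ// oppr_eq0 oner_eq0.
have bk : borel (fun y => h y * (expR (- dot y y))%:E).
  rewrite /borel.
  have -> : (fun p : R * R * R => h (vec3 p.1.1 p.1.2 p.2) *
      (expR (- dot (vec3 p.1.1 p.1.2 p.2) (vec3 p.1.1 p.1.2 p.2)))%:E) =
    (fun p : R * R * R => h (vec3 p.1.1 p.1.2 p.2) *
      (expR (- (p.1.1 * p.1.1 + p.1.2 * p.1.2 + p.2 * p.2)))%:E).
    by apply/funext => p; rewrite dot_vec3.
  by measurability.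
have k0 y : 0 <= h y * (expR (- dot y y))%:E by nonneg.
(* The factor 2 is that of evenness. On both sides an integral over two angles in [quad] remains,
   from which the radial one factors out by homogeneity. *)
rewrite (int_S2_even bh h0 hN) -(polar_integral bk k0) muleCA; congr (_ * _).
have mW : measurable_fun setT (fun r : R => (r ^+ 2 * expR (- (r ^+ 2)))%:E).
  by measurability.
have Wfin : radial_weight \is a fin_num.
  by rewrite ge0_fin_numE ?radial_weight_lty// ltW// radial_weight_gt0.
have Wge0 : (0 <= fine radial_weight)%R by rewrite fine_ge0// ltW// radial_weight_gt0.
have mq : measurable quad by exact: measurable_itv.
have mdens : measurable_fun (quad `*` quad)
    (fun p : R * R => sphere_density h p.2 p.1).
  by apply: measurable_funTS; rewrite /sphere_density; measurability.
have mlat : measurable_fun quad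
    (fun phi => \int[leb]_(theta in quad) sphere_density h theta phi).
  have /= H := @measurable_integral_on2 _ _ _ _ R leb quad quad
    (fun phi theta => sphere_density h theta phi) mq mq mdens.
  by apply: H => *; exact: sphere_density_ge0.
rewrite -(fineK Wfin) -ge0_integralZl//; last first.
  by move=> *; apply: integral_ge0 => *; exact: sphere_density_ge0.
apply: eq_integral => phi _; rewrite -ge0_integralZl//; last 2 first.
- by apply: measurable_funTS; rewrite /sphere_density; measurability.
- by move=> *; exact: sphere_density_ge0.
apply: eq_integral => theta _; rewrite (fineK Wfin) muleC.
have d0 : 0 <= sphere_density h theta phi by exact: sphere_density_ge0.
rewrite -ge0_integralZl//; last by nonneg.
have null0 : leb [set 0%R] = 0 by rewrite lebesgue_measure_set1.
apply: (integral_eq_off_null _ null0) => // r _ /eqP r0; rewrite hZ//.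
have -> : dot (r *: sph (theta, phi)) (r *: sph (theta, phi)) = (r ^+ 2)%R.
  rewrite {1 2}/sph/= !vec3Z dot_vec3 -[RHS]mulr1 -(dot_sph theta phi) /sph/= dot_vec3.
  ring.
rewrite /sphere_density -muleA -EFinM [RHS]muleCA -EFinM; congr (_ * _%:E).
by rewrite mulrCA mulrA.
Qed.

End Gaussian.

(** * Rotation invariance of the surface measure *)

Section RotationInvariance.
Context (R : realType).
Local Notation V := 'rV[R]_3.
Local Notation leb := (@lebesgue_measure R).
Local Open Scope ereal_scope.

Lemma borel_dot d (Y : measurableType d) (Phi : R -> R -> Y) (z : V) :
  measurable_fun setT (fun p : R * R => Phi p.1 p.2) ->
  borel (fun y : V => Phi (dot z y) (dot y y)).
Proof.
move=> mPhi.
apply: (eq_borel (g := fun a b c : R => Phi (z 0 0 * a + z 0 1 * b + z 0 2%:R * c)%R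
  (a * a + b * b + c * c)%R)) => [a b c|].
  by rewrite {1}(vec3E z) !dot_vec3.
apply: (measurableT_comp mPhi (g := fun p : R * R * R =>
  (z 0 0 * p.1.1 + z 0 1 * p.1.2 + z 0 2%:R * p.2,
   p.1.1 * p.1.1 + p.1.2 * p.1.2 + p.2 * p.2)%R)).
by apply: measurable_fun_pair; measurability.
Qed.

Section Profile.
Variable Psi : R -> R -> \bar R.
Hypotheses (mPsi : measurable_fun setT (fun p => Psi p.1 p.2)).
Hypotheses (Psi0 : forall s n, 0 <= Psi s n).

Let J (a b c : R) := int_R3 (fun y => Psi (dot (vec3 a b c) y) (dot y y)).

Let bJ (a b c : R) : borel (fun y => Psi (dot (vec3 a b c) y) (dot y y)).
Proof.
exact: borel_dot.
Qed.

Let JE a b c : J a b c = \int[leb]_x \int[leb]_y \int[leb]_t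
  Psi (a * x + b * y + c * t)%R (x * x + y * y + t * t)%R.
Proof.
rewrite /J (int_R3E (bJ a b c) (fun _ => Psi0 _ _)).
by do 3 (apply: eq_integral => ? _); rewrite !dot_vec3.
Qed.

Let J_swap a b c : J a b c = J a c b.
Proof.
rewrite !JE; apply: eq_integral => x _; etransitivity.
  by apply: tonelli => //; apply: measurable_curried => //; measurability.
by do 2 (apply: eq_integral => ? _); congr (Psi _ _); ring.
Qed.

(** A rotation of the first two coordinates has determinant 1 and preserves [dot y y], so it can be
    moved from [y] to the coefficients [a], [b]. *)
Let J_rotate a b c (co si : R) : (co ^+ 2 + si ^+ 2 = 1)%R ->
  J a b c = J (co * a + si * b)%R (- si * a + co * b)%R c.
Proof.
move=> cs1; rewrite !JE.
pose g x y := \int[leb]_t Psi (a * x + b * y + c * t)%R (x * x + y * y + t * t)%R.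
have mg : measurable_fun setT (fun p : R * R => g p.1 p.2).
  apply: (@measurable_integral2 _ _ _ _ _ leb (fun (p : R * R) t =>
    Psi (a * p.1 + b * p.2 + c * t)%R (p.1 * p.1 + p.2 * p.2 + t * t)%R)) => //.
  by apply: measurable_curried => //; measurability.
have g0 x y : 0 <= g x y by apply: integral_ge0.
have D1 : (co * co - (- si) * si = 1)%R by rewrite -cs1; ring.
have D0 : (co * co - (- si) * si != 0)%R by rewrite D1 oner_eq0.
have <- := ge0_integral_plane_map mg g0 D0.
apply: eq_integral => x _; apply: eq_integral => y _.
rewrite D1 normr1 mul1e; apply: eq_integral => t _; congr (Psi _ _); first ring.
rewrite -[(x * x)%R]mul1r -[(y * y)%R]mul1r -cs1; ring.
Qed.

(** Two plane rotations are enough: one takes [(a, b)] to [(r, 0)], the other, after an exchange of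
    coordinates, takes [(r, c)] to [(1, 0)]. *)
Lemma int_R3_dot_unit z : dot z z = 1%R ->
  int_R3 (fun y => Psi (dot z y) (dot y y)) =
  int_R3 (fun y => Psi (dot (vec3 1 0 0) y) (dot y y)).
Proof.
rewrite (vec3E z) -!/(J _ _ _) dot_vec3.
move: (z 0 0)%R (z 0 1)%R (z 0 2%:R)%R => a b c abc1.
have ge0 : (0 <= a ^+ 2 + b ^+ 2)%R by rewrite addr_ge0 ?sqr_ge0.
pose r := Num.sqrt (a ^+ 2 + b ^+ 2).
have r2 : (r ^+ 2 = a ^+ 2 + b ^+ 2)%R by rewrite sqr_sqrtr.
have -> : J a b c = J r 0%R c.
  have [r0|r0] := eqVneq r 0%R.
    have /eqP : (a ^+ 2 + b ^+ 2 = 0)%R by rewrite -r2 r0 expr0n.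
    by rewrite paddr_eq0 ?sqr_ge0// !sqrf_eq0 r0 => /andP[/eqP -> /eqP ->].
  rewrite (@J_rotate a b c (a / r) (b / r)).
    congr (J _ _ _); last by ring.
    by apply: (mulfI r0); rewrite -[RHS]expr2 r2; field.
  by rewrite !expr_div_n -mulrDl -r2 divff// sqrf_eq0.
rewrite J_swap (@J_rotate r c 0%R r c); last by rewrite r2 -abc1; ring.
by congr (J _ _ _); [rewrite -!expr2 r2 -abc1|]; ring.
Qed.

End Profile.

Lemma eq_int_S2 (f g : V -> \bar R) : (forall p, f (sph p) = g (sph p)) ->
  int_S2 f = int_S2 g.
Proof. by move=> fg; apply: eq_integral => p _; rewrite fg. Qed.

Lemma int_S2D (f g : V -> \bar R) : borel f -> borel g ->
  (forall w, 0 <= f w) -> (forall w, 0 <= g w) ->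
  int_S2 (fun w => f w + g w) = int_S2 f + int_S2 g.
Proof.
move=> bf bg f0 g0; rewrite /int_S2.
have mD : measurable (`[0%R, pi]%classic `*` `[0%R, (2 * pi)%R]%classic : set (R * R)).
  by apply: measurableX; exact: measurable_itv.
have mS h : borel h -> measurable_fun (`[0%R, pi]%classic `*` `[0%R, (2 * pi)%R]%classic)
    (fun p : R * R => h (sph p) * (sin p.1)%:E).
  by move=> bh; apply: measurable_funTS; rewrite /sph; measurability.
have S0 h : (forall w, 0 <= h w) -> forall p : R * R,
    (`[0%R, pi]%classic `*` `[0%R, (2 * pi)%R]%classic) p -> 0 <= h (sph p) * (sin p.1)%:E.
  move=> h0 -[t u] [/= + _]; rewrite in_itv/= => /andP[t0 tpi].
  by rewrite mule_ge0// lee_fin sin_ge0_pi// t0.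
etransitivity; last first.
  apply: (@ge0_integralD _ _ _ (prod_measure leb leb) _ mD).
  - exact: S0.
  - exact: mS.
  - exact: S0.
  - exact: mS.
by apply: eq_integral => p _; rewrite ge0_muleDl.
Qed.

(** [sphere_to_space] asks for homogeneity under negative factors as well, so [q] is replaced by its
    symmetrization [qe], whose integral is twice that of [q] by antipodal symmetry. In space the
    rotations of [int_R3_dot_unit] apply. *)
Lemma int_S2_dot_unit (q : R -> R) z : measurable_fun setT q ->
  (forall s, (0 <= q s)%R) -> dot z z = 1%R ->
  int_S2 (fun w => (q (dot z w))%:E) = int_S2 (fun w => (q (dot (vec3 1 0 0) w))%:E).
Proof.
move=> mq q0.
pose qe s := (q s + q (- s))%R.
have mqe : measurable_fun setT qe.
  by apply: measurable_funD => //; apply: measurableT_comp.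
pose Psi s n := ((qe (s / Num.sqrt n))%:E * (expR (- n))%:E).
have mPsi : measurable_fun setT (fun p : R * R => Psi p.1 p.2).
  by rewrite /Psi; measurability.
have Psi0 s n : 0 <= Psi s n by rewrite /Psi mule_ge0// lee_fin ?expR_ge0// addr_ge0.
have bq z' : borel (fun w => (q (dot z' w))%:E).
  by apply: (@borel_dot _ _ (fun s _ => (q s)%:E)); measurability.
suff key z' : dot z' z' = 1%R ->
    radial_weight R * (2%:E * int_S2 (fun w => (q (dot z' w))%:E)) =
    2%:E * int_R3 (fun y => Psi (dot z' y) (dot y y)).
  have e1 : dot (@vec3 R 1 0 0) (vec3 1 0 0) = 1%R by rewrite dot_vec3; ring.
  move=> z1; have := key _ z1; rewrite (int_R3_dot_unit mPsi Psi0 z1) -(key _ e1).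
  have Wf : radial_weight R \is a fin_num.
    by rewrite ge0_fin_numE ?radial_weight_lty// ltW// radial_weight_gt0.
  (* The common factor is finite and nonzero, hence can be cancelled in the extended reals. *)
  pose w := (fine (radial_weight R) * 2)%R.
  have w0 : (w != 0)%R.
    by rewrite mulf_neq0// fine_eq0// gt_eqF// radial_weight_gt0.
  have cancelW X : X = (w^-1)%:E * (radial_weight R * (2%:E * X)).
    by rewrite !muleA -(fineK Wf) -!EFinM -mulrA mulVf// mul1e.
  by move=> WE; rewrite (cancelW (int_S2 _)) WE -cancelW.
move=> z'1.
pose h y := (qe (dot z' y / Num.sqrt (dot y y)))%:E.
have bh : borel h.
  by apply: (@borel_dot _ _ (fun s n => (qe (s / Num.sqrt n))%:E)); measurability.
have h0 y : 0 <= h y by rewrite lee_fin addr_ge0.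
have hZ (r : R) y : r != 0%R -> h (r *: y)%R = h y.
  move=> r0; rewrite /h.
  have dotZr (u : V) : dot u (r *: y)%R = (r * dot u y)%R.
    by rewrite /dot mulr_sumr; apply: eq_bigr => i _; rewrite !mxE; ring.
  have -> : (dot (r *: y) (r *: y) = r ^+ 2 * dot y y)%R.
    by rewrite dotZr /dot !mulr_sumr; apply: eq_bigr => i _; rewrite !mxE; ring.
  rewrite dotZr sqrtrM ?sqr_ge0// sqrtr_sqr.
  have qeN s : qe (- s)%R = qe s by rewrite /qe opprK addrC.
  have [r_gt0|r_lt0] : (0 < r \/ r < 0)%R by apply/orP; rewrite orbC -neq_lt.
    by rewrite gtr0_norm// -mulf_div divff// mul1r.
  by rewrite ltr0_norm// -mulf_div invrN mulrN divff// mulN1r qeN.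
have <- : int_S2 h = 2%:E * int_S2 (fun w => (q (dot z' w))%:E).
  have dotN w : dot z' (- w)%R = (- dot z' w)%R.
    by rewrite /dot -sumrN; apply: eq_bigr => i _; rewrite !mxE mulrN.
  rewrite mule_natl mule2n.
  rewrite -{2}(int_S2_antipode (bq z')); last by move=> w; rewrite lee_fin.
  rewrite -int_S2D//.
  - apply: eq_int_S2 => p.
    by rewrite /h /qe dotN -EFinD; case: p => t u; rewrite dot_sph sqrtr1 divr1.
  - have -> : (fun w => (q (dot z' (- w)%R))%:E) = (fun w => (q (- dot z' w))%:E).
      by apply/funext => w; rewrite dotN.
    by apply: (@borel_dot _ _ (fun s _ => (q (- s))%:E)); measurability.
  - by move=> w; rewrite lee_fin.
  - by move=> w; rewrite lee_fin.
exact: sphere_to_space.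
Qed.

End RotationInvariance.

(** * The weighted bound *)

Section Algebra.
Context (R : realType).
Local Notation V := 'rV[R]_3.
Implicit Types u v w z : V.

Lemma dot_ge0 v : 0 <= dot v v.
Proof. by apply: sumr_ge0 => i _; rewrite -expr2 sqr_ge0. Qed.

Lemma sqr_enorm v : enorm v ^+ 2 = dot v v.
Proof. by rewrite sqr_sqrtr// dot_ge0. Qed.

Lemma enorm_ge0 v : 0 <= enorm v. Proof. exact: sqrtr_ge0. Qed.

Lemma enorm_eq0 v : (enorm v == 0) = (v == 0).
Proof.
apply/idP/eqP => [|->]; last by rewrite /enorm /dot big1 ?sqrtr0// => i _; rewrite mxE mul0r.
rewrite -sqrf_eq0 sqr_enorm dotE -!expr2.
rewrite paddr_eq0 ?addr_ge0 ?sqr_ge0// paddr_eq0 ?sqr_ge0// !sqrf_eq0.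
move=> /andP[/andP[/eqP v0 /eqP v1] /eqP v2].
by rewrite (vec3E v) v0 v1 v2; apply/rowP => -[[|[|[|//]]] i3]; rewrite !mxE.
Qed.

Lemma dot_normalize z : z != 0 -> dot ((enorm z)^-1 *: z) ((enorm z)^-1 *: z) = 1.
Proof.
move=> z0; have e0 : enorm z != 0 by rewrite enorm_eq0.
have -> : dot ((enorm z)^-1 *: z) ((enorm z)^-1 *: z) = (enorm z) ^- 2 * dot z z.
  by rewrite -exprVn !dotE !mxE; ring.
by rewrite -sqr_enorm mulVf// sqrf_eq0.
Qed.

Lemma dot_unit_itv z w : dot z z = 1 -> dot w w = 1 -> -1 <= dot z w <= 1.
Proof.
move=> z1 w1.
have h1 : 0 <= dot (z + w) (z + w) by exact: dot_ge0.
have h2 : 0 <= dot (z - w) (z - w) by exact: dot_ge0.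
move: z1 w1 h1 h2; rewrite !dotE !mxE => z1 w1 h1 h2.
by apply/andP; split; nra.
Qed.

Lemma collision_energy u v w : dot w w = 1 ->
  dot (post_u u v w) (post_u u v w) + dot (post_v u v w) (post_v u v w) =
  dot u u + dot v v.
Proof.
rewrite /post_u /post_v; move sE : (dot (v - u) w) => s w1.
(* The energy defect is a multiple of [s * dot w w - dot (v - u) w], which vanishes for unit [w]. *)
have -> : dot (u + s *: w) (u + s *: w) + dot (v - s *: w) (v - s *: w) =
  dot u u + dot v v + 2 * s * (s * dot w w - dot (v - u) w).
  by rewrite !dotE !mxE; ring.
by rewrite w1 sE mulr1 subrr mulr0 addr0.
Qed.

Section Weight.
Variables (rho beta : R).
Hypothesis beta0 : 0 < beta.
Local Notation wbar := (wbar rho beta).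

Lemma wbar_gt0 v : 0 < wbar v.
Proof.
rewrite divr_gt0 ?expR_gt0// powR_gt0// ltr_pwDl// mulr_ge0 ?sqr_ge0//.
Qed.

Lemma wbar_le1 v : wbar v <= 1.
Proof.
have h : 0 <= rho ^+ 2 * enorm v ^+ 2 by rewrite mulr_ge0 ?sqr_ge0.
rewrite ler_pdivrMr ?mul1r; last by rewrite powR_gt0// ltr_pwDl.
apply: (@le_trans _ _ 1).
  by rewrite -expR0 ler_expR mulNr oppr_le0 divr_ge0// sqr_ge0.
apply: (@le_trans _ _ (1 `^ beta)); first by rewrite powR1.
rewrite ge0_ler_powR ?nnegrE ?(ltW beta0)//; lra.
Qed.

(** With [a + b = |u|^2 + |v|^2] the exponentials multiply exactly, and the polynomial factors
    satisfy [(1 + rho^2 a) (1 + rho^2 b) >= 1 + rho^2 (a + b) >= 1 + rho^2 |v|^2]. *)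
Lemma wbar_collision u v w : dot w w = 1 ->
  wbar (post_u u v w) * wbar (post_v u v w) <= expR (- (enorm u ^+ 2) / 4) * wbar v.
Proof.
move=> w1; have E := collision_energy u v w1.
rewrite /Defs.wbar !sqr_enorm; move: E.
have := dot_ge0 (post_u u v w); have := dot_ge0 (post_v u v w).
move: (dot (post_u _ _ _) _) (dot (post_v _ _ _) _) => a b b0 a0 E.
have u0 := dot_ge0 u; have v0 := dot_ge0 v.
have r0 := sqr_ge0 rho.
have p0 x : 0 <= x -> 0 < 1 + rho ^+ 2 * x.
  by move=> x0; rewrite ltr_pwDl// mulr_ge0.
have -> : expR (- a / 4) / (1 + rho ^+ 2 * a) `^ beta *
    (expR (- b / 4) / (1 + rho ^+ 2 * b) `^ beta) =
    expR (- dot u u / 4) * (expR (- dot v v / 4) /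
      ((1 + rho ^+ 2 * a) * (1 + rho ^+ 2 * b)) `^ beta).
  rewrite mulf_div -expRD powRM ?(ltW (p0 _ _))// mulrA -expRD.
  by congr (expR _ / _); lra.
rewrite ler_wpM2l ?expR_ge0// ler_wpM2l ?expR_ge0//.
rewrite lef_pV2 ?posrE ?powR_gt0 ?mulr_gt0 ?p0//.
rewrite ge0_ler_powR ?nnegrE ?(ltW beta0) ?mulr_ge0 ?(ltW (p0 _ _))//.
have : 0 <= rho ^+ 2 * a * (rho ^+ 2 * b) by apply: mulr_ge0; apply: mulr_ge0.
have : 0 <= rho ^+ 2 * dot u u by apply: mulr_ge0.
have := congr1 (fun x => rho ^+ 2 * x) E; rewrite /= !mulrDr.
nra.
Qed.

End Weight.
End Algebra.

Section LinearIntegrals.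
Context (R : realType).
Local Notation V := 'rV[R]_3.
Local Notation leb := (@lebesgue_measure R).
Local Open Scope ereal_scope.
Implicit Types (k f g : V -> \bar R).

Lemma int_S2Z (c : R) f : (0 <= c)%R -> borel f -> (forall w, 0 <= f w) ->
  int_S2 (fun w => c%:E * f w) = c%:E * int_S2 f.
Proof.
move=> c0 bf f0; rewrite /int_S2.
rewrite -(@ge0_integralZl _ _ _ (prod_measure leb leb))//.
- by apply: eq_integral => p _; rewrite muleA.
- by apply: measurableX; exact: measurable_itv.
- by apply: measurable_funTS; rewrite /sph; measurability.
- move=> -[t u] [/= + _]; rewrite in_itv/= => /andP[t0 tpi].
  by rewrite mule_ge0// lee_fin sin_ge0_pi// t0.
Qed.

Lemma int_S2_ge0 f : (forall p, 0 <= f (sph p)) -> 0 <= int_S2 f.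
Proof.
move=> f0; apply: integral_ge0 => -[t u] [/= + _]; rewrite in_itv/= => /andP[t0 tpi].
by rewrite mule_ge0// lee_fin sin_ge0_pi// t0.
Qed.

Lemma int_S2_abs_le f g : (forall p, `|f (sph p)| <= g (sph p)) ->
  `|int_S2 f| <= int_S2 g.
Proof.
move=> fg; apply: abse_integral_le => -[t u] [/= + _]; rewrite in_itv/= => /andP[t0 tpi].
have s0 : (0 <= sin t)%R by rewrite sin_ge0_pi// t0.
by rewrite abseM (gee0_abs (x := (sin t)%:E)) ?lee_fin// lee_wpmul2r.
Qed.

Lemma eq_int_R3 f g : (forall u, f u = g u) -> int_R3 f = int_R3 g.
Proof. by move=> fg; apply: eq_integral => y _; rewrite fg. Qed.

Lemma int_R3_abs_le f g : (forall u, `|f u| <= g u) -> `|int_R3 f| <= int_R3 g.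
Proof. by move=> fg; apply: abse_integral_le. Qed.

Lemma int_R3_le f g : (forall u, 0 <= f u <= g u) -> int_R3 f <= int_R3 g.
Proof. by move=> fg; apply: ge0_integral_le => y _; exact: fg. Qed.

Lemma int_R3Z (c : R) f : (0 <= c)%R -> borel f -> (forall w, 0 <= f w) ->
  int_R3 (fun w => c%:E * f w) = c%:E * int_R3 f.
Proof.
by move=> c0 bf f0; rewrite /int_R3 (@ge0_integralZl _ _ _ (prod_measure (prod_measure leb leb) leb)).
Qed.

Lemma int_R3D f g : borel f -> borel g ->
  (forall w, 0 <= f w) -> (forall w, 0 <= g w) ->
  int_R3 (fun w => f w + g w) = int_R3 f + int_R3 g.
Proof.
by move=> bf bg f0 g0; rewrite /int_R3 (@ge0_integralD _ _ _ (prod_measure (prod_measure leb leb) leb)).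
Qed.

Lemma int_R3_affine (s : R) (t : V) k : (s != 0)%R -> borel k -> (forall y, 0 <= k y) ->
  int_R3 (fun y => (`|s| ^+ 3)%:E * k (s *: y + t)%R) = int_R3 k.
Proof.
move=> s0 bk k0.
rewrite [RHS](int_R3E bk k0) int_R3E; last 2 first.
- by measurability.
- by nonneg.
have vE (x y z : R) : (s *: vec3 x y z + t)%R =
    vec3 (s * x + t 0 0)%R (s * y + t 0 1)%R (s * z + t 0 2%:R)%R.
  by rewrite {1}(vec3E t) vec3Z; apply/rowP => -[[|[|[|//]]] i3]; rewrite !mxE.
move: (t 0 0)%R (t 0 1)%R (t 0 2%:R)%R vE => a b c vE.
rewrite -(@ge0_integral_affine _ s a (fun x => \int[leb]_y \int[leb]_z k (vec3 x y z)))//; last 2 first.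
- by measurability; nonneg.
- by nonneg.
apply: eq_integral => x _.
rewrite -(@ge0_integral_affine _ s b (fun y => \int[leb]_z k (vec3 (s * x + a) y z)))//; last 2 first.
- by measurability; nonneg.
- by nonneg.
rewrite -ge0_integralZl//; last 2 first.
- by measurability; nonneg.
- by nonneg.
apply: eq_integral => y _.
rewrite -(@ge0_integral_affine _ s c (fun z => k (vec3 (s * x + a) (s * y + b) z)))//; last first.
  by measurability; nonneg.
rewrite -!ge0_integralZl//; try side.
by apply: eq_integral => z _; rewrite vE !muleA -!EFinM; congr (_%:E * _); ring.
Qed.

Lemma ge0_int_R3_reflect (v : V) k : borel k -> (forall y, 0 <= k y) ->
  int_R3 (fun y => k (v - y)%R) = int_R3 k.
Proof.
move=> bk k0; rewrite -[RHS](@int_R3_affine (-1) v k)//.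
by apply: eq_int_R3 => y; rewrite normrN normr1 expr1n mul1e scaleN1r addrC.
Qed.

End LinearIntegrals.

(** * The collision kernel and the collision frequency *)

Section Kernel.
Context (R : realType) (gamma : R) (q0 : R -> R).
Local Notation V := 'rV[R]_3.
Local Open Scope ereal_scope.
Hypotheses (gamma01 : (0 < gamma <= 1)%R) (cutoff : angular_cutoff q0).
Implicit Types u v w z : V.

(** [q0] is constrained on [[-1, 1]] only; its extension by 0 is measurable and nonnegative on the
    whole line. *)
Definition angular (s : R) : R := (q0 \_ `[(-1)%R, 1%R]) s.

Lemma measurable_angular : measurable_fun setT angular.
Proof.
case: cutoff => mq _ _.
by apply/(measurable_restrictT _ (measurable_itv `[(-1)%R, 1%R])).
Qed.

Lemma angular_ge0 s : (0 <= angular s)%R.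
Proof.
case: cutoff => _ q0_ge0 _; rewrite /angular patchE; case: ifPn => // /set_mem/=.
by rewrite in_itv/=; exact: q0_ge0.
Qed.

(** The axis [vec3 1 0 0] stands for any unit vector, by [int_S2_dot_unit]. *)
Definition angular_mass := int_S2 (fun w : V => (angular (dot (vec3 1 0 0) w))%:E).

Lemma angular_mass_ge0 : 0 <= angular_mass.
Proof. by apply: int_S2_ge0 => p; rewrite lee_fin angular_ge0. Qed.

Lemma angularE z w : dot z z = 1%R -> dot w w = 1%R -> angular (dot z w) = q0 (dot z w).
Proof.
by move=> z1 w1; rewrite /angular patchE mem_set//= in_itv/=; exact: dot_unit_itv.
Qed.

Lemma dot_sph1 p : dot (@sph R p) (sph p) = 1%R.
Proof. by case: p => t u; exact: dot_sph. Qed.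

Lemma angular_mass_fin : angular_mass \is a fin_num.
Proof.
rewrite ge0_fin_numE ?angular_mass_ge0//; case: cutoff => _ _ q0fin.
have e1 : dot (@vec3 R 1 0 0) (vec3 1 0 0) = 1%R by rewrite dot_vec3; ring.
have := q0fin (vec3 1 0 0); rewrite /enorm e1 sqrtr1 => /(_ erefl).
congr (_ < _); apply: eq_int_S2 => p.
by rewrite angularE// dot_sph1.
Qed.

Lemma kernelE z w : dot w w = 1%R ->
  Defs.kernel gamma q0 z w = (enorm z `^ gamma * angular (dot ((enorm z)^-1 *: z) w))%R.
Proof.
move=> w1; rewrite /Defs.kernel; have [->|z0] := eqVneq z 0%R.
  have -> : enorm (0 : V) = 0%R by apply/eqP; rewrite enorm_eq0.
  by rewrite powR0 ?mul0r//; case/andP: gamma01 => /gt_eqF ->.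
by rewrite angularE ?dot_normalize.
Qed.

Lemma kernel_ge0 z w : dot w w = 1%R -> (0 <= Defs.kernel gamma q0 z w)%R.
Proof. by move=> w1; rewrite kernelE// mulr_ge0 ?powR_ge0 ?angular_ge0. Qed.

(** Rotation invariance makes the angular integral the same constant for every direction of [z]; at
    [z = 0], which has no direction, both sides vanish. *)
Lemma int_S2_kernel (c : R) z : (0 <= c)%R ->
  int_S2 (fun w => (Defs.kernel gamma q0 z w * c)%:E) = (enorm z `^ gamma * c)%:E * angular_mass.
Proof.
move=> c0; have mang := measurable_angular.
transitivity ((enorm z `^ gamma * c)%:E *
    int_S2 (fun w => (angular (dot ((enorm z)^-1 *: z)%R w))%:E)).
  rewrite -int_S2Z//.
  - apply: eq_int_S2 => p; rewrite kernelE ?dot_sph1// -EFinM; congr _%:E; ring.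
  - by rewrite mulr_ge0// powR_ge0.
  - by measurability.
  - by move=> w; rewrite lee_fin angular_ge0.
have [->|z0] := eqVneq z 0%R.
  have -> : enorm (0 : V) = 0%R by apply/eqP; rewrite enorm_eq0.
  rewrite powR0 ?mul0r ?mul0e//; by case/andP: gamma01 => /gt_eqF ->.
congr (_ * _); apply: int_S2_dot_unit => //; first exact: angular_ge0.
exact: dot_normalize.
Qed.

(** The values in use are [c = 2], the Gaussian of [nu], and [c = 4], the Gaussian left over from
    the two weights of the gain term. *)
Definition collision_moment (c : R) v : \bar R :=
  int_R3 (fun u => (enorm (v - u) `^ gamma * expR (- (enorm u ^+ 2) / c))%:E).

Let borel_moment c v : borel (fun u => (enorm (v - u) `^ gamma * expR (- (enorm u ^+ 2) / c))%:E).
Proof. by measurability. Qed.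

Lemma collision_moment_ge0 c v : 0 <= collision_moment c v.
Proof. by apply: integral_ge0 => *; nonneg. Qed.

Lemma int_kernel_gauss (c : R) v :
  int_R3 (fun u => int_S2 (fun w =>
    (Defs.kernel gamma q0 (v - u) w * expR (- (enorm u ^+ 2) / c))%:E)) =
  angular_mass * collision_moment c v.
Proof.
transitivity (int_R3 (fun u => angular_mass *
    (enorm (v - u) `^ gamma * expR (- (enorm u ^+ 2) / c))%:E)).
  apply: eq_integral => y _; rewrite int_S2_kernel ?expR_ge0//; exact: muleC.
rewrite -(fineK angular_mass_fin) int_R3Z//.
- by rewrite fine_ge0// angular_mass_ge0.
- by nonneg.
Qed.

Lemma nuE v : nu gamma q0 v = angular_mass * collision_moment 2 v.
Proof. exact: int_kernel_gauss. Qed.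

(** [c] is at most twice the larger of [a] and [b], and [2^gamma <= 2] because [gamma <= 1]. *)
Lemma powR_add_le (a b c : R) : (0 <= a)%R -> (0 <= b)%R -> (0 <= c)%R ->
  (c ^+ 2 <= 2 * (a ^+ 2 + b ^+ 2))%R -> (c `^ gamma <= 2 * (a `^ gamma + b `^ gamma))%R.
Proof.
move=> a0 b0 c0 cab; have /andP[g0 g1] := gamma01.
have two : (2 `^ gamma <= 2 :> R)%R.
  by rewrite ler1_powR// ler1n.
pose m := Num.max a b.
have m0 : (0 <= m)%R by rewrite le_max a0.
have cm : (c <= 2 * m)%R.
  rewrite -(@ler_pXn2r _ 2)// ?nnegrE ?mulr_ge0//.
  have am : (a <= m)%R by rewrite le_max lexx.
  have bm : (b <= m)%R by rewrite le_max lexx orbT.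
  nra.
apply: (@le_trans _ _ ((2 * m) `^ gamma)%R).
  by rewrite ge0_ler_powR ?nnegrE ?mulr_ge0 ?(ltW g0).
rewrite powRM// ler_pM ?powR_ge0//.
rewrite /m; case: (leP a b) => _.
  by rewrite lerDr powR_ge0.
by rewrite lerDl powR_ge0.
Qed.

(* Scaling [u] by [sqrt 2] turns one Gaussian into the other, and
   [|v - sqrt 2 u|^2 <= 2 (|v - u|^2 + |v + u|^2)]; the two terms on the right
   have the same integral by symmetry. *)
Lemma collision_moment_le v :
  collision_moment 4 v <= (Num.sqrt 2 ^+ 3 * 4)%:E * collision_moment 2 v.
Proof.
set s : R := Num.sqrt 2.
have s2 : (s ^+ 2 = 2)%R by rewrite sqr_sqrtr.
have s_ge0 : (0 <= s)%R by exact: sqrtr_ge0.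
have s0 : (s != 0)%R by rewrite gt_eqF// sqrtr_gt0.
clearbody s.
pose E u := expR (- (enorm u ^+ 2) / 2).
have bf : borel (fun u => (enorm (v - u) `^ gamma * E u)%:E) by exact: borel_moment.
have bg : borel (fun u => (enorm (v + u) `^ gamma * E u)%:E).
  by rewrite /E; measurability.
have symm : int_R3 (fun u => (enorm (v + u) `^ gamma * E u)%:E) = collision_moment 2 v.
  have N0 : (-1 != 0 :> R)%R by rewrite oppr_eq0 oner_eq0.
  have f0 u : 0 <= (enorm (v - u) `^ gamma * E u)%:E by rewrite /E; nonneg.
  transitivity (int_R3 (fun u => (enorm (v - u) `^ gamma * E u)%:E)); last by [].
  rewrite -(int_R3_affine 0 N0 bf f0).
  apply: eq_int_R3 => y; rewrite normrN1 expr1n mul1e addr0 scaleN1r opprK.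
  have dotN : dot (- y) (- y) = dot y y by rewrite !dotE !mxE; ring.
  by have -> : E (- y)%R = E y by rewrite /E !sqr_enorm dotN.
have b4 : borel (fun u => (enorm (v - u) `^ gamma * expR (- (enorm u ^+ 2) / 4))%:E).
  exact: borel_moment.
have f4 u : 0 <= (enorm (v - u) `^ gamma * expR (- (enorm u ^+ 2) / 4))%:E by nonneg.
have -> : collision_moment 4 v = int_R3 (fun y => (`|s| ^+ 3)%:E *
    (enorm (v - (s *: y + 0)) `^ gamma * expR (- (enorm (s *: y + 0) ^+ 2) / 4))%:E).
  by rewrite (int_R3_affine 0 s0 b4 f4).
(* The cube is the Jacobian of the scaling. Of the factor 4, one 2 is the constant of [powR_add_le];
   the other counts the two terms, equal by [symm]. *)
apply: (@le_trans _ _ (int_R3 (fun u => (s ^+ 3 * 2)%:E *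
    ((enorm (v - u) `^ gamma * E u)%:E + (enorm (v + u) `^ gamma * E u)%:E)))).
  apply: int_R3_le => u; rewrite addr0; apply/andP; split; first by nonneg.
  have EE : expR (- enorm (s *: u) ^+ 2 / 4) = E u.
    rewrite /E; congr expR; rewrite !sqr_enorm.
    have -> : (dot (s *: u) (s *: u) = s ^+ 2 * dot u u)%R by rewrite !dotE !mxE; ring.
    by rewrite s2; field.
  have key : (enorm (v - s *: u) `^ gamma <=
      2 * (enorm (v - u) `^ gamma + enorm (v + u) `^ gamma))%R.
    apply: powR_add_le; [exact: enorm_ge0..|]; rewrite !sqr_enorm.
    have expand (a b : R) : (dot (a *: v + b *: u) (a *: v + b *: u) =
        a ^+ 2 * dot v v + 2 * a * b * dot v u + b ^+ 2 * dot u u)%R.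
      by rewrite !dotE !mxE; ring.
    have := expand 1%R (- s)%R; have := expand 1%R 1%R; have := expand 1%R (-1)%R.
    (* From [|s v + u|^2 >= 0], the cross term satisfies [- 2 s (v . u) <= 2 |v|^2 + |u|^2]. *)
    have := expand s 1%R; have := dot_ge0 (s *: v + 1 *: u)%R.
    rewrite !scaleNr !scale1r !sqrrN s2 => h e1 e2 e3 e4; move: h; rewrite e1 e2 e3 e4.
    have := dot_ge0 v; have := dot_ge0 u; lra.
  rewrite -EFinD -[X in X <= _]EFinM -[X in _ <= X]EFinM lee_fin (ger0_norm s_ge0) EE.
  have E0 : (0 <= E u)%R by exact: expR_ge0.
  have s3 : (0 <= s ^+ 3)%R by apply: exprn_ge0.
  have := ler_wpM2l s3 (ler_wpM2r E0 key).
  move: (enorm _ `^ _)%R (enorm _ `^ _)%R (enorm _ `^ _)%R (E u) (s ^+ 3)%R => a b c e s'.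
  by congr (_ <= _)%R; ring.
have f0 w : 0 <= (enorm (v - w) `^ gamma * E w)%:E by rewrite /E; nonneg.
have g0 w : 0 <= (enorm (v + w) `^ gamma * E w)%:E by rewrite /E; nonneg.
have s32 : (0 <= s ^+ 3 * 2)%R by exact: mulr_ge0 (exprn_ge0 3 s_ge0) (ler0n _ 2).
rewrite (int_R3Z s32 (emeasurable_funD bf bg) (fun w => adde_ge0 (f0 w) (g0 w))).
rewrite (int_R3D bf bg f0 g0) symm.
have -> : (s ^+ 3 * 4)%:E = (s ^+ 3 * 2)%:E * 2%:E by rewrite -EFinM; congr EFin; ring.
rewrite -muleA mule_natl mule2n; exact: lexx.
Qed.

End Kernel.

Section GainBound.
Context (R : realType) (gamma rho beta : R) (q0 : R -> R).
Local Notation V := 'rV[R]_3.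
Local Open Scope ereal_scope.
Hypotheses (gamma01 : (0 < gamma <= 1)%R) (cutoff : angular_cutoff q0).
Hypothesis (beta0 : (0 < beta)%R).
Implicit Types u v w z : V.
Local Notation wbar := (wbar rho beta).
Local Notation kernel := (Defs.kernel gamma q0).

Lemma gain_integrand_le (M : R) (f : V -> R) u v w : dot w w = 1%R ->
  (forall u, (`|f u| <= M * wbar u)%R) ->
  (`|kernel (v - u) w * f (post_u u v w) * f (post_v u v w)| <=
   kernel (v - u) w * (M ^+ 2 * wbar v * expR (- (enorm u ^+ 2) / 4)))%R.
Proof.
move=> w1 fM; have K0 := kernel_ge0 gamma01 cutoff (v - u) w1.
rewrite -mulrA normrM (ger0_norm K0) normrM; apply: ler_wpM2l => //.
apply: (@le_trans _ _ ((M * wbar (post_u u v w)) * (M * wbar (post_v u v w)))%R).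
  by apply: ler_pM; [exact: normr_ge0..|exact: fM|exact: fM].
have := wbar_collision rho beta0 u v w1.
move=> /(ler_wpM2l (sqr_ge0 M)).
move: (wbar _) (wbar _) (wbar _) (expR _) => a b d e.
by congr (_ <= _)%R; ring.
Qed.

Lemma gain_le (M : R) (f : V -> R) v :
  (forall u, (`|f u| <= M * wbar u)%R) ->
  `|gain gamma q0 f f v| <=
    (M ^+ 2 * wbar v)%:E * (angular_mass q0 * collision_moment gamma 4 v).
Proof.
move=> fM; set c := (M ^+ 2 * wbar v)%R.
have c0 : (0 <= c)%R by apply: mulr_ge0; [exact: sqr_ge0|exact/ltW/wbar_gt0].
rewrite -(int_kernel_gauss gamma01 cutoff) -int_R3Z//; last 2 first.
- have E u : int_S2 (fun w => (kernel (v - u) w * expR (- (enorm u ^+ 2) / 4))%:E) =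
    (enorm (v - u) `^ gamma * expR (- (enorm u ^+ 2) / 4))%:E * angular_mass q0.
    by rewrite int_S2_kernel// expR_ge0.
  have -> : (fun u => int_S2 (fun w => (kernel (v - u) w * expR (- (enorm u ^+ 2) / 4))%:E)) =
    (fun u => (enorm (v - u) `^ gamma * expR (- (enorm u ^+ 2) / 4))%:E * angular_mass q0).
    by apply/funext => u; exact: E.
  by measurability.
- move=> u; apply: int_S2_ge0 => p; rewrite lee_fin mulr_ge0 ?expR_ge0//.
  by apply: kernel_ge0 => //; exact: dot_sph1.
apply: int_R3_abs_le => u.
have E0 : (0 <= expR (- (enorm u ^+ 2) / 4))%R by exact: expR_ge0.
have cE0 : (0 <= c * expR (- (enorm u ^+ 2) / 4))%R by exact: mulr_ge0.
have -> : c%:E * int_S2 (fun w => (kernel (v - u) w * expR (- (enorm u ^+ 2) / 4))%:E) =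
    int_S2 (fun w => (kernel (v - u) w * (c * expR (- (enorm u ^+ 2) / 4)))%:E).
  by rewrite !int_S2_kernel// muleA -EFinM mulrCA.
apply: int_S2_abs_le => p; rewrite lee_fin.
by apply: gain_integrand_le => //; exact: dot_sph1.
Qed.

Lemma weighted_gain_le (M : R) (f : V -> R) v :
  (forall u, (`|f u| <= M * wbar u)%R) ->
  `|(nu gamma q0 v)^-1 * ((wbar v)^-1)%:E * gain gamma q0 f f v| <=
    (M ^+ 2 * (Num.sqrt 2 ^+ 3 * 4))%:E.
Proof.
move=> fM; set C := (Num.sqrt 2 ^+ 3 * 4)%R.
have C0 : (0 <= C)%R by apply: mulr_ge0; [apply: exprn_ge0; exact: sqrtr_ge0|exact: ler0n].
have w0 := wbar_gt0 rho beta v.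
have MC0 : (0 <= M ^+ 2 * C)%R by apply: mulr_ge0 => //; exact: sqr_ge0.
have Mw0 : (0 <= M ^+ 2 * wbar v)%R by apply: mulr_ge0; [exact: sqr_ge0|exact: ltW].
have nu0 : 0 <= nu gamma q0 v.
  by rewrite nuE// mule_ge0 ?angular_mass_ge0 ?collision_moment_ge0.
have gainE : `|gain gamma q0 f f v| <= (M ^+ 2 * wbar v * C)%:E * nu gamma q0 v.
  apply: (le_trans (gain_le v fM)).
  rewrite (EFinM (M ^+ 2 * wbar v)) -[leRHS]muleA; apply: lee_wpmul2l; first by rewrite lee_fin.
  rewrite nuE// muleCA; apply: lee_wpmul2l; first exact: angular_mass_ge0.
  exact: collision_moment_le.
(* A vanishing [nu] forces the gain to vanish, a finite positive one is divided out, and an infinite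
   one has inverse 0. *)
move: nu0 gainE; case: (nu gamma q0 v) => [r| |]; last by rewrite leNgt ltNy0.
  rewrite lee_fin le_eqVlt => /orP[/eqP <-|r0].
    rewrite mule0 => g0.
    have /eqP -> : gain gamma q0 f f v == 0 by rewrite -abse_eq0 eq_le g0 abse_ge0.
    by rewrite mule0 abse0 lee_fin.
  rewrite -EFinM => gr.
  have gfin : gain gamma q0 f f v \is a fin_num.
    by rewrite -abse_fin_num ge0_fin_numE ?abse_ge0// (le_lt_trans gr)// ltry.
  move: gr; rewrite -(fineK gfin) /inve gt_eqF// -!EFinM !lee_fin => gr.
  rewrite normrM ger0_norm; last by rewrite mulr_ge0 ?invr_ge0 ?ltW.
  rewrite -invfM mulrC ler_pdivrMr; last exact: mulr_gt0.
  by apply: (le_trans gr); rewrite le_eqVlt; apply/orP; left; apply/eqP; ring.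
move=> _ _; rewrite (_ : +oo^-1 = 0)// !mul0e abse0 lee_fin//.
Qed.

End GainBound.

(** * Functions of infinite slope *)

Section MeasurableComparisons.
Context d (T : measurableType d) (R : realType) (f g : T -> R).
Hypotheses (mf : measurable_fun setT f) (mg : measurable_fun setT g).

Lemma measurable_le_set : measurable [set x | f x <= g x].
Proof.
have := measurable_fun_ler mf mg measurableT (Y := [set true]) (I : measurable [set true]).
by rewrite setTI.
Qed.

Lemma measurable_lt_set : measurable [set x | f x < g x].
Proof.
have := measurable_fun_ltr mf mg measurableT (Y := [set true]) (I : measurable [set true]).
by rewrite setTI.
Qed.

End MeasurableComparisons.

Lemma negligible_bigcup_count d (T : measurableType d) (R : realType)
    (mu : {measure set T -> \bar R}) (I : countType) (F : I -> set T) :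
  (forall i, mu.-negligible (F i)) -> mu.-negligible (\bigcup_i F i).
Proof.
move=> nF.
apply: (negligibleS (A := \bigcup_n oapp F set0 (@unpickle I n))).
  by move=> t [i _ Fit]; exists (pickle i) => //; rewrite pickleK.
apply: negligible_bigcup => n; case: unpickle => [i|] /=; first exact: nF.
exact: negligible_set0.
Qed.

Section SteepFunctions.
Context (R : realType).
Local Notation leb := (@lebesgue_measure R).
Implicit Types (A B : set R) (x y : R).

(** The covering interval is centred at an arbitrary point of [B], hence the factor 2. *)
Lemma lebesgue_le_diameter B (e : R) : 0 <= e -> measurable B ->
  (forall x y, B x -> B y -> `|x - y| <= e) -> (leb B <= (2 * e)%:E)%E.
Proof.
move=> e0 mB diam; have [[x Bx]|Bempty] := pselect (B !=set0); last first.
  have -> : B = set0 by apply/seteqP; split => // x Bx; apply: Bempty; exists x.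
  by rewrite measure0 lee_fin mulr_ge0.
apply: (@le_trans _ _ (leb `[x - e, x + e]%classic)).
  apply: le_measure; rewrite ?inE//.
  move=> y By /=; rewrite in_itv/=; have := diam x y Bx By.
  by rewrite ler_norml => /andP[h1 h2]; apply/andP; split; lra.
rewrite lebesgue_measure_itv/= lte_fin; case: ifP => _; last by rewrite lee_fin mulr_ge0.
by rewrite -EFinB lee_fin; lra.
Qed.

Section steep.
Variables (r : R -> R) (A : nat -> nat -> set R).
Hypothesis mr : measurable_fun setT r.
Hypothesis mA : forall K m, measurable (A K m).
Hypothesis ndA : forall K m n, (m <= n)%N -> A K m `<=` A K n.
Hypothesis steepA : forall K m x y, A K m x -> A K m y ->
  `|x - y| < m.+1%:R^-1 -> K.+1%:R * `|x - y| <= `|r x - r y|.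

(** The points of such a piece are within the scale of [A 0 k] of each other, so [r] does not
    contract distances: close values come from close points. The bound on [r] lets finitely many
    short intervals cover its range. *)
Let base k (c : R) (N : nat) := A 0 k `&` [set x | `|x - c| < (2 * k.+1%:R)^-1]
  `&` [set x | `|r x| < N.+1%:R].

Let mbase k c N : measurable (base k c N).
Proof.
apply: measurableI; first apply: measurableI => //.
  by apply: measurable_lt_set; measurability.
by apply: measurable_lt_set; measurability.
Qed.

Let base_steep k c N x y : base k c N x -> base k c N y -> `|x - y| <= `|r x - r y|.
Proof.
move=> [[Ax xc] _] [[Ay yc] _]; rewrite -[leLHS]mul1r; apply: steepA Ax Ay _.
have -> : x - y = (x - c) - (y - c) by ring.
apply: (le_lt_trans (ler_normB _ _)).
have -> : k.+1%:R^-1 = (2 * k.+1%:R)^-1 + (2 * k.+1%:R)^-1 :> R.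
  by field; rewrite addrC natr1 pnatr_eq0.
exact: ltrD.
Qed.

(* Cutting the range of [r] into short intervals: on each piece the slope
   bound [K.+1] holds at the scale of the piece. *)
Let base_bound k c N K m : (leb (base k c N `&` A K m) <= (8 * N.+1%:R / K.+1%:R)%:E)%E.
Proof.
set D : R := N.+1%:R; have D0 : 0 < D by rewrite ltr0n.
have m0 : 0 < m.+1%:R :> R by rewrite ltr0n.
have K0 : 0 < K.+1%:R :> R by rewrite ltr0n.
(* Chosen so that intervals of length [e = 2 D / (n + 1)] are shorter than the scale [1 / (m + 1)]
   of [A K m]. *)
have [n nE] : exists n, 2 * D * m.+1%:R < n.+1%:R.
  have := @archi_boundP R (2 * D * m.+1%:R); set n := Num.bound _ => h.
  by exists n; rewrite (lt_trans (h _))// ?ltr_nat// mulr_ge0// ltW// mulr_gt0.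
have n0 : 0 < n.+1%:R :> R by rewrite ltr0n.
pose e := 2 * D / n.+1%:R.
have e0 : 0 < e by rewrite divr_gt0// mulr_gt0.
have em : e < m.+1%:R^-1 by rewrite ltr_pdivrMr// ltr_pdivlMl// mulrC.
pose P i := base k c N `&` A K m `&`
  [set x | i%:R * e - D <= r x] `&` [set x | r x < i.+1%:R * e - D].
have mP i : measurable (P i).
  apply: measurableI; first (apply: measurableI; first exact: measurableI).
    by apply: measurable_le_set; measurability.
  by apply: measurable_lt_set; measurability.
have Pi i : (leb (P i) <= (2 * (e / K.+1%:R))%:E)%E.
  apply: lebesgue_le_diameter => //; first by rewrite divr_ge0// ltW.
  move=> x y [[[bx Ax] h1] h2] [[[By Ay] h3] h4].
  have rxy : `|r x - r y| < e.
    move: h1 h2 h3 h4 => /=; rewrite -natr1 mulrDl mul1r ltr_norml => h1 h2 h3 h4.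
    by apply/andP; split; lra.
  (* The slope bound 1 brings the two points within the scale of [A K m]; then the slope bound
     [K + 1] applies. *)
  rewrite ler_pdivlMr// mulrC; apply: ltW; apply: (le_lt_trans _ rxy).
  apply: steepA Ax Ay _; apply: le_lt_trans (base_steep bx By) _.
  exact: lt_trans rxy em.
have cover : base k c N `&` A K m `<=` \big[setU/set0]_(i < n.+1) P i.
  move=> x [bx Ax]; rewrite -bigcup_mkord.
  have [_ /=] := bx; rewrite ltr_norml => /andP[rl ru].
  pose i := Num.trunc ((r x + D) / e).
  have q0 : 0 <= (r x + D) / e by rewrite divr_ge0 ?(ltW e0)//; lra.
  have /andP[i1 i2] := truncn_itv q0.
  have h1 : i%:R * e - D <= r x.
    by move: i1; rewrite ler_pdivlMr// => i1; rewrite /i; lra.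
  have h2 : r x < i.+1%:R * e - D.
    by move: i2; rewrite ltr_pdivrMr// => i2; rewrite /i; lra.
  exists i => //=; rewrite -(ltr_nat R) -(ltr_pM2r e0).
  apply: (le_lt_trans (y := r x + D)); first by lra.
  by rewrite /e mulrC divfK ?gt_eqF//; lra.
apply: (@le_trans _ _ (\sum_(i < n.+1) leb (P i))).
  apply: content_subadditive => //; [by move=> i _; exact: mP|exact: (measurableI _ _ (mbase _ _ _) (mA _ _))].
apply: (@le_trans _ _ (\sum_(i < n.+1) (2 * (e / K.+1%:R))%:E)%E).
  by apply: lee_sum.
rewrite sumEFin lee_fin sumr_const card_ord.
have -> : (2 * (e / K.+1%:R)) *+ n.+1 = 4 * D / K.+1%:R :> R.
  rewrite -[LHS]mulr_natl /e; have := lt0r_neq0 K0; have := lt0r_neq0 n0.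
  by move: (n.+1%:R : R) (K.+1%:R : R) => a b a0 b0; field; rewrite a0 b0.
by rewrite ler_pM2r ?invr_gt0// ler_pM2r//; lra.
Qed.

(** Countably many pieces, with rational centres, cover the set. On each, the bound
    [8 (N + 1) / (K + 1)] is uniform in [m], so it survives the increasing union over [m] and then
    tends to 0 as [K] grows. *)
Lemma steep_negligible : leb.-negligible (\bigcap_K \bigcup_m A K m).
Proof.
set E := \bigcap_K _.
have mU K : measurable (\bigcup_m A K m) by exact: bigcupT_measurable.
have mE : measurable E by exact: bigcapT_measurable.
have sub : E `<=` \bigcup_k \bigcup_(q : rat) \bigcup_N (base k (ratr q) N `&` E).
  move=> x Ex; have [k _ Akx] := Ex 0%N I.
  have [h hE] : exists h, h = (2 * k.+1%:R)^-1 :> R by eexists.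
  have h0 : 0 < h by rewrite hE invr_gt0 mulr_gt0// ltr0n.
  have [q] : exists q, ratr q \in `]x - h, x + h[ by apply: rat_in_itvoo; lra.
  rewrite in_itv/= => /andP[q1 q2].
  exists k => //; exists q => //; exists (Num.bound `|r x|) => //; split => //.
  split; first split => //=.
    by rewrite -hE ltr_norml; apply/andP; split; lra.
  by apply: (lt_le_trans (archi_boundP (normr_ge0 _))); rewrite ler_nat.
apply: (@negligibleS _ (measurableTypeR R) R leb _ _ sub).
apply: negligible_bigcup => k; apply: negligible_bigcup_count => q.
apply: negligible_bigcup => N; apply/negligibleP; first exact: (measurableI _ _ (mbase _ _ _) mE).
apply/eqP; rewrite eq_le measure_ge0 andbT; apply/lee_addgt0Pr => e e0; rewrite add0e.
have [K Ke] : exists K, 8 * N.+1%:R / K.+1%:R <= e.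
  have := @archi_boundP R (8 * N.+1%:R / e); set K := Num.bound _ => h.
  have q0 : 0 <= 8 * N.+1%:R / e by rewrite divr_ge0 ?mulr_ge0// ltW.
  exists K; rewrite ler_pdivrMr ?ltr0n// [e * _]mulrC -ler_pdivrMr//.
  by apply/ltW/(lt_trans (h q0)); rewrite ltr_nat.
apply: (@le_trans _ _ (8 * N.+1%:R / K.+1%:R)%:E); last by rewrite lee_fin.
apply: (@le_trans _ _ (leb (\bigcup_m (base k (ratr q) N `&` A K m)))).
  apply: le_measure; rewrite ?inE; [exact: (measurableI _ _ (mbase _ _ _) mE)| |].
    by apply: bigcupT_measurable => m; exact: (measurableI _ _ (mbase _ _ _) (mA _ _)).
  by rewrite -setI_bigcupr; apply: setIS => x /(_ K I).
have mBA m : measurable (base k (ratr q) N `&` A K m) by exact: (measurableI _ _ (mbase _ _ _) (mA _ _)).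
have ndBA : {homo (fun m => base k (ratr q) N `&` A K m) : m n / (m <= n)%N >-> (m <= n)%O}.
  by move=> m n mn; apply/subsetPset; apply: setIS; exact: ndA.
have cv := @nondecreasing_cvg_mu _ _ _ leb _ mBA (bigcupT_measurable _ mBA) ndBA.
rewrite -(cvg_lim _ cv)//; apply: lime_le.
  by apply/cvg_ex; eexists; exact: cv.
by apply: nearW => m; exact: base_bound.
Qed.

End steep.
End SteepFunctions.

(** * Borel sets and null sets in space *)

Section BorelSets.
Context (R : realType).
Local Notation V := 'rV[R]_3.
Local Notation leb := (@lebesgue_measure R).

Lemma rat_near (x e : R) : 0 < e -> exists q : rat, `|x - ratr q| < e.
Proof.
move=> e0; have [q] : exists q, ratr q \in `]x - e, x + e[ by apply: rat_in_itvoo; lra.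
by rewrite in_itv/= => /andP[h1 h2]; exists q; rewrite ltr_norml; apply/andP; split; lra.
Qed.

Lemma ball3P (v w : V) (e : R) : 0 < e ->
  ball v e w <-> [/\ `|v 0 0 - w 0 0| < e, `|v 0 1 - w 0 1| < e &
                     `|v 0 2%:R - w 0 2%:R| < e].
Proof.
move=> e0; split=> [[_ h]|[h0 h1 h2]]; first by split; exact: h.
split=> // i; rewrite [i]ord1.
by move=> [[|[|[|//]]] j3]; [have := h0|have := h1|have := h2];
  congr (`|v _ _ - w _ _| < e); exact: val_inj.
Qed.

(** An open set is the union of the countably many cubes of rational centre and radius [1 / (n + 1)]
    that it contains. *)
Lemma open_measurable3 (O : set V) : open O -> measurable (@v3 R @^-1` O).
Proof.
move=> oO.
pose box (q : rat * rat * rat * nat) : set V :=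
  ball (vec3 (ratr q.1.1.1) (ratr q.1.1.2) (ratr q.1.2)) (q.2.+1%:R^-1 : R).
have n0 n : 0 < n.+1%:R^-1 :> R by rewrite invr_gt0.
have mbox q : measurable (@v3 R @^-1` box q).
  have -> : @v3 R @^-1` box q =
      [set p | `|ratr q.1.1.1 - p.1.1| < q.2.+1%:R^-1] `&`
      [set p | `|ratr q.1.1.2 - p.1.2| < q.2.+1%:R^-1] `&`
      [set p | `|ratr q.1.2 - p.2| < q.2.+1%:R^-1].
    apply/seteqP; split => [p|p] /=.
      by move=> /(ball3P _ _ (n0 q.2)); rewrite !mxE => -[].
    by move=> [[h1 h2] h3]; apply/(ball3P _ _ (n0 q.2)); rewrite !mxE.
  by apply: measurableI; first apply: measurableI; apply: measurable_lt_set; measurability.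
have -> : @v3 R @^-1` O = \bigcup_(q : rat * rat * rat * nat)
    ((if `[<box q `<=` O>] then @v3 R @^-1` box q else set0)).
  apply/seteqP; split => [p Op|p [q _]]; last first.
    by case: asboolP => // bO; exact: bO.
  have /nbhs_ballP[e /= e0 eO] : nbhs (v3 p) O by exact: open_nbhs_nbhs.
  have [n ne] : exists n : nat, n.+1%:R^-1 < e / 2.
    have e20 : 0 <= (e / 2)^-1 by rewrite invr_ge0 divr_ge0// ltW.
    exists (Num.bound (e / 2)^-1); rewrite invf_plt ?posrE ?ltr0n ?divr_gt0//.
    by rewrite (lt_trans (archi_boundP e20))// ltr_nat.
  have [a ha] := rat_near p.1.1 (n0 n).
  have [b hb] := rat_near p.1.2 (n0 n).
  have [c hc] := rat_near p.2 (n0 n).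
  exists (a, b, c, n) => //.
  have -> : `[<box (a, b, c, n) `<=` O>].
    apply/asboolP => w hw; apply: eO.
    have dd (s t u : R) : `|s - t| < n.+1%:R^-1 -> `|t - u| < n.+1%:R^-1 -> `|s - u| < e.
      move: ne; move: (n.+1%:R^-1 : R) => h ne.
      by rewrite !ltr_norml => /andP[h1 h2] /andP[h3 h4]; apply/andP; split; lra.
    move: hw => /(ball3P _ _ (n0 n)); rewrite !mxE => -[w1 w2 w3].
    by apply/(ball3P _ _ e0); rewrite !mxE; split;
      [exact: dd w1|exact: dd w2|exact: dd w3].
  by apply/(ball3P _ _ (n0 n)); rewrite !mxE; split; rewrite distrC.
apply: countable_bigcupT_measurable => [|q]; first exact: countableP.
by case: asboolP.
Qed.

Lemma lsc_borel (r : V -> R) : (forall c, open [set v | c < r v]) -> borel r.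
Proof.
move=> lsc; rewrite /borel.
apply: (measurability _ (RGenOInfty.measurableE R)) => //.
move=> _ [_ [a ->] <-]; rewrite setTI.
have -> : (fun p : R * R * R => r (vec3 p.1.1 p.1.2 p.2)) @^-1` `]a, +oo[%classic =
    @v3 R @^-1` [set v | a < r v].
  by apply/seteqP; split => p /=; rewrite in_itv/= andbT.
exact: open_measurable3.
Qed.

Lemma mvec_preimage d (X : measurableType d) (f : X -> V) (N : set V) :
  mvec f -> measurable (@v3 R @^-1` N) -> measurable (f @^-1` N).
Proof.
move=> mf mN.
have -> : f @^-1` N = (fun x => (f x 0 0, f x 0 1, f x 0 2%:R)) @^-1` (@v3 R @^-1` N).
  by apply/seteqP; split => x; rewrite /v3/= -vec3E.
rewrite -[_ @^-1` _]setTI.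
suff mg : measurable_fun setT (fun x => (f x 0 0, f x 0 1, f x 0 2%:R)) by exact: mg.
by apply: measurable_fun_pair; first apply: measurable_fun_pair.
Qed.

Definition null3 (N : set V) :=
  measurable (@v3 R @^-1` N) /\ int_R3 (fun v => (\1_N v : R)%:E) = 0%E.

Lemma borel_indic (N : set V) : measurable (@v3 R @^-1` N) ->
  borel (fun v => (\1_N v : R)%:E).
Proof.
move=> mN; apply/(@measurable_EFinP _ _ R setT (fun p => \1_N (v3 p))).
exact: (measurable_indic (U := @v3 R @^-1` N)).
Qed.

(** By Tonelli the [i]-th coordinate may be integrated first; each inner integral is the measure of
    a negligible set. *)
Lemma null3_lines (N : set V) (i : 'I_3) : measurable (@v3 R @^-1` N) ->
  (forall v, (@lebesgue_measure R).-negligible [set t | N (v + t *: delta_mx 0 i)]) ->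
  null3 N.
Proof.
move=> mN lines; split=> //.
have bN := borel_indic mN.
have N0 v : (0 <= (\1_N v : R)%:E :> \bar R)%E by rewrite lee_fin.
have line0 (f : R -> V) v : mvec f -> (forall t, f t = v + t *: delta_mx 0 i) ->
    (\int[@lebesgue_measure R]_t (\1_N (f t) : R)%:E = 0)%E.
  move=> mf fE; have mNf : measurable (f @^-1` N) by exact: mvec_preimage.
  rewrite (_ : (fun t => _) = EFin \o \1_(f @^-1` N))// integral_indic// setIT.
  apply/negligibleP => //; have := lines v; congr (_.-negligible _).
  by apply/seteqP; split => t /=; rewrite fE.
rewrite (int_R3E bN N0); case: i lines line0 => -[|[|[|//]]] i3 lines line0.
- etransitivity; first exact: (swap12 bN N0).
  apply: integral0_eq => y _.
  etransitivity.
    apply: (@tonelli _ _ _ _ R leb leb (fun x z => (\1_N (vec3 x y z) : R)%:E)).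
      exact: (borel_vec3 bN measurable_fst (@measurable_cst _ _ _ _ setT y) measurable_snd).
    by move=> x z; exact: N0.
  apply: integral0_eq => z _; apply: (line0 (fun x => vec3 x y z) (vec3 0 y z)).
    by move=> j; exact: mvec_vec3.
  by move=> t; apply/rowP => -[[|[|[|//]]] j3]; rewrite !mxE/= ?mulr1 ?mulr0 ?addr0 ?add0r.
- apply: integral0_eq => x _.
  etransitivity.
    apply: (@tonelli _ _ _ _ R leb leb (fun y z => (\1_N (vec3 x y z) : R)%:E)).
      exact: (borel_vec3 bN (@measurable_cst _ _ _ _ setT x) measurable_fst measurable_snd).
    by move=> y z; exact: N0.
  apply: integral0_eq => z _; apply: (line0 (fun y => vec3 x y z) (vec3 x 0 z)).
    by move=> j; exact: mvec_vec3.
  by move=> t; apply/rowP => -[[|[|[|//]]] j3]; rewrite !mxE/= ?mulr1 ?mulr0 ?addr0 ?add0r.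
- apply: integral0_eq => x _; apply: integral0_eq => y _.
  apply: (line0 (fun z => vec3 x y z) (vec3 x y 0)).
    by move=> j; exact: mvec_vec3.
  by move=> t; apply/rowP => -[[|[|[|//]]] j3]; rewrite !mxE/= ?mulr1 ?mulr0 ?addr0 ?add0r.
Qed.

End BorelSets.

(** * Grazing directions *)

Section QuadraticPaths.
Context (R : realType).
Implicit Types (x v w g : 'rV[R]_3) (r K d : R).

(** The point reached at time [r - K * d] with the perturbed velocity, measured from the unperturbed
    exit point [x - r *: v]: the displacement is of order [d]. *)
Lemma path_quadratic x v w r K d : x - (r - K * d) *: (v + d *: w) =
  x - r *: v + d *: (K *: v - r *: w + d *: (K *: w)).
Proof. by apply/rowP => j; rewrite !mxE; ring. Qed.

(** When [dot g v = 0] the first-order term in [d] is [- r * dot g w], whatever [K] is. *)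
Lemma dot_quadratic g v w r K d :
  dot g (d *: (K *: v - r *: w + d *: (K *: w))) =
  d * (K * dot g v + (d * K - r) * dot g w).
Proof. by rewrite !dotE !mxE; ring. Qed.

End QuadraticPaths.

Section ExitTime.
Context (R : realType).
Local Notation V := 'rV[R]_3.
Variables (Omega : set V) (x : V).
Hypotheses (oO : open Omega) (bO : bounded_set Omega) (Ox : Omega x).

Local Notation r v := (t_b Omega x v).
Let times (v : V) := [set 0] `|`
  [set tau : R | 0 < tau /\ forall s, 0 < s < tau -> Omega (x - s *: v)].

Let times0 v : times v 0. Proof. by left. Qed.

Let times_has_sup v : v != 0 -> has_sup (times v).
Proof.
move=> v0; split; first by exists 0.
have [M0 [_ MO]] := bO.
pose M := `|M0| + 1.
have MP y : Omega y -> `|y| <= M.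
  by apply: MO; rewrite /M; move: (ler_norm M0) => h; lra.
have v_gt0 : 0 < `|v| by rewrite normr_gt0.
have M_gt0 : 0 < M by rewrite /M; move: (normr_ge0 M0) => h; lra.
(* At time [tau / 2] the ray is still in [Omega], so it has moved by at most [2 M]. *)
exists (4 * M / `|v|) => tau [->|[tau0 tauO]].
  by rewrite divr_ge0 ?mulr_ge0// ltW.
rewrite ler_pdivlMr//.
have h1 : `|x - (tau / 2) *: v| <= M by apply/MP/tauO; apply/andP; split; lra.
have h2 := MP _ Ox.
have : `|(tau / 2) *: v| <= M + M.
  have -> : (tau / 2) *: v = x - (x - (tau / 2) *: v) by rewrite subKr.
  by rewrite (le_trans (ler_normB _ _))// lerD.
by rewrite normrZ gtr0_norm ?divr_gt0// => h; lra.
Qed.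

(** The set of times contains 0, and [sup] is 0 on an unbounded set. *)
Lemma t_b_ge0 v : 0 <= r v.
Proof.
have [hs|/sup_out e] := pselect (has_sup (times v)).
  by apply: (ub_le_sup (proj2 hs)); exact: times0.
by have -> : r v = 0 by exact: e.
Qed.

Lemma t_b_before v s : 0 <= s < r v -> Omega (x - s *: v).
Proof.
move=> /andP[s0 sr].
have [->|sn0] := eqVneq s 0; first by rewrite scale0r subr0.
have hs : has_sup (times v).
  apply: contrapT => /sup_out e; have e' : r v = 0 by exact: e.
  by move: sr; rewrite e'; lra.
have [tau [->|[tau0 tauO]] stau] := sup_gt (proj1 hs) sr.
  by move: s0 stau; lra.
by apply: tauO; rewrite stau lt_neqAle eq_sym sn0 s0.
Qed.

Let stays v s : v != 0 -> Omega (x - s *: v) ->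
  exists2 e, 0 < e & forall t, `|t - s| < e -> Omega (x - t *: v).
Proof.
move=> v0 Os; have /nbhs_ballP[e /= e0 eO] : nbhs (x - s *: v) Omega.
  exact: open_nbhs_nbhs.
have v_gt0 : 0 < `|v| by rewrite normr_gt0.
exists (e / `|v|) => [|t ts]; first exact: divr_gt0.
apply: eO; rewrite -ball_normE/=.
have -> : x - s *: v - (x - t *: v) = (t - s) *: v.
  by apply/rowP => i; rewrite !mxE; ring.
by rewrite normrZ -ltr_pdivlMr.
Qed.

(** Openness at time [t] prolongs the ray a little beyond it, and for [v != 0] the set of times is
    bounded, so its supremum exceeds [t]. *)
Let extend v t : v != 0 -> (forall s, 0 <= s <= t -> Omega (x - s *: v)) -> 0 <= t ->
  t < r v.
Proof.
move=> v0 tO t0; have [|e e0 eO] := @stays v t v0; first by apply: tO; rewrite t0 lexx.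
apply: (@lt_le_trans _ _ (t + e / 2)); first lra.
apply: (ub_le_sup (proj2 (times_has_sup v0))).
right; split; first lra; move=> s /andP[s0 st].
have [st'|ts] := leP s t; first by apply: tO; apply/andP; split => //; exact: ltW.
by apply: eO; rewrite ltr_norml; apply/andP; split; lra.
Qed.

Lemma t_b_gt0 v : v != 0 -> 0 < r v.
Proof.
move=> v0; apply: extend => // s s0; have -> : s = 0 by lra.
by rewrite scale0r subr0.
Qed.

Lemma t_b_exit v : v != 0 -> ~ Omega (x - r v *: v).
Proof.
move=> v0 Or; have : r v < r v; last by rewrite ltxx.
apply: extend => //; last exact: t_b_ge0.
move=> s /andP[s0]; rewrite le_eqVlt => /predU1P[->//|sr].
by apply: t_b_before; rewrite s0.
Qed.

Lemma x_b_boundary v : v != 0 -> boundary Omega (x_b Omega x v).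
Proof.
move=> v0; split; last by move=> /interior_subset; exact: t_b_exit.
move=> B /nbhs_ballP[e /= e0 eB].
have v_gt0 : 0 < `|v| by rewrite normr_gt0.
have r0 := t_b_gt0 v0.
have [d [d0 dr de]] : exists d, [/\ 0 < d, d <= r v & d * `|v| < e].
  exists (Num.min (r v) (e / 2 / `|v|)); split.
  - by rewrite lt_min r0 !divr_gt0.
  - by rewrite ge_min lexx.
  - rewrite (@le_lt_trans _ _ (e / 2 / `|v| * `|v|))//.
      by rewrite ler_wpM2r// ge_min lexx orbT.
    by rewrite divfK ?gt_eqF//; lra.
exists (x - (r v - d) *: v); split.
  by apply: t_b_before; apply/andP; split; lra.
apply: eB; rewrite -ball_normE/= /x_b.
have -> : x - r v *: v - (x - (r v - d) *: v) = - (d *: v).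
  by apply/rowP => i; rewrite !mxE; ring.
by rewrite normrN normrZ gtr0_norm.
Qed.

(** If [c < tau < r v], the compact segment of the ray up to [tau] lies in the open [Omega], and so
    does that of every velocity near [v], by the tube lemma. A negative [c] is below every exit
    time. *)
Lemma t_b_lsc c : open [set v | c < r v].
Proof.
rewrite openE => v /= cr.
have [c0|c0] := ltP c 0.
  by near=> w; exact: lt_le_trans (t_b_ge0 w).
have v0 : v != 0.
  (* At [v = 0] all positive times are admissible, so the default value 0 of the supremum
     contradicts [0 <= c < r v]. *)
  apply/eqP => v0; have : r v = 0; last lra.
  rewrite v0 /t_b sup_out// => -[_ [M Mub]].
  have := Mub (`|M| + 1); move: (ler_norm M) (normr_ge0 M) => h1 h2 /(_ _)-h3.
  suff : `|M| + 1 <= M by lra.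
  by apply: h3; right; split; [lra|move=> s _; rewrite scaler0 subr0].
pose tau := (c + r v) / 2.
have [ctau taur] : c < tau /\ tau < r v by rewrite /tau; split; lra.
have tube : \forall w \near v, `[0, tau]%classic `<=` [set s | Omega (x - s *: w)].
  move/compact_near_coveringP : (@segment_compact R 0 tau) => nc.
  apply: (nc V (nbhs v) (fun w s => Omega (x - s *: w)) _) => s; rewrite /= in_itv/= => /andP[s0 st].
  have Os : Omega (x - s *: v) by apply: t_b_before; apply/andP; split; lra.
  have : {for (s, v), continuous (fun p : R * V => x - p.1 *: p.2)}.
    apply: continuousB; first exact: cst_continuous.
    by apply: continuousZ; [exact: cvg_fst|exact: cvg_snd].
  by apply; exact: open_nbhs_nbhs.
have nz : \forall w \near v, w != 0 :> V.
  have v_gt0 : 0 < `|v| by rewrite normr_gt0.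
  near=> w; apply/eqP => w0; have : ball v `|v| w by near: w; exact: nbhsx_ballx.
  by rewrite -ball_normE/= w0 subr0 ltxx.
near=> w.
apply: (lt_trans ctau); apply: extend; [by near: w| |lra].
move=> s s01; have : `[0, tau]%classic `<=` [set s | Omega (x - s *: w)] by near: w.
by apply; rewrite /= in_itv.
Unshelve. all: by end_near.
Qed.

Definition axis (b : bool) (i : 'I_3) : V := (-1) ^+ b *: delta_mx 0 i.

Lemma diff_gradient (xi : V -> R) y u : differentiable xi y ->
  'd xi y u = dot (gradient xi y) u.
Proof.
move=> dxi; rewrite {1}(row_sum_delta u) linear_sum/= /dot; apply: eq_bigr => i _.
by rewrite linearZ/= mxE deriveE// mulrC.
Qed.

(* [xi] grows to first order along [axis b i], while moving back along the
   grazing ray by [K * d] changes it only to second order: the perturbed ray has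
   left [Omega] earlier by more than [K * d], for every [K]. *)
Lemma grazing_steep v : smooth_boundary Omega -> v != 0 -> grazing Omega (x, v) ->
  exists b i, forall K, 0 < K ->
    \forall d \near 0^'+, r (v + d *: axis b i) <= r v - K * d.
Proof.
move=> sO v0 [/= _]; set y := x_b Omega x v => graze.
have by_ : boundary Omega y by exact: x_b_boundary.
(* [outward_normal] selects a local defining function if there is one, and smoothness of the
   boundary excludes the default value; the grazing condition becomes orthogonality to the
   gradient. *)
have [U [xi [[oU Uy sU gU OU] graze']]] : exists U xi,
    local_defining_function Omega y U xi /\ dot (gradient xi y) v = 0.
  move: graze; rewrite /outward_normal; case: xgetP => [n _ [_ [U [xi [ldf ->]]]]|no].
    move=> h; exists U, xi; split=> //; have [_ Uy _ /(_ _ Uy) g0 _] := ldf.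
    have en0 : (enorm (gradient xi y))^-1 != 0.
      by rewrite invr_eq0 enorm_eq0.
    apply: (mulfI en0); rewrite mulr0 -h.
    have dotZ c (u u' : V) : dot (c *: u) u' = c * dot u u'.
      by rewrite /dot mulr_sumr; apply: eq_bigr => j _; rewrite mxE mulrA.
    exact/esym/dotZ.
  have [U [xi ldf]] := sO _ by_.
  by have := no ((enorm (gradient xi y))^-1 *: gradient xi y); case; split => //; exists U, xi.
have dxi : differentiable xi y by exact: (sU [::] y Uy).
have xiy : 0 <= xi y.
  rewrite leNgt; apply/negP => xiy.
  have : (Omega `&` U) y by rewrite OU.
  by move=> [Oy _]; exact: (t_b_exit v0 Oy).
have [i gi0] : exists i, gradient xi y 0 i != 0.
  apply: contrapT => no; have /negP := gU _ Uy; apply; apply/eqP/rowP => i.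
  rewrite [RHS]mxE; apply: contrapT => h; apply: no; exists i; exact/eqP.
pose a := `|gradient xi y 0 i|.
have a0 : 0 < a by rewrite normr_gt0.
(* The sign makes [xi] decrease along [w]. The ray is followed backwards, so perturbing [v] by
   [d *: w] moves its end by about [- d r w] and increases [xi]. *)
exists (0 < gradient xi y 0 i), i => K K0.
set w := axis _ _.
have gw : dot (gradient xi y) w = - a.
  rewrite /w /axis /a; move: (gradient xi y) => g.
  rewrite /dot (bigD1 i)//= big1 => [|j ji]; last by rewrite !mxE (negbTE ji) andbF !mulr0.
  rewrite !mxE !eqxx/= mulr1 addr0; case: ltP => h.
    by rewrite expr1 mulrN1 gtr0_norm.
  by rewrite expr0 mulr1 ler0_norm// opprK.
have r0 := t_b_gt0 v0.
pose W := `|K *: v - r v *: w| + `|K *: w|.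
have W0 : 0 <= W by rewrite addr_ge0.
have pathE d : x - (r v - K * d) *: (v + d *: w) =
    y + d *: (K *: v - r v *: w + d *: (K *: w)).
  exact: path_quadratic.
have pathW d : 0 < d < 1 -> `|d *: (K *: v - r v *: w + d *: (K *: w))| <= d * W.
  move=> /andP[d0 d1]; rewrite normrZ gtr0_norm// ler_wpM2l ?(ltW d0)//.
  rewrite (le_trans (ler_normD _ _))// lerD2l normrZ gtr0_norm//.
  by rewrite ler_piMl// ltW.
(* Tolerance of the first-order expansion: on displacements of size at most [d W] the error is at
   most a quarter of [d a r], while the gain [d a (r - K d)] exceeds half of it once
   [K d < r / 2]. *)
have e0 : 0 < a * r v / (4 * (W + 1)) by rewrite divr_gt0 ?mulr_gt0//; lra.
have eE : a * r v / (4 * (W + 1)) * W <= a * r v / 4.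
  rewrite mulrAC ler_pdivrMr; last by lra.
  have : 0 < a * r v by exact: mulr_gt0.
  by move: (a * r v) => c c0; nra.
have /eqaddoP/(_ _ e0)/nbhs_ballP[rho /= rho0 small] :
    (fun h => xi (y + h)) = (fun h => xi y + 'd xi y h) +o_ (0 : V) id.
  by apply/funext => h; exact: (diff_locallyxC dxi).
have /nbhs_ballP[rho' /= rho'0 ballU] : nbhs y U by exact: open_nbhs_nbhs.
near=> d.
have d0 : 0 < d by near: d; exact: nbhs_right_gt.
have d1 : d < 1 by near: d; exact: nbhs_right_lt.
have Kd : K * d < r v / 2.
  by rewrite mulrC -ltr_pdivlMr//; near: d; apply: nbhs_right_lt; rewrite !divr_gt0.
have dW c : 0 < c -> d < c / (W + 1) -> d * W < c.
  by rewrite ltr_pdivlMr; last lra; move=> c0; nra.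
have dr1 : d * W < rho.
  by apply: dW => //; near: d; apply: nbhs_right_lt; rewrite !divr_gt0//; lra.
have dr2 : d * W < rho'.
  by apply: dW => //; near: d; apply: nbhs_right_lt; rewrite !divr_gt0//; lra.
rewrite leNgt; apply/negP => long.
have O1 : Omega (x - (r v - K * d) *: (v + d *: w)).
  by apply: t_b_before; apply/andP; split => //; lra.
move: O1; rewrite pathE; set h := d *: _ => O1.
have hW : `|h| <= d * W by apply: pathW; rewrite d0.
have U1 : U (y + h).
  apply: ballU; rewrite -ball_normE/= opprD addrA subrr sub0r normrN.
  exact: le_lt_trans hW _.
have xi1 : xi (y + h) < 0.
  have : (Omega `&` U) (y + h) by [].
  by rewrite OU => -[].
have : `|xi (y + h) - (xi y + 'd xi y h)| <= a * r v / (4 * (W + 1)) * `|h|.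
  apply: small; rewrite -ball_normE/= sub0r normrN.
  exact: le_lt_trans hW _.
have -> : 'd xi y h = d * (a * (r v - K * d)).
  rewrite diff_gradient//.
  have -> : dot (gradient xi y) h =
     d * (K * dot (gradient xi y) v + (d * K - r v) * dot (gradient xi y) w).
    exact: dot_quadratic.
  by rewrite graze' gw; ring.
have : a * r v / (4 * (W + 1)) * `|h| <= d * (a * r v / 4).
  apply: (le_trans (ler_wpM2l (ltW e0) hW)); rewrite mulrCA.
  exact: (ler_wpM2l (ltW d0) eE).
have : 0 < d * a * (r v - 2 * (K * d)).
  by apply: mulr_gt0; [exact: mulr_gt0|lra].
move: (_ / (4 * (W + 1)) * `|h|) => E p1 p2; rewrite ler_norml => /andP[p3 _].
have p4 : 0 < d * a * r v by rewrite !mulr_gt0.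
by nra.
Unshelve. all: by end_near.
Qed.

End ExitTime.

Section NullSets.
Context (R : realType).
Local Notation V := 'rV[R]_3.
Local Notation leb := (@lebesgue_measure R).

Lemma measure_bigcup0 d (X : measurableType d) (m : {measure set X -> \bar R})
    (I : countType) (F : I -> set X) :
  (forall i, measurable (F i)) -> (forall i, m (F i) = 0%E) ->
  m (\bigcup_i F i) = 0%E.
Proof.
move=> mF F0; apply: measure_negligible.
  by apply: countable_bigcupT_measurable => //; exact: countableP.
by apply: negligible_bigcup_count => i; exists (F i); split.
Qed.

Lemma int_R3_indic : exists m : 
    {measure set (measurableTypeR R * measurableTypeR R * measurableTypeR R)%type -> \bar R},
  forall N : set V, measurable (@v3 R @^-1` N) ->
  int_R3 (fun v => (\1_N v : R)%:E) = m (@v3 R @^-1` N).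
Proof.
exists ((leb \x leb) \x leb)%E => N mN; rewrite -[in RHS](setIT (@v3 R @^-1` N)).
have <- := @integral_indic _ _ R ((leb \x leb) \x leb)%E setT measurableT _ mN.
by apply: eq_integral => p _; rewrite !indicE.
Qed.

Lemma null3_bigcup (I : countType) (N : I -> set V) :
  (forall i, null3 (N i)) -> null3 (\bigcup_i N i).
Proof.
have [m mE] := int_R3_indic; move=> N0.
have mN i : measurable (@v3 R @^-1` N i) by case: (N0 i).
have mU : measurable (@v3 R @^-1` \bigcup_i N i).
  by rewrite preimage_bigcup; apply: countable_bigcupT_measurable => //; exact: countableP.
split=> //; rewrite mE// preimage_bigcup; apply: measure_bigcup0 => i; first exact: mN.
by etransitivity; [exact/esym/mE|case: (N0 i)].
Qed.

Lemma null3U (N N' : set V) : null3 N -> null3 N' -> null3 (N `|` N').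
Proof.
move=> N0 N'0; rewrite (_ : N `|` N' = \bigcup_(b : bool) (if b then N else N')).
  by apply: null3_bigcup => -[].
apply/seteqP; split => [v [Nv|Nv]|v [[] _ Nv]]; [|by exists false|by left|by right].
by exists true.
Qed.

Lemma null3_point (v : V) : null3 [set v].
Proof.
apply: (@null3_lines _ _ 0) => [|w].
  have -> : @v3 R @^-1` [set v] = [set v 0 0] `*` [set v 0 1] `*` [set v 0 2%:R].
    apply/seteqP; split => [[[a b] c]|[[a b] c]] /=; rewrite /v3/=.
      by move=> <-; rewrite !mxE.
    by move=> [[-> ->] ->]; rewrite -vec3E.
  by apply: measurableX => //; apply: measurableX.
exists [set v 0 0 - w 0 0]; split; first exact: measurable_set1.
  exact: lebesgue_measure_set1.
by move=> t /= <-; rewrite !mxE/= mulr1; lra.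
Qed.

End NullSets.

Section GrazingDirections.
Context (R : realType).
Local Notation V := 'rV[R]_3.
Local Notation leb := (@lebesgue_measure R).
Variables (Omega : set V) (x : V).
Hypotheses (oO : open Omega) (bO : bounded_set Omega) (Ox : Omega x).

Local Notation r v := (t_b Omega x v).

(* Rational increments keep this set Borel; lower semicontinuity of [t_b] extends
   the inequality to real increments. *)
Definition steep_toward b i K m : set V := [set v | forall q : rat,
  0 < (ratr q : R) < m.+1%:R^-1 ->
  r (v + ratr q *: axis R b i) <= r v - K.+1%:R * ratr q].

(** The null set N(x) of the overview. The velocity 0, where [t_b] takes a default value, is added
    by hand. *)
Definition grazing_hull : set V := [set 0] `|`
  \bigcup_(p : bool * 'I_3) \bigcap_K \bigcup_m steep_toward p.1 p.2 K m.

Let r_borel : borel (fun v => r v).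
Proof. by apply: lsc_borel => c; exact: t_b_lsc. Qed.

Let measurable_steep b i K m : measurable (@v3 R @^-1` steep_toward b i K m).
Proof.
have -> : @v3 R @^-1` steep_toward b i K m = ~` \bigcup_(q : rat)
    (if 0 < (ratr q : R) < m.+1%:R^-1 then
      [set p | r (vec3 p.1.1 p.1.2 p.2) - K.+1%:R * ratr q <
               r (vec3 p.1.1 p.1.2 p.2 + ratr q *: axis R b i)] else set0).
  apply/seteqP; split => [p sp [q _]|p sp q q0].
    by case: ifPn => // q0; apply/negP; rewrite -leNgt; exact: sp.
  by rewrite leNgt; apply/negP => h; apply: sp; exists q => //; rewrite q0.
apply: measurableC; apply: countable_bigcupT_measurable => [|q]; first exact: countableP.
case: ifPn => // _; apply: measurable_lt_set.
  by apply: measurable_funB => //; exact: r_borel.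
apply: (borel_mvec r_borel (a := fun p : R * R * R => vec3 p.1.1 p.1.2 p.2 + _)).
by apply: mvecD; [apply: mvec_vec3; measurability|exact: mvec_cst].
Qed.

Let steep_real b i K m v (d : R) : steep_toward b i K m v ->
  0 < d < m.+1%:R^-1 -> r (v + d *: axis R b i) <= r v - K.+1%:R * d.
Proof.
move=> sv; move: sv; rewrite /steep_toward/=; move: (m.+1%:R^-1 : R) => h sv /andP[d0 dh].
rewrite leNgt; apply/negP => long.
pose w := v + d *: axis R b i.
pose c := (r w + (r v - K.+1%:R * d)) / 2.
have [c1 c2] : c < r w /\ r v - K.+1%:R * d < c by rewrite /c; split; lra.
have /nbhs_ballP[e /= e0 eP] : nbhs w [set u | c < r u].
  by apply: open_nbhs_nbhs; split => //; exact: t_b_lsc.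
(* A rational [q] within [g] of [d] is admissible, keeps the perturbed velocity where [r > c], and
   changes the right-hand side too little to exceed [c]. *)
pose g := Num.min (Num.min e d) (Num.min (h - d) ((c - (r v - K.+1%:R * d)) / K.+1%:R)).
have g0 : 0 < g by rewrite !lt_min e0 d0 subr_gt0 dh divr_gt0 ?subr_gt0// ltr0n.
have [g1 g2 g3 g4] : [/\ g <= e, g <= d, g <= h - d &
    g <= (c - (r v - K.+1%:R * d)) / K.+1%:R].
  by split; rewrite !ge_min lexx ?orbT.
have [q] := rat_near d g0; rewrite ltr_norml => /andP[q1 q2].
have q0 : 0 < (ratr q : R) < h by apply/andP; split; lra.
have := sv q q0; apply/negP; rewrite -ltNge.
apply: (@le_lt_trans _ _ c).
  have K0 : 0 < K.+1%:R :> R by rewrite ltr0n.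
  move: g4; rewrite ler_pdivlMr//; move: (K.+1%:R : R) K0 q1 q2 => k k0 q1 q2 g4.
  have : (d - ratr q) * k <= g * k by rewrite ler_wpM2r// ltW.
  lra.
apply: eP; split=> // k j; suff : `|w k j - (v + ratr q *: axis R b i) k j| < e by [].
rewrite !mxE.
rewrite (_ : _ - _ = (d - ratr q) * ((-1) ^+ b * ((k == 0) && (j == i))%:R)); last first.
  by ring.
rewrite !normrM normrX normrN1 expr1n mul1r.
have dq : `|d - ratr q| < e by rewrite ltr_norml; apply/andP; split; lra.
by case: (_ && _); rewrite ?normr1 ?mulr1// normr0 mulr0.
Qed.

Lemma null3_grazing_hull : null3 grazing_hull.
Proof.
apply: null3U; first exact: null3_point.
apply: null3_bigcup => -[b i] /=; apply: (@null3_lines _ _ i) => [|v].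
  rewrite preimage_bigcap; apply: bigcapT_measurable => K.
  by rewrite preimage_bigcup; apply: bigcupT_measurable => m.
have mline : mvec (fun t : R => v + t *: delta_mx 0 i : V).
  by apply: mvecD; [exact: mvec_cst|apply: mvecZ; [exact: measurable_id|exact: mvec_cst]].
rewrite (_ : [set t | _] = \bigcap_K \bigcup_m
    ((fun t : R => v + t *: delta_mx 0 i : V) @^-1` steep_toward b i K m)); last first.
  by apply/seteqP; split => t.
apply: (@steep_negligible _ (fun t => r (v + t *: delta_mx 0 i))).
- exact: (borel_mvec r_borel).
- by move=> K m; exact: mvec_preimage.
- move=> K m n mn t /= st q /andP[q0 qn]; apply: st; rewrite q0/=.
  by rewrite (lt_le_trans qn)// lef_pV2 ?posrE ?ltr0n// ler_nat.
- move=> K m s t; wlog st : s t / s < t => [hw|].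
    have [|ts|->] := ltgtP s t; first exact: hw.
      by move=> ms mt; rewrite distrC [X in _ <= X]distrC => h; exact: hw.
    by rewrite subrr normr0 mulr0.
  move=> /= ms mt; rewrite ler0_norm ?subr_le0 ?(ltW st)// opprB => ts.
  have n1 := ler_norm (r (v + s *: delta_mx 0 i) - r (v + t *: delta_mx 0 i)).
  have n2 := ler_norm (r (v + t *: delta_mx 0 i) - r (v + s *: delta_mx 0 i)).
  rewrite distrC in n2.
  have dt : 0 < t - s < m.+1%:R^-1 by rewrite subr_gt0 st.
  (* Along the negative axis the increment starts at the larger parameter [t], along the positive
     one at [s]. *)
  case: b ms mt => ms mt.
    have := steep_real mt dt; rewrite /axis expr1 scaleN1r.
    rewrite (_ : _ + (t - s) *: _ = v + s *: delta_mx 0 i).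
      by move=> h; lra.
    by move: (delta_mx 0 i : V) => w; apply/rowP => j; rewrite !mxE; ring.
  have := steep_real ms dt; rewrite /axis expr0 scale1r.
  rewrite (_ : _ + (t - s) *: _ = v + t *: delta_mx 0 i).
    by move=> h; lra.
  by move: (delta_mx 0 i : V) => w; apply/rowP => j; rewrite !mxE; ring.
Qed.

Lemma grazing_sub_hull v : smooth_boundary Omega -> grazing Omega (x, v) ->
  grazing_hull v.
Proof.
move=> sO gv; have [->|v0] := eqVneq v 0; first by left.
have [b [i steep]] := grazing_steep oO bO Ox sO v0 gv.
right; exists (b, i) => //= K _.
have K0 : 0 < K.+1%:R :> R by rewrite ltr0n.
have /nbhs_ballP[e /= e0 eP] := steep _ K0.
exists (Num.bound e^-1) => // q /andP[q0 qe].
apply: eP => //; rewrite -ball_normE/= sub0r normrN gtr0_norm// (lt_le_trans qe)//.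
rewrite invf_ple ?posrE ?ltr0n//.
have ei : 0 <= e^-1 by rewrite invr_ge0 ltW.
by rewrite (ltW (lt_trans (archi_boundP ei) _))// ltr_nat.
Qed.

End GrazingDirections.

(** * Null sets and collisions *)

Section ZeroIntegrals.
Context d (T : measurableType d) (R : realType) (mu : {measure set T -> \bar R}).
Local Open Scope ereal_scope.

Lemma null_integral_ae (D : set T) (f : T -> \bar R) :
  measurable D -> measurable_fun D f -> (forall x, D x -> 0 <= f x) ->
  \int[mu]_(x in D) f x = 0 ->
  exists N, [/\ measurable N, mu N = 0 & forall x, D x -> ~ N x -> f x = 0].
Proof.
move=> mD mf f0 If.
have : ae_eq mu D f (cst 0).
  apply/(ae_eq_integral_abs _ mD mf); rewrite -[RHS]If; apply: eq_integral => x /set_mem Dx.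
  by rewrite gee0_abs// f0.
move=> [N [mN N0 sub]]; exists N; split => // x Dx Nx.
by apply: contrapT => fx; apply: Nx; apply: sub => /= h; apply: fx; exact: h.
Qed.

(** Changes of variables serve below through their effect on null sets: a Jacobian that vanishes
    only on [N] is stripped off pointwise, where the integrand vanishes. *)
Lemma null_integral_transfer (D N : set T) (f g : T -> \bar R) :
  measurable D -> measurable_fun D f -> (forall x, D x -> 0 <= f x) ->
  measurable N -> mu N = 0 -> \int[mu]_(x in D) f x = 0 ->
  (forall x, D x -> ~ N x -> f x = 0 -> g x = 0) -> \int[mu]_(x in D) g x = 0.
Proof.
move=> mD mf f0 mN N0 If fg.
have [N' [mN' N'0 fN']] := null_integral_ae mD mf f0 If.
rewrite -[RHS](@integral0 _ _ _ mu D).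
apply: (@integral_eq_off_null _ _ _ mu D (N `|` N')); first exact: measurableU.
  by apply: null_set_setU.
move=> x Dx Nx; apply: fg => //; first by move=> Nx'; apply: Nx; left.
by apply: fN' => // Nx'; apply: Nx; right.
Qed.

End ZeroIntegrals.

(* The two angles in [quad] parametrize half of the sphere, which
   suffices for functions even in the direction. *)
Section CollisionNullSets.
Context (R : realType).
Local Notation V := 'rV[R]_3.
Local Notation leb := (@lebesgue_measure R).
Local Notation quad := (`]- (pi / 2), (pi / 2)[%classic : set R).
Local Open Scope ereal_scope.

Let mquad : measurable quad. Proof. exact: measurable_itv. Qed.

Let space := prod_measure (prod_measure leb leb) leb.

Section quad_integrals.
Variable k : V -> R -> R -> \bar R.
Hypothesis mk : measurable_fun setT
  (fun q : (R * R * R) * (R * R) => k (v3 q.1) q.2.1 q.2.2).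
Hypothesis k0 : forall z s t, 0 <= k z s t.

Let mk1 : measurable_fun setT (fun q : (R * R * R) * R =>
  \int[leb]_(t in quad) k (v3 q.1) q.2 t).
Proof.
have /= H := @measurable_integral_on2 _ _ _ _ R leb setT quad
  (fun (p : (R * R * R) * R) t => k (v3 p.1) p.2 t) measurableT mquad.
apply: H => //; apply: measurable_funTS.
apply: (measurableT_comp (g := fun p : ((R * R * R) * R) * R =>
   (p.1.1, (p.1.2, p.2))) mk).
by apply: measurable_fun_pair; first measurability; apply: measurable_fun_pair; measurability.
Qed.

Lemma borel_quad : borel (fun z => \int[leb]_(s in quad) \int[leb]_(t in quad) k z s t).
Proof.
have /= H := @measurable_integral_on2 _ _ _ _ R leb setT quad
  (fun (p : R * R * R) s => \int[leb]_(t in quad) k (v3 p) s t) measurableT mquad.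
apply: H; first exact: measurable_funTS.
by move=> *; apply: integral_ge0.
Qed.

Lemma int_R3_quad_swap :
  int_R3 (fun z => \int[leb]_(s in quad) \int[leb]_(t in quad) k z s t) =
  \int[leb]_(s in quad) \int[leb]_(t in quad) int_R3 (fun z => k z s t).
Proof.
transitivity (\int[leb]_(s in quad) int_R3 (fun z => \int[leb]_(t in quad) k z s t)).
  apply: (@tonelli_on _ _ _ _ R space leb setT quad
    (fun y s => \int[leb]_(t in quad) k (v3 y) s t)) => //.
    exact: measurable_funTS.
  by move=> *; apply: integral_ge0.
apply: eq_integral => s _.
apply: (@tonelli_on _ _ _ _ R space leb setT quad (fun y t => k (v3 y) s t)) => //.
apply: measurable_funTS.
apply: (measurableT_comp (g := fun p : (R * R * R) * R => (p.1, (s, p.2))) mk).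
apply: measurable_fun_pair; first exact: measurable_fst.
have ms : measurable_fun setT (pair s : R -> R * R).
  by apply: measurable_fun_pair; measurability.
exact: (measurableT_comp ms measurable_snd).
Qed.

End quad_integrals.

(** Evenness in [w] reduces the sphere to two angles in [quad], and Tonelli moves the integral over
    [z] innermost, so that the direction can be fixed first. *)
Lemma collision_null_quad (Q : V -> V -> V) (k : V -> \bar R) :
  mvec (fun q : (R * R * R) * (R * R * R) => Q (v3 q.1) (v3 q.2)) ->
  (forall z w, Q z (- w)%R = Q z w) -> borel k -> (forall z, 0 <= k z) ->
  \int[leb]_(phi in quad) \int[leb]_(theta in quad)
    (`|sin theta|%:E * int_R3 (fun z => k (Q z (sph (theta, phi))))) = 0 ->
  int_R3 (fun z => int_S2 (fun w => k (Q z w))) = 0.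
Proof.
move=> mQ QN bk k0 null.
pose j z phi theta := sphere_density (fun w => k (Q z w)) theta phi.
have v3E (v : V) : v3 (v 0 0, v 0 1, v 0 2%:R)%R = v by rewrite [RHS]vec3E.
have comp d (X : measurableType d) (a b : X -> R * R * R) : measurable_fun setT a ->
    measurable_fun setT b -> measurable_fun setT (fun x => k (Q (v3 (a x)) (v3 (b x)))).
  move=> ma mb; apply: (borel_mvec bk (a := fun x => Q (v3 (a x)) (v3 (b x)))) => i.
  apply: (measurableT_comp (mQ i) (g := fun x => (a x, b x))).
  exact: measurable_fun_pair.
have bz z : borel (fun w => k (Q z w)).
  by rewrite -(v3E z); exact: (comp _ _ (fun=> (z 0 0, z 0 1, z 0 2%:R)%R) id).
have bw w : borel (fun z => k (Q z w)).
  by rewrite -(v3E w); exact: (comp _ _ id (fun=> (w 0 0, w 0 1, w 0 2%:R)%R)).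
have mj : measurable_fun setT (fun q : (R * R * R) * (R * R) => j (v3 q.1) q.2.1 q.2.2).
  apply: emeasurable_funM; last by measurability.
  apply: (comp _ _ fst (fun q => (sin q.2.2 * cos q.2.1, sin q.2.2 * sin q.2.1, cos q.2.2))%R) => //.
  by apply: measurable_fun_pair; first apply: measurable_fun_pair; measurability.
have j0 z s t : 0 <= j z s t by exact: sphere_density_ge0.
apply: (@null_integral_transfer _ _ R space setT set0
  (fun y => \int[leb]_(s in quad) \int[leb]_(t in quad) j (v3 y) s t)) => //.
- exact: (borel_quad mj j0).
- by move=> *; do 2?apply: integral_ge0 => *.
- etransitivity; first exact: (int_R3_quad_swap mj j0).
  rewrite -[RHS]null; apply: eq_integral => phi _; apply: eq_integral => theta _.
  rewrite -(int_R3Z (normr_ge0 _) (bw _) (fun=> k0 _)).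
  by apply: eq_int_R3 => z; rewrite muleC.
- move=> y _ _; rewrite (int_S2_even (bz _)) => [->||]; [by rewrite mule0| |] => *.
    exact: k0.
  by rewrite QN.
Qed.

End CollisionNullSets.

Section CollisionNullSets.
Context (R : realType).
Local Notation V := 'rV[R]_3.
Local Notation leb := (@lebesgue_measure R).
Local Notation quad := (`]- (pi / 2), (pi / 2)[%classic : set R).
Local Open Scope ereal_scope.

Let mquad : measurable quad. Proof. exact: measurable_itv. Qed.

Lemma mule_fin_eq0 (c : R) (y : \bar R) : (c != 0)%R -> c%:E * y = 0 -> y = 0.
Proof.
by move=> c0 /eqP; rewrite mule_eq0 eqe (negbTE c0) => /eqP.
Qed.

Lemma affine_null (G : R -> \bar R) (a b : R) : (a != 0)%R ->
  measurable_fun setT G -> (forall s, 0 <= G s) -> \int[leb]_s G s = 0 ->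
  \int[leb]_s G (a * s + b)%R = 0.
Proof.
move=> a0 mG G0 IG.
apply: (@null_integral_transfer _ _ R leb setT set0 (fun s => `|a|%:E * G (a * s + b)%R)) => //.
- apply: emeasurable_funM => //.
  by apply: (measurableT_comp mG (g := fun s => (a * s + b)%R)); measurability.
- by move=> s _; apply: mule_ge0; [rewrite lee_fin normr_ge0|exact: G0].
- by rewrite ge0_integral_affine.
- by move=> s _ _; apply: mule_fin_eq0; rewrite normr_eq0.
Qed.

(** The linear part is a plane substitution with constant Jacobian; the translation is made one
    variable at a time. *)
Lemma plane_affine_null (g : R -> R -> \bar R) (a b c d s t : R) :
  (a * d - b * c != 0)%R ->
  measurable_fun setT (fun p => g p.1 p.2) -> (forall x y, 0 <= g x y) ->
  \int[leb]_x \int[leb]_y g x y = 0 ->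
  \int[leb]_x \int[leb]_y g (a * (x - s) + b * (y - t))%R (c * (x - s) + d * (y - t))%R = 0.
Proof.
move=> D0 mg g0 Ig.
pose D := (`|a * d - b * c|)%R.
pose h x y := g (a * x + b * y)%R (c * x + d * y)%R.
have mh : measurable_fun setT (fun p => h p.1 p.2).
  apply: (@measurable_curried R g mg _ _ (fun p : R * R => (a * p.1 + b * p.2)%R)
    (fun p => (c * p.1 + d * p.2)%R)); measurability.
have h0 x y : 0 <= h x y by exact: g0.
have Dh : \int[leb]_x \int[leb]_y (D%:E * h x y) = 0.
  by rewrite -[RHS]Ig; exact: (ge0_integral_plane_map mg g0 D0).
have DN0 : (D != 0)%R by rewrite normr_eq0.
have mDh : measurable_fun setT (fun p => D%:E * h p.1 p.2).
  by apply: emeasurable_funM.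
have Dh0 x y : 0 <= D%:E * h x y by apply: mule_ge0; [rewrite lee_fin normr_ge0|exact: h0].
pose sh (x : R) := \int[leb]_y (D%:E * h x (1 * y + - t)%R).
have shE x : sh x = \int[leb]_y (D%:E * h x y).
  pose hx y := D%:E * h x y.
  have mhx : measurable_fun setT hx by exact: (@measurable_curried R (fun x y => D%:E * h x y) mDh _ _ (fun=> x) id).
  rewrite -(@ge0_integral_affine R 1 (- t)%R hx (oner_neq0 _) mhx (Dh0 x)).
  by apply: eq_integral => y _; rewrite normr1 mul1e.
have msh : measurable_fun setT sh.
  rewrite (_ : sh = fun x => \int[leb]_y (D%:E * h x y)); last exact/funext.
  exact: (@measurable_integral2 _ _ _ _ _ leb (fun x y => D%:E * h x y)).
have sh_null : \int[leb]_x sh (1 * x + - s)%R = 0.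
  apply: (affine_null _ (oner_neq0 R) msh) => [x|].
    by apply: integral_ge0 => y _; exact: Dh0.
  by rewrite -[RHS]Dh; apply: eq_integral => x _; exact: shE.
have msh' : measurable_fun setT (fun x : R => sh (1 * x + - s)%R).
  by apply: (measurableT_comp msh (g := fun x : R => (1 * x + - s)%R)); measurability.
have sh0 (x : R) : setT x -> 0 <= sh (1 * x + - s)%R.
  by move=> _; apply: integral_ge0 => y _; exact: Dh0.
apply: (@null_integral_transfer _ _ R leb setT set0 (fun x : R => sh (1 * x + - s)%R)
  _ measurableT msh' sh0 measurable0 (measure0 _) sh_null).
move=> /= x _ _ shx.
pose hx (y : R) := D%:E * h (1 * x + - s)%R (1 * y + - t)%R.
have mhx : measurable_fun setT hx.
  apply: (@measurable_curried R (fun x y => D%:E * h x y) mDh _ _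
    (fun _ : R => (1 * x + - s)%R) (fun y : R => (1 * y + - t)%R)); measurability.
apply: (@null_integral_transfer _ _ R leb setT set0 hx
  _ measurableT mhx (fun y _ => Dh0 _ _) measurable0 (measure0 _) shx) => y _ _.
by move=> /(mule_fin_eq0 DN0); rewrite /h !mul1r.
Qed.

Variable k : V -> \bar R.
Hypotheses (bk : borel k) (k0 : forall z, 0 <= k z) (Ik : int_R3 k = 0).

Let reflect_borel (v : V) : borel (fun y => k (v - y)%R).
Proof.
rewrite /borel; apply: (borel_mvec bk (a := fun p : R * R * R => (v - v3 p)%R)).
by apply: mvecD; [exact: mvec_cst|apply: mvecN; apply: mvec_vec3; measurability].
Qed.

(* [z] enters only through [s = dot z w], and [s *: w] are polar coordinates. *)
Lemma post_v_null (v : V) :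
  int_R3 (fun z => int_S2 (fun w => k (v - dot z w *: w)%R)) = 0.
Proof.
apply: (@collision_null_quad R (fun z w => v - dot z w *: w)%R) => //.
- apply: mvecD; first exact: mvec_cst.
  apply: mvecN; apply: mvecZ; last exact: v3_mvec.
  by apply: measurable_dot; exact: v3_mvec.
- move=> z w; congr (v - _)%R.
  by apply/rowP => i; rewrite !dotE !mxE; ring.
pose C phi theta := \int[leb]_r ((r ^+ 2 * `|sin theta|)%:E *
   k (v - r *: sph (theta, phi))%R).
have C0 phi theta : 0 <= C phi theta.
  apply: integral_ge0 => r _; apply: mule_ge0; last exact: k0.
  by rewrite lee_fin; apply: mulr_ge0; [exact: sqr_ge0|exact: normr_ge0].
have mC : measurable_fun setT (fun p : R * R => C p.1 p.2).
  have /= H := @measurable_integral2 _ _ _ _ R leb (fun (p : R * R) (r : R) =>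
    (r ^+ 2 * `|sin p.2|)%:E * k (v - r *: sph (p.2, p.1))%R).
  apply: H => [|p r].
    apply: emeasurable_funM; first by measurability.
    apply: (borel_mvec bk (a := fun q : (R * R) * R => (v - q.2 *: sph (q.1.2, q.1.1))%R)).
    apply: mvecD; first exact: mvec_cst.
    apply: mvecN; apply: mvecZ; first exact: measurable_snd.
    by rewrite /sph /=; apply: mvec_vec3; measurability.
  by apply: mule_ge0 => //; rewrite lee_fin; apply: mulr_ge0; [exact: sqr_ge0|exact: normr_ge0].
apply: (@null_integral_transfer _ _ R leb quad set0
  (fun phi => \int[leb]_(theta in quad) C phi theta)) => //.
- have /= H := @measurable_integral_on2 _ _ _ _ R leb quad quad C mquad mquad.
  by apply: H => //; exact: measurable_funTS.
- by move=> *; apply: integral_ge0.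
- rewrite -[RHS]Ik -[RHS](ge0_int_R3_reflect v bk k0).
  exact: (polar_integral (reflect_borel v) (fun=> k0 _)).
move=> phi _ _ IC.
apply: (@null_integral_transfer _ _ R leb quad set0 (C phi)) => //.
- apply: measurable_funTS.
  exact: (@measurable_curried R C mC _ _ (fun=> phi) id).
move=> theta qt _ Ct; have [->|st] := eqVneq (sin theta) 0%R.
  by rewrite normr0 mul0e.
rewrite [X in _ * X](_ : _ = 0) ?mule0//.
pose w : V := sph (theta, phi).
pose G (s : R) := k (v - s *: w)%R.
have mG : measurable_fun setT G.
  apply: (borel_mvec bk (a := fun s : R => (v - s *: w)%R)).
  by apply: mvecD; [exact: mvec_cst|apply: mvecN; apply: mvecZ; [exact: measurable_id|exact: mvec_cst]].
(* The weight [r^2 |sin theta|] vanishes only at [r = 0]. *)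
have IG : \int[leb]_s G s = 0.
  apply: (@null_integral_transfer _ _ R leb setT [set 0%R]
    (fun r => (r ^+ 2 * `|sin theta|)%:E * G r)) => //.
  - by apply: emeasurable_funM => //; measurability.
  - move=> r _; apply: mule_ge0; last exact: k0.
    by rewrite lee_fin; apply: mulr_ge0; [exact: sqr_ge0|exact: normr_ge0].
  - exact: lebesgue_measure_set1.
  - by move=> r _ /eqP r0; apply: mule_fin_eq0; rewrite mulf_neq0 ?expf_neq0// normr_eq0.
have bG : borel (fun z => G (dot z w)).
  apply: (measurableT_comp mG (g := fun p : R * R * R => dot (vec3 p.1.1 p.1.2 p.2) w)).
  by measurability.
etransitivity; first exact: (int_R3E bG (fun=> k0 _)).
apply: integral0_eq => x _; apply: integral0_eq => y _.
(* [dot z w] is affine in the third coordinate of [z] with slope [cos theta], so each vertical line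
   already contributes 0. *)
have ct : (cos theta != 0)%R by exact: cos_neq0_quad.
rewrite -[RHS](affine_null (x * w 0%R 0%R + y * w 0%R 1%R)%R ct mG (fun=> k0 _) IG).
apply: eq_integral => z _; congr (G _).
by rewrite dotE !mxE/=; ring.
Qed.

(* [z - dot z w *: w] runs over the plane
   [p3 = - tan theta (cos phi p1 + sin phi p2)]. With [p1], [p2], [phi] fixed, the
   angle [theta] already sweeps the vertical line above [(p1, p2)]. *)
Section fixed_longitude.
Variables (v : V) (phi : R).
Hypothesis qphi : quad phi.

Let slope theta (x y : R) := (- (tan theta * (cos phi * x + sin phi * y)))%R.

Let kk (x y t : R) := k (v - vec3 x y t)%R.

Let kk0 x y t : 0 <= kk x y t. Proof. exact: k0. Qed.

Let mkk d (X : measurableType d) (a b c : X -> R) :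
  measurable_fun setT a -> measurable_fun setT b -> measurable_fun setT c ->
  measurable_fun setT (fun x => kk (a x) (b x) (c x)).
Proof. by move=> ma mb mc; exact: (borel_vec3 (reflect_borel v)). Qed.

Let m theta x y := kk x y (slope theta x y).

Let mm d (X : measurableType d) (a b c : X -> R) :
  measurable_fun setT a -> measurable_fun setT b -> measurable_fun setT c ->
  measurable_fun setT (fun x => m (a x) (b x) (c x)).
Proof.
move=> ma mb mc; apply: mkk => //; rewrite /slope.
apply: measurable_funN; apply: measurable_funM.
  by apply: (measurableT_comp (@measurable_tan R) (g := a)).
by apply: measurable_funD; apply: measurable_funM.
Qed.

(** Above [(x, y)] the height is [c * tan theta] with [c = - (cos phi x + sin phi y)], and the
    excluded [x] is the one with [c = 0]. The null integral is pulled back by a scaling and by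
    [tan]. *)
Let line_null x y : x != (- (tan phi * y))%R ->
  \int[leb]_t kk x y t = 0 -> \int[leb]_(theta in quad) m theta x y = 0.
Proof.
move=> xy I0; pose c := (- (cos phi * x + sin phi * y))%R.
have cphi : (cos phi != 0)%R by exact: cos_neq0_quad.
have c0 : (c != 0)%R.
  apply: contra_neq xy => c0; apply: (mulfI cphi).
  have -> : (cos phi * - (tan phi * y) = - (cos phi * (sin phi / cos phi) * y))%R.
    by rewrite /tan; ring.
  by rewrite mulrCA divff// mulr1; move: c0; rewrite /c => c0; lra.
pose G s := kk x y (c * s + 0)%R.
have mline : measurable_fun setT (kk x y).
  by apply: (mkk (a := fun=> x) (b := fun=> y) (c := id)).
have mG : measurable_fun setT G.
  by apply: (mkk (a := fun=> x) (b := fun=> y)) => //; measurability.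
have IG : \int[leb]_s G s = 0 by exact: affine_null.
have mtG : measurable_fun quad (fun s => (1 + tan s ^+ 2)%:E * G (tan s)).
  apply: measurable_funTS; apply: emeasurable_funM; first by measurability.
  exact: (measurableT_comp mG (@measurable_tan R)).
have tG0 s : quad s -> 0 <= (1 + tan s ^+ 2)%:E * G (tan s).
  by move=> _; apply: mule_ge0; [rewrite lee_fin addr_ge0 ?sqr_ge0|exact: kk0].
have ItG : \int[leb]_(s in quad) ((1 + tan s ^+ 2)%:E * G (tan s)) = 0.
  by rewrite -[RHS]IG; exact: (ge0_integral_tan mG (fun=> kk0 _ _ _)).
apply: (@null_integral_transfer _ _ R leb quad set0 _ _ mquad mtG tG0
  measurable0 (measure0 _) ItG) => t _ _ /mule_fin_eq0-h.
rewrite -[RHS]h; last by rewrite gt_eqF// ltr_pwDl// sqr_ge0.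
by rewrite /m /slope /G /c; congr kk; ring.
Qed.

Lemma slope_null :
  \int[leb]_(theta in quad) \int[leb]_x \int[leb]_y m theta x y = 0.
Proof.
have my theta y : measurable_fun setT (fun x => m theta x y).
  by apply: (mm (a := fun=> theta) (b := id) (c := fun=> y)).
(* Three exchanges bring [theta] innermost. *)
transitivity (\int[leb]_(theta in quad) \int[leb]_y \int[leb]_x m theta x y).
  apply: eq_integral => theta _.
  apply: (@tonelli _ _ _ _ R leb leb (m theta)); last by move=> *; exact: kk0.
  exact: (mm (a := fun=> theta) (b := fst) (c := snd)).
transitivity (\int[leb]_y \int[leb]_(theta in quad) \int[leb]_x m theta x y).
  apply: (@tonelli_on _ _ _ _ R leb leb quad setT (fun theta y => \int[leb]_x m theta x y)) => //.
    apply: measurable_funTS.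
    have /= H := @measurable_integral2 _ _ _ _ R leb (fun (p : R * R) x => m p.1 x p.2).
    apply: H; last by move=> *; exact: kk0.
    by apply: (mm (a := fun q : (R * R) * R => q.1.1) (b := snd) (c := fun q => q.1.2)) => //;
      measurability.
  by move=> *; apply: integral_ge0 => *; exact: kk0.
transitivity (\int[leb]_y \int[leb]_x \int[leb]_(theta in quad) m theta x y).
  apply: eq_integral => y _.
  apply: (@tonelli_on _ _ _ _ R leb leb quad setT (fun theta x => m theta x y)) => //.
    by apply: measurable_funTS; exact: (mm (a := fst) (b := snd) (c := fun=> y)).
  by move=> *; exact: kk0.
pose line (x y : R) := \int[leb]_t kk x y t.
have mline d (X : measurableType d) (a b : X -> R) : measurable_fun setT a ->
    measurable_fun setT b -> measurable_fun setT (fun p => line (a p) (b p)).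
  move=> ma mb.
  have /= H := @measurable_integral2 _ _ _ _ R leb (fun (p : X) t => kk (a p) (b p) t).
  apply: H; last by move=> *; exact: kk0.
  apply: (mkk (a := fun q : X * R => a q.1) (b := fun q => b q.1) (c := snd)) => //.
    exact: measurableT_comp.
  exact: measurableT_comp.
have line0 x y : 0 <= line x y by apply: integral_ge0 => *; exact: kk0.
have Iline : \int[leb]_y \int[leb]_x line x y = 0.
  rewrite -[RHS]Ik -[RHS](ge0_int_R3_reflect v bk k0).
  etransitivity; last exact/esym/(int_R3E (reflect_borel v) (fun=> k0 _)).
  exact/esym/(swap12 (reflect_borel v) (fun=> k0 _)).
have mIline : measurable_fun setT (fun y => \int[leb]_x line x y).
  have /= H := @measurable_integral2 _ _ _ _ R leb (fun y x => line x y).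
  by apply: H => //; exact: (mline _ _ snd fst).
have Iline0 y : setT y -> 0 <= \int[leb]_x line x y.
  by move=> _; apply: integral_ge0 => *; exact: line0.
apply: (@null_integral_transfer _ _ R leb setT set0 _ _ measurableT mIline Iline0
  measurable0 (measure0 _) Iline) => y _ _ Iy.
have mly : measurable_fun setT (fun x => line x y) by exact: (mline _ _ id (fun=> y)).
apply: (@null_integral_transfer _ _ R leb setT [set (- (tan phi * y))%R] _ _ measurableT mly
  (fun x _ => line0 x y) (measurable_set1 _) (lebesgue_measure_set1 _) Iy) => x _ xy.
by apply: line_null; apply/eqP.
Qed.

End fixed_longitude.

End CollisionNullSets.

Section PostUNull.
Context (R : realType).
Local Notation V := 'rV[R]_3.
Local Notation leb := (@lebesgue_measure R).
Local Notation quad := (`]- (pi / 2), (pi / 2)[%classic : set R).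

(* [a], [b] are [tan theta cos phi] and [tan theta sin phi]. *)
Lemma projection_chart (w1 w2 w3 z1 z2 z3 a b : R) :
  w1 * w1 + w2 * w2 + w3 * w3 = 1 -> a * w3 = w1 -> b * w3 = w2 ->
  let x := (1 - w1 ^+ 2) * (z1 - z3 * a) + - (w1 * w2) * (z2 - z3 * b) in
  let y := - (w1 * w2) * (z1 - z3 * a) + (1 - w2 ^+ 2) * (z2 - z3 * b) in
  vec3 z1 z2 z3 - dot (vec3 z1 z2 z3) (vec3 w1 w2 w3) *: vec3 w1 w2 w3 =
  vec3 x y (- (a * x + b * y)).
Proof.
move=> + aE bE; rewrite -{}aE -{}bE => w1E x y.
(* This is [|w|^2 = 1] in terms of [a], [b], [w3]; the coordinates agree with those of the
   projection up to multiples of its defect. *)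
have H : w3 * w3 * (a * a + b * b + 1) = 1 by rewrite -[RHS]w1E; ring.
pose c := z1 * (a * w3) + z2 * (b * w3) + z3 * w3.
have X : x = z1 - c * (a * w3).
  transitivity (z1 - c * (a * w3) + z3 * a * (w3 * w3 * (a * a + b * b + 1) - 1)).
    by rewrite /x /c; ring.
  by rewrite H subrr mulr0 addr0.
have Y : y = z2 - c * (b * w3).
  transitivity (z2 - c * (b * w3) + z3 * b * (w3 * w3 * (a * a + b * b + 1) - 1)).
    by rewrite /y /c; ring.
  by rewrite H subrr mulr0 addr0.
have Z : - (a * x + b * y) = z3 - c * w3.
  transitivity (z3 - c * w3
    + (z3 + a * z1 + b * z2) * (w3 * w3 * (a * a + b * b + 1) - 1)).
    by rewrite X Y /c; ring.
  by rewrite H subrr mulr0 addr0.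
rewrite dot_vec3 -/c Z X Y.
by apply/rowP => -[[|[|[|//]]] i3]; rewrite !mxE/=.
Qed.

Local Open Scope ereal_scope.
Variable k : V -> \bar R.
Hypotheses (bk : borel k) (k0 : forall z, 0 <= k z) (Ik : int_R3 k = 0).

Let mquad : measurable quad. Proof. exact: measurable_itv. Qed.

Section fixed_direction.
Variables (v : V) (theta phi : R).
Hypothesis qtheta : quad theta.
Let w : V := sph (theta, phi).
Let g x y := k (v - vec3 x y (- (tan theta * (cos phi * x + sin phi * y))))%R.

Let mg : measurable_fun setT (fun p => g p.1 p.2).
Proof.
apply: (borel_mvec bk (a := fun p : R * R =>
  (v - vec3 p.1 p.2 (- (tan theta * (cos phi * p.1 + sin phi * p.2))))%R)).
by apply: mvecD; [exact: mvec_cst|apply: mvecN; apply: mvec_vec3; measurability].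
Qed.

(** For fixed [z3] the first two coordinates of the projection are affine in [(z1, z2)] with
    determinant [cos theta ^ 2], and they determine the third on the plane orthogonal to [w]. *)
Lemma projection_null : \int[leb]_x \int[leb]_y g x y = 0 ->
  int_R3 (fun z => k (v - z + dot z w *: w)%R) = 0.
Proof.
move=> Ig; pose h z := k (v - z + dot z w *: w)%R.
have bh : borel h.
  rewrite /borel; apply: (borel_mvec bk (a := fun p => (v - v3 p + dot (v3 p) w *: w)%R)).
  apply: mvecD; first by apply: mvecD; [exact: mvec_cst|apply: mvecN; exact: v3_mvec].
  by apply: mvecZ; [apply: measurable_dot; [exact: v3_mvec|exact: mvec_cst]|exact: mvec_cst].
have h0 z : 0 <= h z by exact: k0.
have ct : (cos theta != 0)%R by exact: cos_neq0_quad.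
pose a := (tan theta * cos phi)%R; pose b := (tan theta * sin phi)%R.
have tc : (tan theta * cos theta = sin theta)%R by rewrite /tan divfK.
have aE : (a * cos theta = sin theta * cos phi)%R.
  by rewrite /a mulrAC tc.
have bE : (b * cos theta = sin theta * sin phi)%R.
  by rewrite /b mulrAC tc.
have w1 := @dot_sph1 R (theta, phi); rewrite /sph/= dot_vec3 in w1.
rewrite -/h (int_R3E bh h0).
etransitivity; first exact: (swap23 bh h0).
etransitivity.
  apply: (@tonelli _ _ _ _ R leb leb (fun x z => \int[leb]_y h (vec3 x y z))).
    have /= H := @measurable_integral2 _ _ _ _ R leb
      (fun (p : R * R) y => h (vec3 p.1 y p.2)).
    by apply: H => //; apply: (borel_vec3 bh); measurability.
  by move=> *; apply: integral_ge0.
apply: integral0_eq => z3 _.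
pose w1' := (sin theta * cos phi)%R; pose w2' := (sin theta * sin phi)%R.
have D0 : ((1 - w1' ^+ 2) * (1 - w2' ^+ 2) - - (w1' * w2') * - (w1' * w2') != 0)%R.
  rewrite (_ : _ - _ = cos theta * cos theta)%R ?mulf_neq0//.
  by rewrite (_ : cos theta * cos theta = 1 - w1' * w1' - w2' * w2')%R;
    [ring|rewrite /w1' /w2'; lra].
rewrite -[RHS](@plane_affine_null R g _ _ _ _ (z3 * a) (z3 * b) D0 mg (fun _ _ => k0 _) Ig).
apply: eq_integral => z1 _; apply: eq_integral => z2 _.
have := @projection_chart w1' w2' (cos theta) z1 z2 z3 a b w1 aE bE.
rewrite /h /g /= => e; congr k.
have -> : (v - vec3 z1 z2 z3 + dot (vec3 z1 z2 z3) w *: w =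
  v - (vec3 z1 z2 z3 - dot (vec3 z1 z2 z3) w *: w))%R by rewrite opprB addrA addrAC.
rewrite -[w]/(vec3 w1' w2' (cos theta)) e; congr (v - vec3 _ _ _)%R.
by rewrite /a /b; move: (tan theta) => t; ring.
Qed.

End fixed_direction.

(** [slope_null] gives, for almost every [theta], a null integral over the plane orthogonal to [w],
    which [projection_null] lifts to space. *)
Lemma post_u_null (v : V) :
  int_R3 (fun z => int_S2 (fun w => k (v - z + dot z w *: w)%R)) = 0.
Proof.
apply: (@collision_null_quad R (fun z w => v - z + dot z w *: w)%R) => //.
- apply: mvecD.
    by apply: mvecD; [exact: mvec_cst|apply: mvecN; exact: v3_mvec].
  by apply: mvecZ; [apply: measurable_dot; exact: v3_mvec|exact: v3_mvec].
- move=> z w; congr (v - z + _)%R.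
  by apply/rowP => i; rewrite !dotE !mxE; ring.
apply: integral0_eq => phi qphi.
pose A theta := \int[leb]_x \int[leb]_y
   k (v - vec3 x y (- (tan theta * (cos phi * x + sin phi * y))))%R.
have A0 theta : quad theta -> 0 <= A theta.
  by move=> _; apply: integral_ge0 => *; apply: integral_ge0.
have mA : measurable_fun quad A.
  apply: measurable_funTS.
  have /= H := @measurable_integral2 _ _ _ _ R leb (fun theta x => \int[leb]_y
     k (v - vec3 x y (- (tan theta * (cos phi * x + sin phi * y))))%R).
  apply: H; last by move=> *; apply: integral_ge0.
  have /= H := @measurable_integral2 _ _ _ _ R leb (fun (p : R * R) y =>
     k (v - vec3 p.2 y (- (tan p.1 * (cos phi * p.2 + sin phi * y))))%R).
  apply: H => //.
  apply: (borel_mvec bk (a := fun q : (R * R) * R =>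
    (v - vec3 q.1.2 q.2 (- (tan q.1.1 * (cos phi * q.1.2 + sin phi * q.2))))%R)).
  by apply: mvecD; [exact: mvec_cst|apply: mvecN; apply: mvec_vec3; measurability].
apply: (@null_integral_transfer _ _ R leb quad set0 _ _ mquad mA A0
  measurable0 (measure0 _) (slope_null bk k0 Ik v qphi)) => theta qtheta _ Atheta.
by rewrite (projection_null qtheta Atheta) mule0.
Qed.

End PostUNull.

(** * Continuity of the gain term *)

Section GainTranslation.
Context (R : realType).
Local Notation V := 'rV[R]_3.
Local Notation leb := (@lebesgue_measure R).
Local Open Scope ereal_scope.

Definition sphere_domain : set (R * R) :=
  `[0%R, (@pi R)]%classic `*` `[0%R, (2 * @pi R)%R]%classic.

Lemma measurable_sphere_domain : measurable sphere_domain.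
Proof. by apply: measurableX; exact: measurable_itv. Qed.

Local Notation space := (prod_measure (prod_measure leb leb) leb).
Local Notation angles := (prod_measure leb leb).

(** [h] may change sign; measurability of partial integrals is applied to its positive and negative
    parts. *)
Lemma borel_int_S2 (h : V -> V -> \bar R) :
  measurable_fun setT (fun q : (R * R * R) * (R * R) => h (v3 q.1) (sph q.2)) ->
  borel (fun z => int_S2 (h z)).
Proof.
move=> mh; pose g (y : R * R * R) (p : R * R) := h (v3 y) (sph p) * (sin p.1)%:E.
have mg : measurable_fun setT (fun q => g q.1 q.2).
  by apply: emeasurable_funM => //; measurability.
have -> : borel (fun z => int_S2 (h z)) = measurable_fun setT
    (fun y => \int[angles]_(p in sphere_domain) (fun q => g q.1 q.2)^\+ (y, p) -
              \int[angles]_(p in sphere_domain) (fun q => g q.1 q.2)^\- (y, p)).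
  rewrite /borel; congr measurable_fun; apply/funext => y.
  transitivity (\int[angles]_(p in sphere_domain) g y p); first reflexivity.
  rewrite [LHS]integralE; congr (_ - _); apply: eq_integral => p _.
    by rewrite !funeposE.
  by rewrite !funenegE.
apply: emeasurable_funB.
  have /= H := @measurable_integral_on2 _ _ _ _ R angles setT sphere_domain
    (fun y p => (fun q => g q.1 q.2)^\+ (y, p)) measurableT measurable_sphere_domain.
  apply: H; last by move=> *; exact: funepos_ge0.
  apply: measurable_funTS.
  have := measurable_funepos mg; congr measurable_fun.
  by apply/funext => -[y p]; rewrite !funeposE.
have /= H := @measurable_integral_on2 _ _ _ _ R angles setT sphere_domain
  (fun y p => (fun q => g q.1 q.2)^\- (y, p)) measurableT measurable_sphere_domain.
apply: H; last by move=> *; exact: funeneg_ge0.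
apply: measurable_funTS.
have := measurable_funeneg mg; congr measurable_fun.
by apply/funext => -[y p]; rewrite !funenegE.
Qed.

Lemma int_R3_reflect (k : V -> \bar R) (v : V) : borel k ->
  int_R3 (fun u => k (v - u)%R) = int_R3 k.
Proof.
move=> bk; have mk : measurable_fun setT (fun p => k (v3 p)) := bk.
have parts (g : V -> \bar R) : int_R3 g =
    int_R3 (fun z => maxe (g z) 0) - int_R3 (fun z => maxe (- g z) 0).
  rewrite {1}/int_R3 integralE; congr (_ - _); apply: eq_integral => p _.
    by rewrite funeposE.
  by rewrite funenegE.
have bp : borel (fun z => maxe (k z) 0).
  have := measurable_funepos mk; congr measurable_fun.
  by apply/funext => y; rewrite funeposE.
have bm : borel (fun z => maxe (- k z) 0).
  have := measurable_funeneg mk; congr measurable_fun.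
  by apply/funext => y; rewrite funenegE.
rewrite [LHS]parts [RHS]parts; congr (_ - _).
  by apply: (ge0_int_R3_reflect v bp) => z; rewrite le_max lexx orbT.
by apply: (ge0_int_R3_reflect v bm) => z; rewrite le_max lexx orbT.
Qed.

Local Close Scope ereal_scope.
Variables (gamma : R) (q0 : R -> R).
Hypotheses (gamma01 : (0 < gamma <= 1)%R) (cutoff : angular_cutoff q0).

(* The integrand of [gain] in the relative velocity [z = v - u]. *)
Definition shifted_integrand (f : V -> R) (v z w : V) : R :=
  Defs.kernel gamma q0 z w * f (v - z + dot z w *: w) * f (v - dot z w *: w).

Let sph_mvec d (X : measurableType d) (a : X -> R * R) :
  measurable_fun setT a -> mvec (fun x => sph (a x)).
Proof.
move=> ma.
have m1 : measurable_fun setT (fun x => (a x).1) by exact: measurableT_comp.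
have m2 : measurable_fun setT (fun x => (a x).2) by exact: measurableT_comp.
apply: mvec_vec3; first apply: measurable_funM.
- by apply: (measurableT_comp (@measurable_sin R) (g := fun x => (a x).1)).
- by apply: (measurableT_comp (@measurable_cos R) (g := fun x => (a x).2)).
- apply: measurable_funM.
    by apply: (measurableT_comp (@measurable_sin R) (g := fun x => (a x).1)).
  by apply: (measurableT_comp (@measurable_sin R) (g := fun x => (a x).2)).
- by apply: (measurableT_comp (@measurable_cos R) (g := fun x => (a x).1)).
Qed.

Let mpost d d' (X : measurableType d) (Y : measurableType d') (f : V -> Y) (v : V)
    (a : X -> R * R * R) (b : X -> R * R) :
  borel f -> measurable_fun setT a -> measurable_fun setT b ->
  measurable_fun setT (fun x => f (v - v3 (a x) + dot (v3 (a x)) (sph (b x)) *: sph (b x))%R) /\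
  measurable_fun setT (fun x => f (v - dot (v3 (a x)) (sph (b x)) *: sph (b x))%R).
Proof.
move=> bf ma mb.
have mprod : mvec (fun x => dot (v3 (a x)) (sph (b x)) *: sph (b x)).
  apply: mvecZ; last exact: sph_mvec.
  by apply: measurable_dot; [exact: v3_mvec|exact: sph_mvec].
split.
  apply: (borel_mvec bf (a := fun x => (v - v3 (a x) + dot (v3 (a x)) (sph (b x)) *: sph (b x))%R)).
  apply: mvecD => //; apply: mvecD; first exact: mvec_cst.
  by apply: mvecN; exact: v3_mvec.
apply: (borel_mvec bf (a := fun x => (v - dot (v3 (a x)) (sph (b x)) *: sph (b x))%R)).
by apply: mvecD; [exact: mvec_cst|exact: mvecN].
Qed.

Lemma measurable_shifted_integrand (f : V -> R) (v : V) : borel f ->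
  measurable_fun setT (fun q : (R * R * R) * (R * R) =>
    (shifted_integrand f v (v3 q.1) (sph q.2))%:E).
Proof.
move=> bf; have [m1 m2] := mpost v bf (@measurable_fst _ _ (R * R * R)%type (R * R)%type)
  (@measurable_snd _ _ (R * R * R)%type (R * R)%type).
rewrite (_ : (fun q : (R * R * R) * (R * R) => _) = (fun q => (enorm (v3 q.1) `^ gamma *
    angular q0 (dot ((enorm (v3 q.1))^-1 *: v3 q.1) (sph q.2)) *
    f (v - v3 q.1 + dot (v3 q.1) (sph q.2) *: sph q.2) *
    f (v - dot (v3 q.1) (sph q.2) *: sph q.2))%:E)); last first.
  by apply/funext => q; rewrite /shifted_integrand (kernelE q0 gamma01)// dot_sph1.
apply/measurable_EFinP; apply: measurable_funM => //; apply: measurable_funM => //.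
have me : measurable_fun setT (fun q : (R * R * R) * (R * R) => enorm (v3 q.1)).
  by apply: measurable_enorm; exact: v3_mvec.
apply: measurable_funM.
  by apply: (measurableT_comp (@measurable_powR R gamma) (g := fun q => enorm (v3 q.1))).
apply: (measurableT_comp (measurable_angular cutoff)
  (g := fun q : (R * R * R) * (R * R) => dot ((enorm (v3 q.1))^-1 *: v3 q.1) (sph q.2))).
apply: measurable_dot; last exact: sph_mvec.
apply: mvecZ; last exact: v3_mvec.
by apply: (measurableT_comp (@measurable_invr R) (g := fun q => enorm (v3 q.1))).
Qed.


(** The vanishing integrals of the indicator of [N] give exceptional sets first in [z], then in the
    angles for each remaining [z]. The poles are set apart, since there the factor [sin] of [int_S2]
    vanishes. *)
Lemma collision_off_null (N : set V) (v : V) : null3 N ->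
  exists Ny : set (R * R * R), [/\ measurable Ny, space Ny = 0%E &
   forall y, ~ Ny y -> exists Np : set (R * R), [/\ measurable Np, angles Np = 0%E &
     forall p, sphere_domain p -> ~ Np p -> sin p.1 <> 0 ->
       ~ N (v - v3 y + dot (v3 y) (sph p) *: sph p) /\
       ~ N (v - dot (v3 y) (sph p) *: sph p)]].
Proof.
move=> [mN N0]; pose k (u : V) : \bar R := (\1_N u : R)%:E.
have bk : borel k by exact: borel_indic.
have k0 u : (0 <= k u)%E by rewrite lee_fin.
pose h1 z w := k (v - z + dot z w *: w); pose h2 z w := k (v - dot z w *: w).
have m12 := mpost v bk (@measurable_fst _ _ (R * R * R)%type (R * R)%type)
  (@measurable_snd _ _ (R * R * R)%type (R * R)%type).
have zero (h : V -> V -> \bar R) : (forall z w, (0 <= h z w)%E) ->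
    measurable_fun setT (fun q : (R * R * R) * (R * R) => h (v3 q.1) (sph q.2)) ->
    int_R3 (fun z => int_S2 (h z)) = 0%E ->
    exists Ny : set (R * R * R), [/\ measurable Ny, space Ny = 0%E &
     forall y, ~ Ny y -> exists Np : set (R * R), [/\ measurable Np, angles Np = 0%E &
       forall p, sphere_domain p -> ~ Np p -> sin p.1 <> 0 -> h (v3 y) (sph p) = 0%E]].
  move=> h0 mh Ih.
  have := @null_integral_ae _ _ R space setT _ measurableT (borel_int_S2 mh)
    (fun y _ => int_S2_ge0 (fun p => h0 (v3 y) _)) Ih.
  move=> [Ny [mNy Ny0 hNy]]; exists Ny; split=> // y /(hNy y I) Iy.
  have mhy : measurable_fun sphere_domain (fun p : R * R => (h (v3 y) (sph p) * (sin p.1)%:E)%E).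
    apply: measurable_funTS; apply: emeasurable_funM; last by measurability.
    apply: (measurableT_comp (g := fun p : R * R => (y, p)) mh).
    exact: pair1_measurable.
  have hy0 (p : R * R) : sphere_domain p -> (0 <= h (v3 y) (sph p) * (sin p.1)%:E)%E.
    case: p => t u [/= + _]; rewrite in_itv/= => /andP[t0 tpi].
    by apply: mule_ge0 => //; rewrite lee_fin sin_ge0_pi// t0.
  have [Np [mNp Np0 hNp]] := @null_integral_ae _ _ R angles _ _ measurable_sphere_domain mhy hy0 Iy.
  exists Np; split=> // p Dp /(hNp p Dp) + /eqP s0.
  by move/eqP; rewrite mule_eq0 eqe (negbTE s0) orbF => /eqP.
have [N1 [mN1 N10 h1N]] := zero h1 (fun _ _ => k0 _) m12.1 (post_u_null bk k0 N0 v).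
have [N2 [mN2 N20 h2N]] := zero h2 (fun _ _ => k0 _) m12.2 (post_v_null bk k0 N0 v).
have notin u : k u = 0%E -> ~ N u.
  by rewrite /k => -[] + Nu; rewrite indicE mem_set//= => /eqP; rewrite oner_eq0.
exists (N1 `|` N2); split; first exact: measurableU.
  exact: (@null_set_setU _ _ R space N1 N2 mN1 mN2 N10 N20).
move=> y Ny.
have [M1 [mM1 M10 hM1]] := h1N y (fun h => Ny (or_introl h)).
have [M2 [mM2 M20 hM2]] := h2N y (fun h => Ny (or_intror h)).
exists (M1 `|` M2); split; first exact: measurableU.
  exact: (@null_set_setU _ _ R angles M1 M2 mM1 mM2 M10 M20).
move=> p Dp Np s0; split; apply: notin.
  by apply: hM1 => // h; apply: Np; left.
by apply: hM2 => // h; apply: Np; right.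
Qed.


(** Carries an exceptional set in [z = v - u] back to the variable [u] of the gain term. *)
Lemma null_reflect (Ny : set (R * R * R)) (v : V) : measurable Ny -> space Ny = 0%E ->
  exists Nu : set (R * R * R), [/\ measurable Nu, space Nu = 0%E &
    forall y, ~ Nu y -> exists2 y', v3 y' = v - v3 y & ~ Ny y'].
Proof.
move=> mNy Ny0; pose k (z : V) : \bar R := (\1_Ny (z 0 0, z 0 1, z 0 2%:R) : R)%:E.
have v3K y : (v3 y 0 0, v3 y 0 1, v3 y 0 2%:R) = y :> R * R * R.
  by case: y => -[a b] c; rewrite !mxE.
have kE y : k (v3 y) = (\1_Ny y)%:E by rewrite /k v3K.
have bk : borel k.
  apply: (@eq_measurable_fun _ _ _ _ _ (fun y => (\1_Ny y : R)%:E)).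
    by move=> y _; exact/esym/kE.
  by apply/measurable_EFinP; exact: measurable_indic.
have Ik : int_R3 k = 0%E.
  rewrite -[RHS]Ny0 -[Ny in RHS]setIT.
  rewrite -(@integral_indic _ _ R space setT measurableT Ny mNy).
  by apply: eq_integral => y _; exact: kE.
have bkv : borel (fun u => k (v - u)).
  apply: (borel_mvec bk (a := fun p : R * R * R => v - v3 p)).
  by apply: mvecD; [exact: mvec_cst|apply: mvecN; exact: v3_mvec].
have Ikv : int_R3 (fun u => k (v - u)) = 0%E by rewrite int_R3_reflect.
have k0 u : (0 <= k u)%E by rewrite lee_fin.
have [Nu [mNu Nu0 hNu]] := @null_integral_ae _ _ R space setT _ measurableT bkv
  (fun _ _ => k0 _) Ikv.
exists Nu; split=> // y /(hNu y I) /= ky.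
exists ((v - v3 y) 0 0, (v - v3 y) 0 1, (v - v3 y) 0 2%:R); first by rewrite [RHS]vec3E.
by move=> Nyy; move: ky; rewrite /k indicE mem_set//= => -[] /eqP; rewrite oner_eq0.
Qed.

(** [f] is exchanged for [g] while the variable is still [u]; the reflection to [z] is then made in
    the Borel integrand. *)
Lemma gain_shifted (N : set V) (f g : V -> R) (v : V) : null3 N -> borel g ->
  (forall u, ~ N u -> f u = g u) ->
  gain gamma q0 f f v =
  int_R3 (fun z => int_S2 (fun w => (shifted_integrand g v z w)%:E)).
Proof.
move=> N0 bg fg; have mg := measurable_shifted_integrand v bg.
have [Nz [mNz Nz0 hNz]] := collision_off_null v N0.
rewrite -(int_R3_reflect v (borel_int_S2 mg)).
pose h z w := (shifted_integrand f v z w)%:E.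
have gainE : gain gamma q0 f f v = int_R3 (fun u => int_S2 (h (v - u))).
  apply: eq_int_R3 => u; apply: eq_int_S2 => p.
  by rewrite /h /shifted_integrand /post_u /post_v subKr.
rewrite gainE; have [Nu [mNu Nu0 hNu]] := null_reflect v mNz Nz0.
suff H y : ~ Nu y -> int_S2 (h (v - v3 y)) =
    int_S2 (fun w => (shifted_integrand g v (v - v3 y) w)%:E).
  exact: (@integral_eq_off_null _ _ R space setT Nu _ _ mNu Nu0 (fun y _ => H y)).
move=> /hNu[z <- /hNz[Np [mNp Np0 hNp]]].
suff K p : sphere_domain p -> ~ Np p -> (h (v3 z) (sph p) * (sin p.1)%:E)%E =
    ((shifted_integrand g v (v3 z) (sph p))%:E * (sin p.1)%:E)%E.
  exact: (@integral_eq_off_null _ _ R angles sphere_domain Np _ _ mNp Np0 K).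
move=> Dp /(hNp p Dp) pN.
have [->|/eqP s0] := eqVneq (sin p.1) 0; first by rewrite !mule0.
have [n1 n2] := pN s0; congr (_ * _)%E.
by rewrite /h /shifted_integrand !fg.
Qed.

End GainTranslation.

Section GaussianMoment.
Context (R : realType) (gamma : R).
Hypothesis gamma01 : 0 < gamma <= 1.
Local Notation leb := (@lebesgue_measure R).

(** The intermediate bound is [a^gamma <= 1 + a^2]. The exponent [1 / 16] leaves half of the
    Gaussian [exp(- a^2 / 8)] of the moment below, and the factor 16 lets [exp x >= 1 + x]
    conclude. *)
Lemma powR_le_gauss (a : R) : 0 <= a -> a `^ gamma <= 16 * expR (a ^+ 2 / 16).
Proof.
move=> a0; have /andP[g0 g1] := gamma01.
apply: (@le_trans _ _ (1 + a ^+ 2)); last first.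
  have := @expR_ge1Dx R (a ^+ 2 / 16); have := sqr_ge0 a.
  by move: (expR _) => e b0; lra.
have [a1|a1] := leP a 1.
  apply: (@le_trans _ _ (1 `^ gamma)).
    by rewrite ge0_ler_powR ?nnegrE// ltW.
  by rewrite powR1 lerDl sqr_ge0.
apply: (@le_trans _ _ (a `^ 1)); first by rewrite ler_powR// ltW.
by rewrite powRr1//; nra.
Qed.

Lemma gaussian_moment_lty :
  (int_R3 (fun z : 'rV[R]_3 => (enorm z `^ gamma * expR (- (enorm z ^+ 2) / 8))%:E) < +oo)%E.
Proof.
pose e (x : R) := expR (- (16^-1 * x ^+ 2)).
have le z : (0 <= (enorm z `^ gamma * expR (- (enorm z ^+ 2) / 8))%:E <=
    (16 * (e (z 0 0) * (e (z 0 1) * e (z 0 2%:R))))%:E)%E.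
  rewrite !lee_fin mulr_ge0 ?powR_ge0 ?expR_ge0//=.
  have -> : e (z 0 0) * (e (z 0 1) * e (z 0 2%:R)) =
      expR (enorm z ^+ 2 / 16) * expR (- (enorm z ^+ 2) / 8).
    by rewrite /e -!expRD sqr_enorm dotE; congr expR; lra.
  rewrite mulrA ler_wpM2r ?expR_ge0//.
  exact/powR_le_gauss/enorm_ge0.
apply: (le_lt_trans (int_R3_le le)).
have me : measurable_fun setT (fun x => (e x)%:E) by rewrite /e; measurability.
have e0 x : (0 <= (e x)%:E)%E by rewrite lee_fin expR_ge0.
pose I := (\int[leb]_x (e x)%:E)%E.
have I0 : (0 <= I)%E by apply: integral_ge0 => x _; exact: e0.
have Ifin : I \is a fin_num.
  by rewrite ge0_fin_numE//; apply: gauss_integral_lty; rewrite invr_gt0.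
have bE : borel (fun z : 'rV[R]_3 => (16 * (e (z 0 0) * (e (z 0 1) * e (z 0 2%:R))))%:E).
  apply: (@eq_borel _ _ _ _ (fun a b c => (16 * (e a * (e b * e c)))%:E)).
    by move=> a b c; rewrite !mxE.
  by rewrite /e; measurability.
have E0 (z : 'rV[R]_3) : (0 <= (16 * (e (z 0 0) * (e (z 0 1) * e (z 0 2%:R))))%:E)%E.
  by case/andP: (le z) => h1 h2; exact: le_trans h2.
have i0 : 0 <= fine I by apply: fine_ge0.
have scale (c : R) : 0 <= c -> (\int[leb]_x (c * e x)%:E = (c * fine I)%:E)%E.
  move=> c0; rewrite EFinM fineK// /I -ge0_integralZl//.
rewrite (int_R3E bE E0) (_ : (\int[leb]_x _)%E = (16 * fine I * fine I * fine I)%:E) ?ltry//.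
rewrite -(scale (16 * fine I * fine I)); last by rewrite !mulr_ge0.
apply: eq_integral => x _.
rewrite (_ : 16 * fine I * fine I * e x = 16 * fine I * e x * fine I); last by ring.
rewrite -scale; last by rewrite !mulr_ge0 ?expR_ge0.
apply: eq_integral => y _.
rewrite (_ : 16 * fine I * e x * e y = 16 * e x * e y * fine I); last by ring.
rewrite -scale; last by rewrite !mulr_ge0 ?expR_ge0.
by apply: eq_integral => z _; rewrite !mxE/=; congr EFin; ring.
Qed.

End GaussianMoment.

Section DominatedConvergence.
Context (R : realType) (gamma rho beta : R) (q0 : R -> R).
Local Notation V := 'rV[R]_3.
Local Notation leb := (@lebesgue_measure R).
Local Notation space := (prod_measure (prod_measure leb leb) leb).
Local Notation angles := (prod_measure leb leb).
Hypotheses (gamma01 : 0 < gamma <= 1) (cutoff : angular_cutoff q0).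
Hypothesis beta0 : 0 < beta.
Local Notation wbar := (wbar rho beta).
Local Notation kernel := (Defs.kernel gamma q0).
Local Notation shifted := (shifted_integrand gamma q0).

Let gaussian (C : R) (z : V) := C * expR (- (enorm z ^+ 2) / 8).

(** The dominating function must not vary with [v]: [exp(- |v - z|^2 / 4) <= exp(|v|^2 / 4) exp(-
    |z|^2 / 8)] amounts to [|2 v - z|^2 >= 0], and [|v|^2 <= B] along the sequence. *)
Lemma shifted_integrand_le (g : V -> R) (M B : R) v z w : dot w w = 1 ->
  (forall u, `|g u| <= M * wbar u) -> dot v v <= B ->
  `|shifted g v z w| <= kernel z w * gaussian (M ^+ 2 * expR (B / 4)) z.
Proof.
move=> w1 gM vB.
have := gain_integrand_le gamma01 cutoff beta0 (v - z) v w1 gM.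
rewrite /post_u /post_v subKr => h; apply: (le_trans h).
apply: ler_wpM2l; first exact: (kernel_ge0 gamma01 cutoff).
rewrite /gaussian -[leLHS]mulrA -[leRHS]mulrA; apply: ler_wpM2l; first exact: sqr_ge0.
have [w0 wle] := (wbar_gt0 rho beta v, wbar_le1 rho beta0 v).
apply: (@le_trans _ _ (expR (- enorm (v - z) ^+ 2 / 4))).
  by rewrite ler_piMl// expR_ge0.
rewrite -expRD ler_expR !sqr_enorm.
have -> : dot (v - z) (v - z) = dot v v + dot z z - 2 * dot v z.
  by rewrite !dotE !mxE; ring.
have : 0 <= dot (2 *: v - z) (2 *: v - z) by exact: dot_ge0.
have -> : dot (2 *: v - z) (2 *: v - z) = 4 * dot v v + dot z z - 4 * dot v z.
  by rewrite !dotE !mxE; ring.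
by lra.
Qed.

(** The kernel is the shifted integrand of the constant 1. *)
Lemma measurable_kernel : measurable_fun setT (fun q : (R * R * R) * (R * R) =>
  kernel (v3 q.1) (sph q.2)).
Proof.
have b1 : borel (fun _ : V => 1 : measurableTypeR R) by exact: measurable_cst.
have := measurable_shifted_integrand gamma01 cutoff 0 b1.
move/measurable_EFinP; congr measurable_fun.
by apply/funext => q; rewrite /shifted_integrand !mulr1.
Qed.

Variables (g_ : nat -> V -> R) (g : V -> R) (N_ : nat -> set V) (N : set V).
Variables (v_ : nat -> V) (v : V) (M : R).
Hypotheses (null_ : forall n, null3 (N_ n)) (nullN : null3 N).
Hypotheses (bg_ : forall n, borel (g_ n)) (bg : borel g).
Hypothesis g_M : forall n u, `|g_ n u| <= M * wbar u.
Hypothesis v_v : v_ @ \oo --> v.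
Hypothesis g_cvg : forall (p_ : nat -> V) p, (forall n, ~ N_ n (p_ n)) -> ~ N p ->
  p_ @ \oo --> p -> g_ n (p_ n) @[n --> \oo] --> g p.

Let square_bound : exists B, forall n, dot (v_ n) (v_ n) <= B.
Proof.
have cvi (i : 'I_3) : v_ n 0 i @[n --> \oo] --> v 0 i.
  apply: (@cvg_comp _ _ _ v_ (fun w : V => w 0 i) \oo (nbhs v) (nbhs (v 0 i)) v_v).
  exact: (@coord_continuous R 1 3 0 i v).
have : dot (v_ n) (v_ n) @[n --> \oo] --> dot v v.
  rewrite (_ : (fun n => dot (v_ n) (v_ n)) = fun n => v_ n 0 0 * v_ n 0 0 +
    v_ n 0 1 * v_ n 0 1 + v_ n 0 2%:R * v_ n 0 2%:R); last first.
    by apply/funext => n; rewrite dotE.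
  by rewrite dotE; apply: cvgD; first apply: cvgD; apply: cvgM; exact: cvi.
move=> c; have /cvg_seq_bounded : cvgn (fun n => dot (v_ n) (v_ n)) by apply/cvg_ex; exists (dot v v).
move=> [B [_ HB]]; exists (`|B| + 1) => n.
have := HB (`|B| + 1); move: (ler_norm B) => h /(_ _ n I)-h2.
by apply: (le_trans (ler_norm _)); apply: h2; lra.
Qed.

(** Each term of the sequence and the limit have their own exceptional sets; countably many are
    joined, in [z] and then in the angles. *)
Let good_points : exists Ny : set (R * R * R), [/\ measurable Ny, space Ny = 0%E &
   forall y, ~ Ny y -> exists Np : set (R * R), [/\ measurable Np, angles Np = 0%E &
     forall p, sphere_domain p -> ~ Np p -> sin p.1 <> 0 ->
       shifted (g_ n) (v_ n) (v3 y) (sph p) @[n --> \oo] --> shifted g v (v3 y) (sph p)]].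
Proof.
pose A n := projT1 (cid (collision_off_null (v_ n) (null_ n))).
have AP n := projT2 (cid (collision_off_null (v_ n) (null_ n))).
have [A0 [mA0 A00 hA0]] := collision_off_null v nullN.
have mA n : measurable (A n) by case: (AP n).
have mU : measurable (\bigcup_n A n) by exact: bigcupT_measurable.
exists (\bigcup_n A n `|` A0); split; first exact: measurableU.
  have A0n n : space (A n) = 0%E by case: (AP n).
  exact: (@null_set_setU _ _ R space _ _ mU mA0 (@measure_bigcup0 R _ _ space nat A mA A0n) A00).
move=> y Ny.
have [Q0 [mQ0 Q00 hQ0]] := hA0 y (fun h => Ny (or_intror h)).
have NA n : ~ A n y by move=> h; apply: Ny; left; exists n.
have BP n : exists Np : set (R * R), [/\ measurable Np, angles Np = 0%E &
     forall p, sphere_domain p -> ~ Np p -> sin p.1 <> 0 ->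
       ~ N_ n (v_ n - v3 y + dot (v3 y) (sph p) *: sph p) /\
       ~ N_ n (v_ n - dot (v3 y) (sph p) *: sph p)].
  by case: (AP n) => _ _; apply; exact: NA.
pose Q n := projT1 (cid (BP n)); have QP n := projT2 (cid (BP n)).
have mQ n : measurable (Q n) by case: (QP n).
have mQU : measurable (\bigcup_n Q n) by exact: bigcupT_measurable.
exists (\bigcup_n Q n `|` Q0); split; first exact: measurableU.
  have Q0n n : angles (Q n) = 0%E by case: (QP n).
  exact: (@null_set_setU _ _ R angles _ _ mQU mQ0 (@measure_bigcup0 R _ _ angles nat Q mQ Q0n) Q00).
move=> p Dp Np s0.
have [n1 n2] := hQ0 p Dp (fun h => Np (or_intror h)) s0.
have nn n : ~ N_ n (v_ n - v3 y + dot (v3 y) (sph p) *: sph p) /\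
       ~ N_ n (v_ n - dot (v3 y) (sph p) *: sph p).
  by case: (QP n) => _ _; apply => // h; apply: Np; left; exists n.
apply: cvgM; first apply: cvgM; first exact: cvg_cst.
  apply: g_cvg => //; first by move=> n; case: (nn n).
  by apply: cvgD; [apply: cvgB => //; exact: cvg_cst|exact: cvg_cst].
apply: g_cvg => //; first by move=> n; case: (nn n).
by apply: cvgB => //; exact: cvg_cst.
Qed.

(** [g_cvg] lets the arguments move with [n] while avoiding [N_ n], as the two post-collisional
    velocities do. The inner dominating function is the kernel times a Gaussian, the outer one its
    integral over the sphere. *)
Lemma shifted_integral_cvg :
  int_R3 (fun z => int_S2 (fun w => (shifted (g_ n) (v_ n) z w)%:E)) @[n --> \oo] -->
  int_R3 (fun z => int_S2 (fun w => (shifted g v z w)%:E)).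
Proof.
have [B vB] := square_bound; have [Ny [mNy Ny0 hNy]] := good_points.
pose C := M ^+ 2 * expR (B / 4).
have C0 : 0 <= C by apply: mulr_ge0; [exact: sqr_ge0|exact: expR_ge0].
have G0 z : 0 <= gaussian C z by apply: mulr_ge0 => //; exact: expR_ge0.
have ge_le n z p : `|shifted (g_ n) (v_ n) z (sph p)| <= kernel z (sph p) * gaussian C z.
  by apply: shifted_integrand_le => //; exact: dot_sph1.
have ms_ n := measurable_shifted_integrand gamma01 cutoff (v_ n) (bg_ n).
have ms := measurable_shifted_integrand gamma01 cutoff v bg.
have sin0 (p : R * R) : sphere_domain p -> 0 <= sin p.1.
  by case: p => t u [/= + _]; rewrite in_itv/= => /andP[t0 tpi]; rewrite sin_ge0_pi// t0.
have msin : measurable_fun setT (fun p : R * R => (sin p.1)%:E) by measurability.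
have section (h : (R * R * R) * (R * R) -> \bar R) y : measurable_fun setT h ->
    measurable_fun setT (fun p => h (y, p)).
  by move=> mh; apply: (measurableT_comp mh (g := fun p => (y, p))); exact: pair1_measurable.
have k0 z p : 0 <= kernel z (sph p) by apply: (kernel_ge0 gamma01 cutoff); exact: dot_sph1.
have inner y : ~ Ny y ->
    int_S2 (fun w => (shifted (g_ n) (v_ n) (v3 y) w)%:E) @[n --> \oo] -->
    int_S2 (fun w => (shifted g v (v3 y) w)%:E).
  move=> /hNy[Np [mNp Np0 hNp]].
  pose G (p : R * R) := ((kernel (v3 y) (sph p) * gaussian C (v3 y))%:E * (sin p.1)%:E)%E.
  have mG : measurable_fun setT G.
    apply: emeasurable_funM => //; apply/measurable_EFinP.
    apply: measurable_funM; last exact: measurable_cst.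
    apply: (measurableT_comp measurable_kernel (g := fun p : R * R => (y, p))).
    exact: pair1_measurable.
  have Gpos p : sphere_domain p -> (0 <= G p)%E.
    move=> /sin0 sp; apply: mule_ge0; last by rewrite lee_fin.
    by rewrite lee_fin mulr_ge0.
  have iG : angles.-integrable (@sphere_domain R) G.
    apply/integrableP; split; first exact: measurable_funTS.
    rewrite (_ : (\int[angles]_(p in @sphere_domain R) `|G p|)%E =
      int_S2 (fun w => (kernel (v3 y) w * gaussian C (v3 y))%:E)); last first.
      by apply: eq_integral => p /set_mem Dp; rewrite gee0_abs// Gpos.
    rewrite (int_S2_kernel gamma01 cutoff)// lte_mul_pinfty//.
      by rewrite lee_fin mulr_ge0// powR_ge0.
    by rewrite -ge0_fin_numE ?(angular_mass_ge0 cutoff)// (angular_mass_fin cutoff).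
  have [] := @dominated_convergence _ _ R angles (@sphere_domain R) (@measurable_sphere_domain R)
    (fun n p => (shifted (g_ n) (v_ n) (v3 y) (sph p))%:E * (sin p.1)%:E)%E
    (fun p => (shifted g v (v3 y) (sph p))%:E * (sin p.1)%:E)%E G.
  - move=> n; apply: measurable_funTS; apply: emeasurable_funM => //.
    exact: (section _ y (ms_ n)).
  - apply: measurable_funTS; apply: emeasurable_funM => //; exact: (section _ y ms).
  - exists Np; split=> // p /= /not_implyP[Dp nc]; apply: contrapT => Npp; apply: nc.
    (* At the poles both sides carry the factor 0. *)
    have [s0|/eqP s0] := eqVneq (sin p.1) 0.
      rewrite s0 mule0 (_ : (fun n => _) = fun=> 0%E); first exact: cvg_cst.
      by apply/funext => n; rewrite mule0.
    rewrite -EFinM (_ : (fun n => _) = fun n =>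
      (shifted (g_ n) (v_ n) (v3 y) (sph p) * sin p.1)%:E); last first.
      by apply/funext => n; rewrite EFinM.
    apply: cvg_EFin; first by near=> n.
    by apply: cvgM; [exact: hNp|exact: cvg_cst].
  - exact: iG.
  - apply: aeW => p n Dp; rewrite abseM /G.
    have -> : (`|(sin p.1)%:E| = (sin p.1)%:E)%E.
      by apply: gee0_abs; rewrite lee_fin; exact: sin0.
    by apply: lee_wpmul2r; rewrite lee_fin; [exact: sin0|exact: ge_le].
  by move=> _ _.
have mH_ n := @borel_int_S2 R (fun z w => (shifted (g_ n) (v_ n) z w)%:E) (ms_ n).
have mH := @borel_int_S2 R (fun z w => (shifted g v z w)%:E) ms.
pose G (y : R * R * R) : \bar R :=
  ((enorm (v3 y) `^ gamma * gaussian C (v3 y))%:E * angular_mass q0)%E.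
have Gpos y : (0 <= G y)%E.
  by apply: mule_ge0; [rewrite lee_fin mulr_ge0// powR_ge0|exact: (angular_mass_ge0 cutoff)].
have GE y : G y = ((C * fine (angular_mass q0))%:E *
    (enorm (v3 y) `^ gamma * expR (- (enorm (v3 y) ^+ 2) / 8))%:E)%E.
  rewrite /G -(fineK (angular_mass_fin cutoff)) -!EFinM /gaussian; congr EFin; ring.
have bmom : borel (fun z : V => (enorm z `^ gamma * expR (- (enorm z ^+ 2) / 8))%:E).
  by measurability.
have mG : measurable_fun setT G.
  rewrite (_ : G = fun y => ((C * fine (angular_mass q0))%:E *
    (enorm (v3 y) `^ gamma * expR (- (enorm (v3 y) ^+ 2) / 8))%:E)%E); last exact/funext.
  by apply: emeasurable_funM; [exact: measurable_cst|exact: bmom].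
have iG : space.-integrable setT G.
  apply/integrableP; split => //.
  have am0 : 0 <= fine (angular_mass q0) by apply: fine_ge0; exact: (angular_mass_ge0 cutoff).
  rewrite (_ : (\int[space]_y `|G y|)%E = ((C * fine (angular_mass q0))%:E *
     int_R3 (fun z : V => (enorm z `^ gamma * expR (- (enorm z ^+ 2) / 8))%:E))%E).
    apply: lte_mul_pinfty; [by rewrite lee_fin mulr_ge0|by []|exact: gaussian_moment_lty].
  rewrite -(int_R3Z _ bmom); last 2 first.
  - by rewrite mulr_ge0.
  - by move=> z; rewrite lee_fin mulr_ge0 ?powR_ge0 ?expR_ge0.
  by apply: eq_integral => y _; rewrite gee0_abs// GE.
have [] := @dominated_convergence _ _ R space setT measurableT
  (fun n y => int_S2 (fun w => (shifted (g_ n) (v_ n) (v3 y) w)%:E))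
  (fun y => int_S2 (fun w => (shifted g v (v3 y) w)%:E)) G mH_ mH.
- exists Ny; split=> // y /= /not_implyP[_ nc]; apply: contrapT => Nyy; apply: nc.
  exact: inner.
- exact: iG.
- apply: aeW => y n _; rewrite /G -(int_S2_kernel gamma01 cutoff)//.
  by apply: int_S2_abs_le => p; rewrite lee_fin.
by move=> _ _.
Unshelve. all: by end_near.
Qed.

End DominatedConvergence.

(** * Limits within a set along sequences *)

Section WithinSequences.
Context (R : realType) (X : pseudoMetricType R) (Y : topologicalType).
Variables (A : set X) (G : X -> Y) (p : X).

(** Dominated convergence is sequential. A failure of the limit yields, in each ball of radius
    [1 / (n + 1)], a point of [A] with value outside a fixed neighbourhood [W]. *)
Lemma within_cvg_seq :
  (forall s : nat -> X, (forall n, A (s n)) -> s @ \oo --> p ->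
     G (s n) @[n --> \oo] --> G p) ->
  G x @[x --> within A (nbhs p)] --> G p.
Proof.
move=> H W nW; apply: contrapT => no.
have next n : exists q, [/\ ball p n.+1%:R^-1 q, A q & ~ W (G q)].
  apply: contrapT => nex; apply: no.
  suff : \forall q \near p, A q -> W (G q) by [].
  apply/nbhs_ballP; exists n.+1%:R^-1; first by rewrite /= invr_gt0 ltr0n.
  by move=> q pq Aq; apply: contrapT => Wq; apply: nex; exists q.
pose s n := projT1 (cid (next n)); have sP n := projT2 (cid (next n)).
have sA n : A (s n) by case: (sP n).
have sp : s @ \oo --> p.
  apply/cvg_ballP => e e0; near=> n.
  have [pn _ _] := sP n; apply: le_ball pn; apply: ltW.
  by near: n; exact: near_infty_natSinv_lt (PosNum e0).
have /filter_ex[n Wn] : \forall n \near \oo, W (G (s n)) by exact: (H s sA sp W nW).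
by case: (sP n) => _ _; exact.
Unshelve. all: by end_near.
Qed.

Lemma seq_cvg_within (s : nat -> X) : G x @[x --> within A (nbhs p)] --> G p ->
  (forall n, A (s n)) -> s @ \oo --> p -> G (s n) @[n --> \oo] --> G p.
Proof.
move=> cG sA sp W nW.
have nW' : nbhs p [set q | A q -> W (G q)] by exact: (cG _ nW).
have := sp _ nW'; apply: (@filterS _ \oo _ (fun n => A (s n) -> W (G (s n)))) => n; exact.
Qed.

End WithinSequences.

Section BoltzmannGain.
Context (R : realType).
Local Notation V := 'rV[R]_3.
Variables (Omega : set V) (T : R) (F : R -> V -> V -> R).
Hypotheses (oO : open Omega) (bO : bounded_set Omega) (sO : smooth_boundary Omega).
Let S := `[0, T] `*` ((Omega `*` [set: V]) `\` grazing Omega).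
Hypothesis cF : {within S,
  continuous (fun p : R * (V * V) => F p.1 p.2.1 p.2.2)}.

Let cF_at t x v : t \in `[0, T] -> Omega x -> ~ grazing Omega (x, v) ->
  F p.1 p.2.1 p.2.2 @[p --> within S (nbhs (t, (x, v)))] --> F t x v.
Proof.
by move=> tT Ox gv; move/subspace_continuousP : cF => /(_ (t, (x, v))); apply.
Qed.

(* Modifying [F] on a Borel null set containing the grazing velocities makes it
   Borel without changing its gain term. *)
Definition ungrazed t x v : R :=
  if `[< grazing_hull Omega x v >] then 0 else F t x v.

Let ungrazedE t x v : ~ grazing_hull Omega x v -> F t x v = ungrazed t x v.
Proof. by rewrite /ungrazed; case: asboolP. Qed.

(** Off the hull [F t x] is continuous relative to the non-grazing velocities, so each superlevel
    set is there the trace of an open set [O]; on the hull the value is 0. *)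
Lemma borel_ungrazed t x : t \in `[0, T] -> Omega x -> borel (ungrazed t x).
Proof.
move=> tT Ox; have [mH _] := null3_grazing_hull oO bO Ox.
rewrite /borel; apply: (measurability _ (RGenOInfty.measurableE R)) => //.
move=> _ [_ [c ->] <-]; rewrite setTI.
(* Grazing velocities are included so that relative continuity yields a full neighbourhood. *)
pose O := interior [set u | grazing Omega (x, u) \/ c < F t x u].
have -> : (fun p : R * R * R => ungrazed t x (vec3 p.1.1 p.1.2 p.2)) @^-1` `]c, +oo[%classic =
    (@v3 R @^-1` O `\` @v3 R @^-1` grazing_hull Omega x) `|`
    (if c < 0 then @v3 R @^-1` grazing_hull Omega x else set0).
  apply/seteqP; split => p /=; rewrite in_itv/= andbT -[vec3 _ _ _]/(v3 p) /ungrazed.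
    case: asboolP => [Hp c0|Hp cFp]; first by right; rewrite c0.
    left; split => //; rewrite /O /= /interior/=.
    have gp : ~ grazing Omega (x, v3 p) by move/(grazing_sub_hull oO bO Ox sO).
    have nW : nbhs (F t x (v3 p)) [set r | c < r] by apply: open_nbhs_nbhs; split => //; exact: open_gt.
    have near_S : \forall q \near (t, (x, v3 p)), S q -> c < F q.1 q.2.1 q.2.2.
      exact: (cF_at tT Ox gp nW).
    have cv : (fun u : V => (t, (x, u))) @ nbhs (v3 p) --> nbhs (t, (x, v3 p)).
      apply: (@cvg_pair _ _ _ (nbhs (v3 p)) (nbhs t) (nbhs (x, v3 p)) _ _ _ (fun=> t) (fun u => (x, u))).
        exact: cvg_cst.
      apply: (@cvg_pair _ _ _ (nbhs (v3 p)) (nbhs x) (nbhs (v3 p)) _ _ _ (fun=> x) id).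
        exact: cvg_cst.
      exact: cvg_id.
    have := cv _ near_S.
    apply: (@filterS _ (nbhs (v3 p)) _ (fun u => S (t, (x, u)) -> c < F t x u)) => u Su.
    have [gu|gu] := pselect (grazing Omega (x, u)); first by left.
    by right; apply: Su.
  case=> [[Op Hp]|].
    case: asboolP => // _; have /= [gp|//] := interior_subset Op.
    by exfalso; apply: Hp; exact: (grazing_sub_hull oO bO Ox sO gp).
  by case: ifPn => // c0; case: asboolP.
apply: measurableU; last by case: ifP.
by apply: measurableD => //; apply: open_measurable3; exact: open_interior.
Qed.

Variables (gamma rho beta : R) (q0 : R -> R) (M : R).
Hypotheses (gamma01 : 0 < gamma <= 1) (cutoff : angular_cutoff q0) (beta0 : 0 < beta).
Hypothesis M0 : 0 <= M.
Hypothesis FM : forall t x v, t \in `[0, T] -> Omega x -> `|F t x v| <= M * wbar rho beta v.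

Lemma gain_continuous : {within `[0, T] `*` (Omega `*` [set: V]),
    continuous (fun p : R * (V * V) =>
      gain gamma q0 (F p.1 p.2.1) (F p.1 p.2.1) p.2.2)}.
Proof.
apply/subspace_continuousP => -[t [x v]] [/= tT [/= Ox _]].
apply: within_cvg_seq => s sA sp.
have sT n : (s n).1 \in `[0, T] by case: (sA n).
have sx n : Omega (s n).2.1 by case: (sA n) => _ [].
have t_t : (s n).1 @[n --> \oo] --> t by exact: (cvg_comp _ _ sp cvg_fst).
have xv_xv : (s n).2 @[n --> \oo] --> (x, v) by exact: (cvg_comp _ _ sp cvg_snd).
have x_x : (s n).2.1 @[n --> \oo] --> x by exact: (cvg_comp _ _ xv_xv cvg_fst).
have v_v : (s n).2.2 @[n --> \oo] --> v by exact: (cvg_comp _ _ xv_xv cvg_snd).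
have E t' x' v' : t' \in `[0, T] -> Omega x' -> gain gamma q0 (F t' x') (F t' x') v' =
    int_R3 (fun z => int_S2 (fun w =>
      (shifted_integrand gamma q0 (ungrazed t' x') v' z w)%:E)).
  move=> t'T Ox'; apply: (gain_shifted gamma01 cutoff _ (null3_grazing_hull oO bO Ox')).
    exact: borel_ungrazed.
  exact: ungrazedE.
rewrite /= E// (_ : (fun n => gain _ _ _ _ _) = fun n => int_R3 (fun z => int_S2 (fun w =>
    (shifted_integrand gamma q0 (ungrazed (s n).1 (s n).2.1) (s n).2.2 z w)%:E))); last first.
  by apply/funext => n; rewrite E.
apply: (@shifted_integral_cvg _ _ rho beta _ gamma01 cutoff beta0 _ _
  (fun n => grazing_hull Omega (s n).2.1) (grazing_hull Omega x) _ v M).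
- by move=> n; exact: null3_grazing_hull.
- exact: null3_grazing_hull.
- by move=> n; exact: borel_ungrazed.
- exact: borel_ungrazed.
- move=> n u; rewrite /ungrazed; case: asboolP => _; last exact: FM.
  by rewrite normr0 mulr_ge0// ltW// wbar_gt0.
- exact: v_v.
(* Off the hulls [ungrazed] is [F], and the points stay in the set on which [F] is continuous. *)
move=> p_ p Hp_ Hp pp; rewrite -ungrazedE//.
rewrite (_ : (fun n => _) = fun n => F (s n).1 (s n).2.1 (p_ n)); last first.
  by apply/funext => n; rewrite -ungrazedE.
have gp : ~ grazing Omega (x, p) by move/(grazing_sub_hull oO bO Ox sO).
apply: (seq_cvg_within (G := fun q : R * (V * V) => F q.1 q.2.1 q.2.2)
  (s := fun n => ((s n).1, ((s n).2.1, p_ n))) (cF_at tT Ox gp)).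
  move=> n; split=> //=; split => // gn; apply: (Hp_ n).
  exact: (grazing_sub_hull oO bO (sx n) sO gn).
exact: (cvg_pair t_t (cvg_pair x_x pp)).
Qed.

End BoltzmannGain.

Theorem theorem4 (R : realType) (Omega : set 'rV[R]_3)
  (T gamma rho beta : R) (q0 : R -> R)
  (F : R -> 'rV[R]_3 -> 'rV[R]_3 -> R) :
  open Omega -> bounded_set Omega -> connected Omega ->
  smooth_boundary Omega ->
  0 < T -> 0 < gamma <= 1 -> angular_cutoff q0 -> 0 < beta ->
  {within `[0, T] `*` ((Omega `*` [set: 'rV[R]_3]) `\` grazing Omega),
    continuous (fun p : R * ('rV[R]_3 * 'rV[R]_3) => F p.1 p.2.1 p.2.2)} ->
  (sup_norm_on (`[0%R, T] `*` (closure Omega `*` [set: 'rV[R]_3]))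
     (fun p => ((wbar rho beta p.2.2)^-1 * F p.1 p.2.1 p.2.2)%:E) < +oo)%E ->
  {within `[0, T] `*` (Omega `*` [set: 'rV[R]_3]),
    continuous (fun p : R * ('rV[R]_3 * 'rV[R]_3) =>
      gain gamma q0 (F p.1 p.2.1) (F p.1 p.2.1) p.2.2)} /\
  (sup_norm_on (`[0%R, T] `*` (closure Omega `*` [set: 'rV[R]_3]))
     (fun p => (nu gamma q0 p.2.2)^-1 * ((wbar rho beta p.2.2)^-1)%:E *
       gain gamma q0 (F p.1 p.2.1) (F p.1 p.2.1) p.2.2) < +oo)%E.
Proof.
move=> oO bO _ sO _ gamma01 cutoff beta0 cF; set s := sup_norm_on _ _ => s_fin.
(* For empty [Omega] the supremum is -oo; the maximum with 0 keeps [M] nonnegative. *)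
pose M := fine (maxe 0%E s).
have M0 : 0 <= M by apply: fine_ge0; rewrite le_max lexx.
have FM t x v : t \in `[0, T] -> closure Omega x -> `|F t x v| <= M * wbar rho beta v.
  move=> tT Ox; have w0 := wbar_gt0 rho beta v.
  have le_s : (`|(wbar rho beta v)^-1 * F t x v|%:E <= maxe 0%E s)%E.
    rewrite le_max; apply/orP; right.
    by apply: ereal_sup_ubound; exists (t, (x, v)).
  rewrite mulrC -ler_pdivrMl//.
  rewrite -(gtr0_norm w0) -normfV -normrM -lee_fin (le_trans le_s)// /M fineK//.
  by rewrite ge0_fin_numE ?le_max ?lexx// gt_max ltry s_fin.
split.
  apply: (gain_continuous oO bO sO cF gamma01 cutoff beta0 M0) => t x v tT Ox.
  by apply: FM => //; exact: subset_closure.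
(* The estimate is pointwise in [(t, x)] and so covers the boundary points of [Omega]. *)
apply: (@le_lt_trans _ _ (M ^+ 2 * (Num.sqrt 2 ^+ 3 * 4))%:E); last exact: ltry.
apply: ge_ereal_sup => _ [[t [x v]] [/= tT [/= Ox _]] <-].
by apply: weighted_gain_le => // u; exact: FM.
Qed.
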